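(* Let $\Gamma$ be a compact metric graph with any combination of Dirichlet and Neumann conditions at its leaves (if it has any) and Kirchhoff conditions at all other vertices. Let $N\ge 0$ be the number of Neumann leaves and $\beta\ge 0$ the number of independent cycles (first Betti number) of $\Gamma$, and let $k,j$ be integers with $k>j\ge N+\beta+1$. Then $$\frac{\lambda_k(\Gamma)}{\lambda_j(\Gamma)}\le 4\cdot\frac{k^2}{(j-(N+\beta))^2}.$$
   Context: A compact metric graph $\Gamma=(\mathcal V,\mathcal E)$ has finitely many vertices and edges; each edge $e$ is identified with an interval $[0,\ell_e]$, $0<\ell_e<\infty$, whose endpoints are attached to vertices; loops and parallel edges are permitted; $\Gamma$ is connected. Its first Betti number is $\beta=|\mathcal E|-|\mathcal V|+1$. A leaf is a vertex of degree one (a loop counts twice in the degree). $C(\Gamma)$ denotes the continuous functions on $\Gamma$ and $H^1(\Gamma)=\{f\in C(\Gamma): f|_e\in H^1(e)\ \forall e\in\mathcal E\}$. For a finite set $V_D$ of vertices, the Laplacian on $\Gamma$ with Dirichlet conditions at $V_D$ is the self-adjoint operator on $L^2(\Gamma)$ associated with the form $\int_\Gamma f'\overline{g}'\,dx$ on the set of $f\in H^1(\Gamma)$ vanishing on $V_D$. It acts as $-f''$ on each edge; functions in its domain vanish on $V_D$ and satisfy at all other vertices the Kirchhoff condition (continuity, and the sum of the derivatives along all incident edges, all oriented into the vertex, is zero), which at a leaf is the Neumann condition. Here $V_D$ is a (possibly empty) subset of the set of leaves; the leaves in $V_D$ are the Dirichlet leaves and those not in $V_D$ are the Neumann leaves.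 The eigenvalues, counted with multiplicity, are $\lambda_1(\Gamma)\le\lambda_2(\Gamma)\le\dots$. *)

(* Defs.v *)
From mathcomp Require Import all_boot all_order all_algebra.
From mathcomp Require Import all_classical all_reals all_analysis.
From mathcomp Require Import complex.

Set Implicit Arguments.
Unset Strict Implicit.
Unset Printing Implicit Defensive.

Import Order.TTheory GRing.Theory Num.Theory.
Import numFieldNormedType.Exports.

Local Open Scope classical_set_scope.
Local Open Scope ring_scope.
Local Open Scope card_scope.
Local Open Scope complex_scope.

(* The edge [e] is the interval [0, len e]; [endpt (e, false)] is the vertex
   to which its endpoint 0 is attached and [endpt (e, true)] the one to which
   its endpoint [len e] is attached. Loops and parallel edges are allowed. *)
Record metric_graph (R : realType) := MetricGraph {
  vert : finType;
  edge : finType;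
  len : edge -> R;
  endpt : edge * bool -> vert;
  len_gt0 : forall e, 0 < len e;
  vert_inhabited : (0 < #|vert|)%N;
  graph_connected : forall u v,
    connect [rel x y | [exists e, exists b,
      (endpt (e, b) == x) && (endpt (e, ~~ b) == y)]] u v }.

Section Graph.
Context {R : realType} (G : metric_graph R).

(* A loop at [v] contributes both of its endpoints. *)
Definition degree (v : vert G) : nat :=
  #|[set p : edge G * bool | endpt p == v]%SET|.

Definition leaf (v : vert G) : bool := degree v == 1%N.

(* |E| - |V| + 1; the subtraction of naturals is not truncated here, since
   |V| <= |E| + 1 by connectedness. *)
Definition betti : nat := (#|edge G| + 1 - #|vert G|)%N.

Definition num_neumann_leaves (VD : {set vert G}) : nat :=
  #|[set v | leaf v & v \notin VD]%SET|.

(* Functions on the graph are given edgewise; their values outside the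
   intervals [0, len e] are irrelevant. *)
Definition graph_fun := edge G -> R -> R[i].

Definition endval (f : graph_fun) (p : edge G * bool) : R[i] :=
  f p.1 (if p.2 then len p.1 else 0).

Definition graph_continuous (f : graph_fun) : Prop :=
  (forall e, {within `[0, len e], continuous (@complex.Re R \o f e)} /\
             {within `[0, len e], continuous (@complex.Im R \o f e)}) /\
  (forall p q, endpt p = endpt q -> endval f p = endval f q).

(* Integral over [0, l] of a complex-valued function. *)
Definition cintegral (l : R) (f : R -> R[i]) : R[i] :=
  Rintegral lebesgue_measure `[0, l] (@complex.Re R \o f) +i*
  Rintegral lebesgue_measure `[0, l] (@complex.Im R \o f).

Definition L2_interval (l : R) (f : R -> R[i]) : Prop :=
  ((@complex.Re R \o f) \_ `[0, l] \in Lfun lebesgue_measure 2%:E) /\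
  ((@complex.Im R \o f) \_ `[0, l] \in Lfun lebesgue_measure 2%:E).

(* [f] is absolutely continuous on [0, l] with derivative [g] in L^2. *)
Definition is_L2_derivative (l : R) (f g : R -> R[i]) : Prop :=
  L2_interval l g /\ forall x, 0 <= x <= l -> f x = f 0 + cintegral x g.

Definition H1_interval (l : R) (f : R -> R[i]) : Prop :=
  exists g, is_L2_derivative l f g.

(* The derivative of an H^1 function, determined up to a null set of
   [0, l]. *)
Definition L2_derivative (l : R) (f : R -> R[i]) : R -> R[i] :=
  xget (fun=> 0) [set g | is_L2_derivative l f g].

Definition H1_graph (f : graph_fun) : Prop :=
  graph_continuous f /\ forall e, H1_interval (len e) (f e).

Definition L2_graph (f : graph_fun) : Prop :=
  forall e, L2_interval (len e) (f e).

Definition L2_inner (f g : graph_fun) : R[i] :=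
  \sum_(e : edge G) cintegral (len e) (fun x => f e x * (g e x)^*).

Definition graph_derivative (f : graph_fun) : graph_fun :=
  fun e => L2_derivative (len e) (f e).

Definition form_domain (VD : {set vert G}) (f : graph_fun) : Prop :=
  H1_graph f /\ forall p, endpt p \in VD -> endval f p = 0.

Definition dirichlet_form (f g : graph_fun) : R[i] :=
  L2_inner (graph_derivative f) (graph_derivative g).

(* Graph of the self-adjoint operator associated with the form:
   [f] is in the operator domain and is mapped to [h]. *)
Definition is_laplacian (VD : {set vert G}) (f h : graph_fun) : Prop :=
  [/\ form_domain VD f, L2_graph h &
      forall g, form_domain VD g -> dirichlet_form f g = L2_inner h g].

Definition eigenspace (VD : {set vert G}) (mu : R) : set graph_fun :=
  [set f | is_laplacian VD f (fun e x => mu%:C * f e x)].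

(* The complex dimension is [d]. Functions are compared on the graph only;
   for continuous functions this is the same as equality in L^2. *)
Definition has_dimension (E : set graph_fun) (d : nat) : Prop :=
  exists b : 'I_d -> graph_fun,
  [/\ forall i, E (b i),
      forall c : 'I_d -> R[i],
        (forall e x, 0 <= x <= len e -> \sum_i c i * b i e x = 0) ->
        forall i, c i = 0 &
      forall f, E f -> exists c : 'I_d -> R[i],
        forall e x, 0 <= x <= len e -> f e x = \sum_i c i * b i e x].

(* [lam 1 <= lam 2 <= ...] lists all eigenvalues, each one as many times as
   its multiplicity. The value [lam 0] is not used. *)
Definition eigenvalue_sequence (VD : {set vert G}) (lam : nat -> R) : Prop :=
  (forall m n, (1 <= m <= n)%N -> lam m <= lam n) /\
  (forall mu : R, exists2 d, has_dimension (eigenspace VD mu) d &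
     [set n | (1 <= n)%N /\ lam n = mu] #= `I_d).

End Graph.

(* Main.v *)
(* Cut the edges into short pieces. A solution of -u'' = w^2 u on every piece
   is determined by its values at the nodes, and the Kirchhoff conditions
   become a linear system with a symmetric matrix A(w), whose kernel is
   isomorphic to the eigenspace of w^2. As A(w) decreases strictly with w,
   the number of eigenvalues up to w^2 is the number of nonpositive
   directions of A(w).

   There is a set D of vertices, containing the Dirichlet leaves and at most
   N + beta other vertices, such that the graph can be oriented without
   directed cycles avoiding D and with exactly one outgoing edge at every
   vertex outside D. Propagating Prufer phases along this orientation, from phase 0 on D,
   diagonalizes the form of A(w) on the functions vanishing on D: it is a
   signed sum of squares, with as many negative squares as the propagated
   wave has zeros. Hence this number of zeros, C(w), is at most the number of
   eigenvalues up to w^2 and at least the number of eigenvalues below w^2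
   minus N + beta.

   The outgoing phase at a vertex is a superadditive function of the incoming
   phases, whence m C(w) <= C(m w). With w slightly above the square root of
   lambda_j this gives lambda_{m(j - N - beta)} <= m^2 lambda_j, and the
   theorem follows with m = floor(2k / (j - N - beta)). *)

From mathcomp Require Import all_boot all_order all_algebra.
From mathcomp Require Import all_classical all_reals all_analysis.
From mathcomp Require Import complex measurable_realfun ring lra zify.
Require Import Defs.

Set Implicit Arguments.
Unset Strict Implicit.
Unset Printing Implicit Defensive.

Import Order.TTheory GRing.Theory Num.Theory.
Import numFieldNormedType.Exports.

(** * Connected multigraphs *)

(** The scaling in the frequency lives on phases and the spectral count on matrices. The two meet
    only at frequencies where no phase is a multiple of pi, since the squares divide by sines of
    phases; such frequencies are dense because every phase increases strictly with the frequency.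
    The entries of A(w) have poles where w times the length of a piece reaches pi. The pieces are
    therefore cut short enough for the largest frequency in play, the square root of lambda_{m(j - N
    - beta)}, so that A is continuous and strictly decreasing on the whole range.

    The number N + beta is the price of imposing zeros: one vertex for each Neumann leaf and one
    endpoint of each edge outside a spanning tree. Tree edges are oriented towards a root, which
    must itself lie in D without adding to the count; this governs the choice of the root. The
    factor 4 is due to rounding alone: only multiples of j - N - beta are reached, and one of them
    lies between k and 2k. *)

Section Multigraph.
Variables (V E : finType) (endpt : E * bool -> V).
Implicit Types (F : pred E) (u v r : V) (d : E * bool).

Definition flip d := (d.1, ~~ d.2).

(** [F] selects the usable edges, so that connectedness can be stated again after an edge has been
    removed. *)
Definition adj F : rel V := [rel x y | [exists e, exists b,
  [&& F e, endpt (e, b) == x & endpt (e, ~~ b) == y]]].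

Lemma adjP F x y : reflect (exists2 d, F d.1 & endpt d = x /\ endpt (flip d) = y)
  (adj F x y).
Proof.
apply: (iffP existsP) => [[e /existsP[b /and3P[Fe /eqP <- /eqP <-]]]|].
  by exists (e, b).
by case=> -[e b] /= Fe [<- <-]; exists e; apply/existsP; exists b; rewrite Fe !eqxx.
Qed.

Lemma adj_sym F : symmetric (adj F).
Proof.
suff H x y : adj F x y -> adj F y x by move=> x y; apply/idP/idP; apply: H.
case/adjP => d Fd [<- <-]; apply/adjP; exists (flip d) => //; split=> //.
by rewrite /flip /= negbK; case: d {Fd}.
Qed.

(** A spanning tree rooted at [r]: [par v] is the dart from [v] towards its parent. The strict
    decrease of [h] is what excludes cycles; [h] need not be the distance to [r]. *)
Definition parent_structure F r (par : V -> E * bool) (h : V -> nat) :=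
  h r = 0 /\ forall v, v != r ->
    [/\ F (par v).1, endpt (par v) = v & h (endpt (flip (par v))) < h v].

Lemma breadth_first F r : E -> (forall v, connect (adj F) v r) ->
  exists par h, parent_structure F r par h.
Proof.
move=> e0 conn.
(* [lev k v] holds when [r] is within [k] steps of [v]; the least such [k] serves as the height. *)
pose fix lev (k : nat) (v : V) {struct k} : bool := if k is k'.+1 then lev k' v || [exists w, adj F v w && lev k' w]
  else v == r.
have ex v : exists k, lev k v.
  have /connectP[p] := conn v; elim: p v => [|w p IHp] v /=; first by move=> _ rv; exists 0; apply/eqP.
  move=> /andP[vw wp] /(IHp _ wp)[k wk]; exists k.+1 => /=.
  by apply/orP; right; apply/existsP; exists w; rewrite vw.
pose h v := ex_minn (ex v).
have step v : v != r -> exists d, [/\ F d.1, endpt d = v & h (endpt (flip d)) < h v].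
  rewrite {2}/h; case: ex_minnP => -[|k] /=; first by move=> ->.
  move=> /orP[vk /(_ _ vk)|/existsP[w /andP[/adjP[d Fd [dv dw]] wk]] _ _]; first by rewrite ltnn.
  exists d; split; rewrite // dw ltnS /h; case: ex_minnP => n _; exact.
have [par parP] : exists par : V -> E * bool, forall v, v != r ->
    [/\ F (par v).1, endpt (par v) = v & h (endpt (flip (par v))) < h v].
  pose P v d := [&& F d.1, endpt d == v & h (endpt (flip d)) < h v].
  (* The root has no parent; [(e0, true)] is its filler value. *)
  exists (fun v => odflt (e0, true) [pick d | P v d]) => v /step[d [Fd dv hd]].
  case: pickP => [d' /and3P[? /eqP ? ?]|/(_ d)] //=.
  by rewrite /P Fd dv eqxx hd.
exists par, h; split=> //; rewrite /h; case: ex_minnP => n _ /(_ 0).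
by rewrite /= eqxx => /(_ isT); case: n.
Qed.

Section Tree.
Variables (F : pred E) (r : V) (par : V -> E * bool) (h : V -> nat).
Hypothesis ps : parent_structure F r par h.

Definition tree_edge e := [exists v, (v != r) && ((par v).1 == e)].
(** For a tree edge this is the end at the child, so tree edges point towards the root. Nontree
    edges get [false] and start at their endpoint 0. *)
Definition source_end e := [exists v, (v != r) && (par v == (e, true))].

Lemma par_endpt v : v != r -> endpt (par v) = v.
Proof. by case/ps.2. Qed.

(** Two vertices sharing a parent edge would be each other's parents, and [h] would decrease both
    ways. *)
Lemma par_edge_inj v w : v != r -> w != r -> (par v).1 = (par w).1 -> v = w.
Proof.
move=> vr wr; have [_ ve vh] := ps.2 _ vr; have [_ we wh] := ps.2 _ wr.
move: ve vh we wh; rewrite /flip; case: (par v) (par w) => [e b] [e' b'] /= ve vh we wh ee.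
move: we wh; rewrite -ee; case: (eqVneq b b') => [<- <- //|bb] we wh.
have bE : b' = ~~ b by case: (b) (b') bb => [] [].
move: we wh vh; rewrite bE negbK ve => -> wh vh.
by have := ltn_trans wh vh; rewrite ltnn.
Qed.

Lemma source_endP v : v != r -> par v = ((par v).1, source_end (par v).1).
Proof.
move=> vr; rewrite /source_end; case E1: (par v) => [e b] /=; congr pair.
apply/esym; case: b E1 => E1; first by apply/existsP; exists v; rewrite vr E1 eqxx.
apply/negbTE/negP => /existsP[w /andP[wr /eqP wE]].
have vw : v = w by apply: par_edge_inj => //; rewrite E1 wE.
by move: E1; rewrite vw wE.
Qed.

Lemma nontree_source_end e : ~~ tree_edge e -> source_end e = false.
Proof.
apply: contraNF => /existsP[v /andP[vr /eqP pv]].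
by apply/existsP; exists v; rewrite vr pv eqxx.
Qed.

(** The parent edges are in bijection with the vertices other than [r]. *)
Lemma card_nontree : #|[pred e | ~~ tree_edge e]| = #|E| + 1 - #|V|.
Proof.
have : #|[pred e | tree_edge e]| = #|[pred v | v != r]|.
  rewrite -(@card_in_image _ _ (fun v => (par v).1)); last first.
    by move=> v w; rewrite !inE => vr wr; apply: par_edge_inj.
  apply: eq_card => e; rewrite !inE; apply/existsP/fintype.imageP.
    by case=> v /andP[vr /eqP <-]; exists v.
  by case=> v; rewrite inE => vr ->; exists v; rewrite vr eqxx.
have := cardC (pred1 r); rewrite card1.
have := cardC [pred e | tree_edge e].
rewrite (_ : #|predC [pred e | tree_edge e]| = #|[pred e | ~~ tree_edge e]|); last first.
  by apply: eq_card => e; rewrite !inE.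
rewrite (_ : #|predC (pred1 r)| = #|[pred v | v != r]|); last first.
  by apply: eq_card => e; rewrite !inE.
move: #|_| #|_| #|_| #|_| #|_| => a b c d e; lia.
Qed.

End Tree.

Definition isleaf v := #|[set d | endpt d == v]| == 1.

Lemma second_dart v d : ~~ isleaf v -> endpt d = v ->
  exists2 d', d' != d & endpt d' = v.
Proof.
move=> nl dv; have : 1 < #|[set d | endpt d == v]|.
  have : 0 < #|[set d | endpt d == v]| by apply/card_gt0P; exists d; rewrite inE dv.
  by move: nl; rewrite /isleaf; case: #|_| => [|[|n]].
rewrite (cardD1 d) inE dv eqxx ltnS => /card_gt0P[d'].
by rewrite !inE => /andP[dd' /eqP]; exists d'.
Qed.

Hypothesis connected : forall u v, connect (adj predT) u v.

(** The cut set will consist of the leaves and of endpoint 0 of each nontree edge. For the root to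
    belong to it at no extra cost, the root is a leaf if there is one, and such an endpoint
    otherwise. *)
Lemma rooted_tree : E ->
  exists F r par h, parent_structure F r par h /\
    (isleaf r \/ exists2 e, ~~ tree_edge r par e & endpt (e, false) = r).
Proof.
move=> e0; case: (pickP isleaf) => [r rl|noleaf].
  have [par [h ps]] := breadth_first e0 (fun v => connected v r).
  by exists predT, r, par, h; split=> //; left.
pose r0 := endpt (e0, false).
have [par [h ps]] := breadth_first e0 (fun v => connected v r0).
have [e ne] : exists e, ~~ tree_edge r0 par e.
  (* A vertex of largest height has no child, so a dart there other than its parent dart is on no
     tree edge; it exists as there are no leaves. If the vertex is [r0], there are no tree edges at
     all. *)
  pose v := [arg max_(v > r0) h v]; have vmax w : h w <= h v.
    by rewrite /v; case: arg_maxnP => // i _ H; apply: H.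
  case: (eqVneq v r0) => [vr|vr].
    exists e0; apply/existsPn => w; rewrite negb_and negbK.
    case: (eqVneq w r0) => //= wr; have [_ _] := ps.2 _ wr.
    by have := vmax w; rewrite vr ps.1 leqn0 => /eqP ->.
  have [d' dd' dv] := second_dart (negbT (noleaf v)) (par_endpt ps vr).
  exists d'.1; apply/existsPn => w; rewrite negb_and -implybE.
  apply/implyP => wr; apply/negP => /eqP wd.
  have [_ we wh] := ps.2 _ wr.
  case: (eqVneq (par w) d') => [wd'|wd'].
    by move: dd'; rewrite -dv -wd' we eqxx.
  have fl : flip (par w) = d'.
    move: wd wd'; rewrite /flip; case: (par w) (d') => [e b] [e' b'] /= ->.
    by rewrite xpair_eqE eqxx /=; case: b b' => [] [].
  by move: wh; rewrite fl dv ltnNge vmax.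
(* The graph stays connected without the nontree edge [e], and a new tree, rooted at an endpoint of
   [e] and built from the other edges, leaves [e] out. *)
pose r := endpt (e, false).
have conn v : connect (adj (predC1 e)) v r.
  have c0 u : connect (adj (predC1 e)) u r0.
    have [n] := ubnP (h u); elim: n u => // n IHn u; rewrite ltnS => un.
    case: (eqVneq u r0) => [->|ur]; first exact: connect0.
    have [_ ue uh] := ps.2 _ ur.
    apply: connect_trans (connect1 _) (IHn (endpt (flip (par u))) (leq_trans uh un)).
    apply/adjP; exists (par u) => //=; apply: contraNneq ne => <-.
    by apply/existsP; exists u; rewrite ur eqxx.
  apply: connect_trans (c0 v) _.
  by rewrite (sym_connect_sym (@adj_sym _)).
have [par' [h' ps']] := breadth_first e0 conn.
exists (predC1 e), r, par', h'; split=> //; right; exists e => //.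
apply/existsPn => v; rewrite negb_and -implybE; apply/implyP => vr.
by have [] := ps'.2 _ vr.
Qed.

(* The tail of e is its endpoint (e, o e). Outside D, every vertex v has
   exactly one outgoing edge, par v, and at least one incoming edge; the rank
   excludes directed cycles avoiding D. *)
Lemma oriented_cut (VD : {set V}) : E -> (forall v, v \in VD -> isleaf v) ->
  exists (D : {set V}) (o : E -> bool) (par : V -> E) (rk : V -> nat),
  [/\ VD \subset D,
      #|D :\: VD| <= #|[set v | isleaf v & v \notin VD]| + (#|E| + 1 - #|V|) &
      [/\ forall v, v \notin D -> endpt (par v, o (par v)) = v,
          forall e, endpt (e, o e) \notin D -> par (endpt (e, o e)) = e,
          forall v, v \notin D -> exists e, endpt (e, ~~ o e) = v &
          forall e, endpt (e, o e) \notin D ->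
            rk (endpt (e, o e)) < rk (endpt (e, ~~ o e))]].
Proof.
move=> e0 VDl; have [F [r [par [h [ps rP]]]]] := rooted_tree e0.
pose NT := [pred e | ~~ tree_edge r par e].
(* The tails of the nontree edges are in [D], so an edge whose tail avoids [D] is a tree edge
   leaving the child. *)
pose D := [set v | isleaf v] :|: [set endpt (e, false) | e in NT].
have rD : r \in D.
  case: rP => [rl|[e ne <-]]; first by rewrite !inE rl.
  by rewrite inE; apply/orP; right; apply: imset_f; rewrite inE.
have neD v : v \notin D -> v != r by apply: contraNneq => ->.
pose o := source_end r par; pose hm := \max_v h v.
have tree_src e : endpt (e, o e) \notin D -> par (endpt (e, o e)) = (e, o e).
  move=> eD; case: (boolP (tree_edge r par e)) => [/existsP[v /andP[vr /eqP pe]]|ne].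
    by have := source_endP ps vr; rewrite pe => pv; rewrite /o -pv (par_endpt ps vr).
  move: eD; rewrite /o nontree_source_end // inE negb_or => /andP[_] /negP[].
  by apply: imset_f; rewrite inE.
(* Heights decrease along the tree edges; [hm - h] turns this into an increasing rank. *)
exists D, o, (fun v => (par v).1), (fun v => hm - h v); split.
- by apply/fintype.subsetP => v /VDl vl; rewrite !inE vl.
- apply: leq_trans (_ : #|[set v | isleaf v & v \notin VD]| +
      #|[set endpt (e, false) | e in NT]| <= _).
    apply: leq_trans (leq_card_setU _ _); apply: subset_leq_card.
    apply/fintype.subsetP => v; rewrite !inE => /andP[-> /orP[->|->]] //.
    by rewrite orbT.
  by rewrite leq_add2l -(card_nontree ps) leq_imset_card.
split.
- by move=> v /neD vr; rewrite -(source_endP ps vr) (par_endpt ps vr).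
- by move=> e /tree_src ->.
- move=> v vD; have vr := neD _ vD.
  have nl : ~~ isleaf v by apply: contraNN vD => vl; rewrite !inE vl.
  (* A second dart at [v] is the head of its edge: the only tail at [v] is the parent dart, the
     tails of nontree edges being in [D]. *)
  have [[e b] dd' dv] := second_dart nl (par_endpt ps vr); exists e.
  suff -> : ~~ o e = b by [].
  case: (boolP (tree_edge r par e)) => [/existsP[w /andP[wr /eqP pe]]|ne].
    have := source_endP ps wr; rewrite pe -/(o e) => pw.
    case: (eqVneq b (o e)) => [bo|]; last by case: (b) (o e) => [] [].
    have wv : w = v by rewrite -(par_endpt ps wr) pw -bo.
    by move: dd'; rewrite bo -pw wv eqxx.
  rewrite /o nontree_source_end //; case: b dv {dd'} => // dv.
  by move: vD; rewrite -dv inE negb_or => /andP[_] /negP[]; apply: imset_f; rewrite inE.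
- move=> e eD; have [_ _] := ps.2 _ (neD _ eD); rewrite tree_src // /flip /= => lt.
  have : h (endpt (e, o e)) <= hm by apply: leq_bigmax.
  lia.
Qed.

End Multigraph.

(** * Inertia of symmetric matrices *)

Local Open Scope ring_scope.

Section Inertia.
Variable F : realFieldType.
Implicit Types n k l : nat.

Definition qform n (A : 'M[F]_n) (x : 'rV[F]_n) : F := (x *m A *m x^T) 0 0.

(** Inertia without eigenvalues: the subspace is the row space of [U], and [P] prescribes a strict
    or weak sign. *)
Definition has_subspace (P : pred F) n (A : 'M[F]_n) k : Prop :=
  exists2 U : 'M[F]_n, (k <= \rank U)%N &
    forall x : 'rV[F]_n, (x <= U)%MS -> x != 0 -> P (qform A x).

Lemma qformD n (A B : 'M[F]_n) x : qform (A + B) x = qform A x + qform B x.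
Proof. by rewrite /qform mulmxDr mulmxDl mxE. Qed.

Lemma qform_cong n m (A : 'M[F]_n) (P : 'M[F]_(m, n)) (y : 'rV[F]_m) :
  qform A (y *m P) = qform (P *m A *m P^T) y.
Proof. by rewrite /qform trmx_mul !mulmxA. Qed.

Lemma qform_diag n (d x : 'rV[F]_n) :
  qform (diag_mx d) x = \sum_i d 0 i * x 0 i ^+ 2.
Proof.
rewrite /qform mxE; apply: eq_bigr => i _.
rewrite mul_mx_diag !mxE; ring.
Qed.

Lemma qform_le n (A : 'M[F]_n) (e : F) (x : 'rV[F]_n) :
  0 <= e -> (forall i j, `|A i j| <= e) ->
  `|qform A x| <= n%:R * e * \sum_i x 0 i ^+ 2.
Proof.
move=> e0 Ae.
have -> : qform A x = \sum_j \sum_i x 0 i * A i j * x 0 j.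
  by rewrite /qform mxE; apply: eq_bigr => j _; rewrite !mxE mulr_suml.
have H j : `|\sum_i x 0 i * A i j * x 0 j| <=
    \sum_i (e / 2 * x 0 i ^+ 2 + e / 2 * x 0 j ^+ 2).
  apply: le_trans (ler_norm_sum _ _ _) _.
  apply: ler_sum => i _; rewrite !normrM.
  have := real_normK (num_real (x 0 i)); have := real_normK (num_real (x 0 j)).
  have := sqr_ge0 (`|x 0 i| - `|x 0 j|).
  have := mulr_ge0 (normr_ge0 (x 0 i)) (normr_ge0 (x 0 j)).
  move: (Ae i j); set a := `|A i j|; set u := `|x 0 i|; set v := `|x 0 j|.
  move=> ae uv0 uv <- <-.
  have : a * (u * v) <= e * (u * v) by rewrite ler_wpM2r.
  have : 0 <= e * (u - v) ^+ 2 by rewrite mulr_ge0.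
  nra.
apply: le_trans (ler_norm_sum _ _ _) _.
apply: le_trans (ler_sum _ (fun j _ => H j)) _.
under eq_bigr do rewrite big_split /= -mulr_sumr sumr_const card_ord.
rewrite big_split /= sumr_const card_ord sumrMnl -mulr_sumr -mulrnDl -mulr_natl.
by rewrite le_eqVlt; apply/orP; left; apply/eqP; field.
Qed.

(** Subspaces with incompatible signs meet only in 0. This turns a lower bound on one index into an
    upper bound on the opposite one. *)
Lemma has_subspace_disjoint (P Q : pred F) n (A : 'M[F]_n) k l :
  (forall t, P t -> ~~ Q t) -> has_subspace P A k -> has_subspace Q A l ->
  (k + l <= n)%N.
Proof.
move=> PQ [U kU UP] [V lV VQ]; rewrite leqNgt; apply/negP => nkl.
have : (0 < \rank (U :&: V)%MS)%N.
  by have := mxrank_sum_cap U V; have := rank_leq_col (U + V)%MS; lia.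
rewrite lt0n mxrank_eq0 => /rowV0Pn [v vUV v0].
move: vUV; rewrite sub_capmx => /andP[vU vV].
by move: (PQ _ (UP _ vU v0)); rewrite (VQ _ vV v0).
Qed.

Lemma has_subspace_impl (P Q : pred F) n (A B : 'M[F]_n) k :
  (forall x, x != 0 -> P (qform A x) -> Q (qform B x)) ->
  has_subspace P A k -> has_subspace Q B k.
Proof. by move=> PQ [U kU UP]; exists U => // x xU x0; apply: PQ => //; apply: UP. Qed.

Lemma has_subspace_leq (P : pred F) n (A : 'M[F]_n) k l :
  (l <= k)%N -> has_subspace P A k -> has_subspace P A l.
Proof. by move=> lk [U kU UP]; exists U => //; apply: leq_trans lk kU. Qed.

Lemma mxrank_sum_leq (I : finType) (p : pred I) m n (B : I -> 'M[F]_(m, n)) :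
  (\rank (\sum_(i | p i) B i)%R <= \sum_(i | p i) \rank (B i))%N.
Proof.
elim/big_rec2: _ => [|i y x _ xy]; first by rewrite mxrank0.
by apply: leq_trans (mxrank_add _ _) _; rewrite leq_add2l.
Qed.

Lemma leq_rank_diag n (d : 'rV[F]_n) : (\rank (diag_mx d) <= #|[pred i | (d 0 i != 0)%R]|)%N.
Proof.
have -> : diag_mx d = \sum_(i | d 0 i != 0) d 0 i *: delta_mx i i.
  rewrite diag_mx_sum_delta [RHS]big_mkcond /=; apply: eq_bigr => i _.
  by case: eqVneq => //= ->; rewrite scale0r.
apply: leq_trans (mxrank_sum_leq _ _) _.
rewrite -sum1_card; apply: leq_sum => i _.
by apply: leq_trans (mxrank_scale _ _) _; rewrite mxrank_delta.
Qed.

Lemma rank_diag n (d : 'rV[F]_n) : \rank (diag_mx d) = #|[pred i | d 0 i != 0]|.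
Proof.
apply/eqP; rewrite eqn_leq leq_rank_diag /=.
(* [e] fills the zeros of [d], which makes the sum invertible; subadditivity of the rank then forces
   equality. *)
pose e : 'rV[F]_n := \row_i (d 0 i == 0)%:R.
have : (\rank (diag_mx (d + e)) = n)%N.
  apply/eqP; rewrite -[_ == _]/(row_free _) row_free_unit unitmxE det_diag.
  rewrite unitfE; apply/prodf_neq0 => i _; rewrite !mxE.
  by case: (eqVneq (d 0 i) 0) => [->|?]; rewrite ?add0r ?oner_neq0 ?addr0.
rewrite raddfD /= => rn.
have := mxrank_add (diag_mx d) (diag_mx e); rewrite rn.
have := leq_rank_diag e.
have -> : #|[pred i | e 0 i != 0]| = #|[predC [pred i | d 0 i != 0]]|.
  by apply: eq_card => i; rewrite !inE mxE; case: (d 0 i == 0); rewrite ?oner_neq0 ?eqxx.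
have := cardC [pred i | d 0 i != 0]; rewrite card_ord.
move: #|_| #|predC _| (\rank (diag_mx d)) (\rank (diag_mx e)) => p q u v; lia.
Qed.

Lemma symmetric_block n (B : 'M[F]_(1 + n)) : B^T = B ->
  B = block_mx (B 0 0)%:M (ursubmx B) (ursubmx B)^T (drsubmx B).
Proof.
move=> Bs; rewrite -{1}[B]submxK; congr block_mx; last by rewrite trmx_ursub Bs.
apply/matrixP => i j; rewrite !ord1 !mxE eqxx mulr1n.
by rewrite (_ : lshift n 0 = 0) //; apply/val_inj.
Qed.

(** One step of symmetric Gaussian elimination; [S] is the Schur complement of the pivot. *)
Lemma eliminate_first n (B : 'M[F]_(1 + n)) : B^T = B -> B 0 0 != 0 ->
  exists2 L : 'M[F]_(1 + n), L \in unitmx &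
    exists2 S : 'M[F]_n, S^T = S & L *m B *m L^T = block_mx (B 0 0)%:M 0 0 S.
Proof.
move=> Bs; move: (symmetric_block Bs); set b := ursubmx B; set C := drsubmx B.
have Cs : C^T = C by rewrite /C trmx_drsub Bs.
move: (B 0 0) => a -> a0.
exists (block_mx 1%:M 0 (- (a^-1 *: b^T)) 1%:M).
  by rewrite unitmxE det_lblock !det1 mulr1 unitr1.
exists (C - a^-1 *: (b^T *m b)).
  by rewrite linearB linearZ /= trmx_mul trmxK Cs.
rewrite tr_block_mx !mulmx_block !trmx1 !trmx0 !mul1mx !mul0mx !mulmx1 !mulmx0 ?addr0 ?add0r.
rewrite linearN linearZ /= trmxK mulNmx mul_mx_scalar scalerA divff // scale1r.
rewrite mulmxN mul_scalar_mx scalerA divff // scale1r !addNr mulNmx -scalemxAl mul0mx add0r.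
by rewrite addrC.
Qed.

(** Lagrange's reduction, by congruence only, as eigenvalues need not exist in [F]. By polarization
    a nonzero symmetric form is nonzero at some vector, which becomes the pivot. *)
Lemma symmetric_diagonalization n (A : 'M[F]_n) : A^T = A ->
  exists2 P, P \in unitmx & exists d : 'rV[F]_n, P *m A *m P^T = diag_mx d.
Proof.
elim: n A => [|n IHn] A As.
  by exists 1%:M; rewrite ?unitmx1 //; exists 0; apply/matrixP => -[].
case: (eqVneq A 0) => [->|A0].
  by exists 1%:M; rewrite ?unitmx1 //; exists 0; rewrite mulmx0 mul0mx linear0.
have [v v0] : exists v : 'rV[F]_n.+1, qform A v != 0.
  have /existsP[i /existsP[j ij]] : [exists i, exists j, A i j != 0].
    apply: contraNT A0 => /existsPn H; apply/eqP/matrixP => i j; rewrite mxE.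
    by apply/eqP; have /existsPn/(_ j) := H i; rewrite negbK.
  have E p q : ((delta_mx 0 p : 'rV[F]_n.+1) *m A *m (delta_mx 0 q : 'rV[F]_n.+1)^T) 0 0 = A p q.
    by rewrite -rowE trmx_delta -colE !mxE.
  have E2 : qform A (delta_mx 0 i + delta_mx 0 j) = A i i + A j j + 2 * A i j.
    have addE (X Y : 'M[F]_1) : (X + Y) 0 0 = X 0 0 + Y 0 0 by rewrite mxE.
    rewrite /qform linearD /= !mulmxDl !mulmxDr !addE !E.
    have -> : A j i = A i j by rewrite -[in LHS]As mxE.
    ring.
  case: (eqVneq (A i i) 0) => [ii|]; last by exists (delta_mx 0 i); rewrite /qform E.
  case: (eqVneq (A j j) 0) => [jj|]; last by exists (delta_mx 0 j); rewrite /qform E.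
  exists (delta_mx 0 i + delta_mx 0 j).
  by rewrite E2 ii jj !add0r mulf_neq0 // pnatr_eq0.
have [P Pu Pv] : exists2 P, P \in unitmx & delta_mx 0 0 *m P = v.
  have vn0 : v != 0.
    by apply: contraNneq v0 => ->; rewrite /qform !mul0mx mxE.
  have E : (delta_mx 0 0 : 'rV[F]_n.+1) *m ((delta_mx 0 0 : 'rV[F]_n.+1)^T *m v) = v.
    by rewrite mulmxA trmx_delta mul_delta_mx -[RHS]mul1mx; congr (_ *m _); apply/rowP => i; rewrite !mxE !ord1.
  have : \rank ((delta_mx 0 0 : 'rV[F]_n.+1) *m ((delta_mx 0 0 : 'rV[F]_n.+1)^T *m v)) =
      \rank (delta_mx 0 0 : 'rV[F]_n.+1).
    by rewrite E rank_rV vn0 mxrank_delta.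
  by case/complete_unitmx => g gu; rewrite E => vg; exists g.
have a0 : (P *m A *m P^T) 0 0 != 0.
  rewrite (_ : _ 0 0 = qform A v) // -Pv qform_cong /qform -rowE trmx_delta -colE.
  by move: (P *m A *m P^T) => B; rewrite !mxE.
have Bs : (P *m A *m P^T)^T = P *m A *m P^T by rewrite !trmx_mul trmxK As mulmxA.
have [L Lu [S Ss LE]] := @eliminate_first n _ Bs a0.
have [Q Qu [d QE]] := IHn S Ss.
have Mu : (block_mx 1%:M 0 0 Q : 'M[F]_(1 + n)) \in unitmx.
  by rewrite unitmxE det_ublock det1 mul1r.
exists ((block_mx 1%:M 0 0 Q : 'M[F]_(1 + n)) *m L *m P).
  by rewrite !unitmx_mul Lu Pu Mu.
exists (row_mx ((P *m A *m P^T) 0 0)%:M d).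
have -> (M : 'M[F]_(1 + n)) : (M *m L *m P) *m A *m (M *m L *m P)^T =
    M *m (L *m (P *m A *m P^T) *m L^T) *m M^T by rewrite !trmx_mul !mulmxA.
rewrite LE tr_block_mx !mulmx_block !trmx1 !trmx0 !mul1mx !mul0mx !mulmx1 !mulmx0 !addr0 !add0r.
rewrite ?mul0mx QE.
have E := @diag_mx_row F n 1 ((P *m A *m P^T) 0 0)%:M d.
apply: (etrans _ (esym E)).
by congr block_mx; apply/matrixP => i j; rewrite !ord1 !mxE.
Qed.

Definition coordmx n (S : pred 'I_n) : 'M[F]_n := diag_mx (\row_i (S i)%:R).

Lemma rank_coordmx n (S : pred 'I_n) (P : 'M[F]_n) :
  P \in unitmx -> \rank (coordmx S *m P) = #|S|.
Proof.
rewrite -row_free_unit => Pf; rewrite mxrankMfree // rank_diag.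
by apply: eq_card => i; rewrite -[RHS]/(S i) !inE mxE; case: (S i); rewrite ?oner_eq0 ?eqxx.
Qed.

Lemma coordmx_subP n (S : pred 'I_n) (P : 'M[F]_n) (x : 'rV[F]_n) :
  (x <= coordmx S *m P)%MS ->
  exists2 w : 'rV[F]_n, x = w *m P & forall i, ~~ S i -> w 0 i = 0.
Proof.
case/submxP => y ->; exists (y *m coordmx S); first by rewrite mulmxA.
by move=> i /negbTE Si; rewrite mul_mx_diag !mxE Si mulr0.
Qed.

Lemma sum_sqr_gt0 n (w : 'rV[F]_n) : w != 0 -> 0 < \sum_i w 0 i ^+ 2.
Proof.
move=> w0; rewrite lt_def sumr_ge0 ?andbT => [|i _]; last exact: sqr_ge0.
apply: contraNneq w0 => /eqP; rewrite psumr_eq0 => [/allP w0|i _]; last exact: sqr_ge0.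
apply/eqP/rowP => i; rewrite mxE; apply/eqP; rewrite -sqrf_eq0.
by apply: (implyP (w0 i _)); rewrite ?mem_index_enum.
Qed.

Lemma congruence_small n (P : 'M[F]_n) (d : F) : 0 < d -> exists2 e, 0 < e &
  forall E : 'M[F]_n, (forall i j, `|E i j| <= e) ->
    forall i j, `|(P *m E *m P^T) i j| <= d.
Proof.
move=> d0; pose c := \sum_i \sum_k `|P i k|.
have cP i : \sum_k `|P i k| <= c.
  rewrite /c [leRHS](bigD1 i) //= lerDl sumr_ge0 // => j _.
  by apply: sumr_ge0 => k _; apply: normr_ge0.
have c0 : 0 <= c by apply: sumr_ge0 => j _; apply: sumr_ge0 => k _; apply: normr_ge0.
(* Multiplying by [P] on both sides enlarges entries by at most [c ^+ 2]; the 1 keeps the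
   denominator positive. *)
exists (d / (1 + c ^+ 2)); first by rewrite divr_gt0 // ltr_pwDl ?sqr_ge0.
move=> E Ee i j; rewrite mxE.
apply: le_trans (_ : c * (d / (1 + c ^+ 2)) * c <= _); last first.
  rewrite -subr_ge0 (_ : _ - _ = d / (1 + c ^+ 2)).
    by rewrite divr_ge0 ?ltW // ltr_pwDl ?sqr_ge0.
  by field; rewrite gt_eqF // ltr_pwDl ?sqr_ge0.
apply: le_trans (ler_norm_sum _ _ _) _.
apply: le_trans (_ : \sum_k c * (d / (1 + c ^+ 2)) * `|P j k| <= _); last first.
  rewrite -mulr_sumr ler_wpM2l // mulr_ge0 // divr_ge0 ?ltW // ltr_pwDl ?sqr_ge0 //.
apply: ler_sum => k _; rewrite normrM [P^T _ _]mxE ler_wpM2r // mxE.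
apply: le_trans (ler_norm_sum _ _ _) _.
apply: le_trans (_ : \sum_l `|P i l| * (d / (1 + c ^+ 2)) <= _).
  by apply: ler_sum => l _; rewrite normrM ler_wpM2l.
by rewrite -mulr_suml ler_wpM2r // divr_ge0 ?ltW // ltr_pwDl ?sqr_ge0.
Qed.

(** After diagonalization [p] and [q] count the positive and the negative entries. Definite
    directions survive a small perturbation, while the kernel may split either way; hence only lower
    bounds near [A]. *)
Lemma inertia n (A : 'M[F]_n) : A^T = A ->
  exists p q, [/\ (p + q = \rank A)%N,
    has_subspace (<= 0) A (n - p) &
    exists2 e, 0 < e & forall B : 'M[F]_n, (forall i j, `|B i j - A i j| <= e) ->
      has_subspace (> 0) B p /\ has_subspace (< 0) B q].
Proof.
move=> As; have [P Pu [d PAP]] := symmetric_diagonalization As.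
exists #|[pred i | 0 < d 0 i]|, #|[pred i | d 0 i < 0]|.
have rA : \rank A = #|[pred i | d 0 i != 0]|.
  rewrite -rank_diag -PAP mxrankMfree ?row_free_unit ?unitmx_tr //.
  by rewrite -[RHS]mxrank_tr trmx_mul mxrankMfree ?row_free_unit ?unitmx_tr // mxrank_tr.
split.
- rewrite rA -cardUI addnC (_ : #|predI _ _| = 0%N) ?add0n.
    by apply: eq_card => i; rewrite !inE; case: ltgtP.
  by apply: eq_card0 => i; rewrite !inE; case: ltgtP.
- exists (coordmx [pred i | d 0 i <= 0] *m P).
    rewrite rank_coordmx // leq_subLR -{1}[n]card_ord.
    rewrite -(cardC [pred i | 0 < d 0 i]) leq_add2l; apply: subset_leq_card.
    by apply/fintype.subsetP => i; rewrite !inE leNgt.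
  move=> x /coordmx_subP[w -> wS] _; rewrite qform_cong PAP qform_diag inE.
  rewrite sumr_le0 // => i _; case: (leP (d 0 i) 0) => [di|di].
    by rewrite mulr_le0_ge0 // sqr_ge0.
  by rewrite wS ?expr0n ?mulr0 //= -ltNge.
have [D D0 Dd] : exists2 D, 0 < D & forall i, d 0 i != 0 -> D <= `|d 0 i|.
  exists (\big[Order.min/1]_(i | d 0 i != 0) `|d 0 i|).
    by elim/big_ind: _ => // [x y x0 y0|i di]; rewrite ?lt_min ?x0 ?normr_gt0.
  by move=> i di; apply: bigmin_le_cond.
(* Changing the entries by [D / (1 + n)] moves the form by at most n D / (1 + n) times the sum of
   squares, which the bound [D] on the nonzero diagonal entries absorbs. *)
have n1 : 0 < 1 + n%:R :> F by rewrite ltr_pwDl.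
have [e e0 He] := congruence_small P (divr_gt0 D0 n1).
exists e => // B BA.
have key (w : 'rV[F]_n) : `|qform B (w *m P) - \sum_i d 0 i * w 0 i ^+ 2| <=
    n%:R * (D / (1 + n%:R)) * \sum_i w 0 i ^+ 2.
  rewrite -qform_diag -PAP -qform_cong -{1}(subrK A B) qformD addrK qform_cong.
  apply: qform_le => [|i j]; first by rewrite divr_ge0 ?ltW.
  by apply: He => k l; have := BA k l; rewrite !mxE.
have Dn : n%:R * (D / (1 + n%:R)) < D.
  by rewrite mulrCA gtr_pMr // ltr_pdivrMr // mul1r ltrDr.
split.
- exists (coordmx [pred i | 0 < d 0 i] *m P); first by rewrite rank_coordmx.
  move=> x /coordmx_subP[w -> wS] x0 /=.
  have w0 : w != 0 by apply: contraNneq x0 => ->; rewrite mul0mx.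
  have := key w; rewrite ler_norml => /andP[+ _].
  have : D * \sum_i w 0 i ^+ 2 <= \sum_i d 0 i * w 0 i ^+ 2.
    rewrite mulr_sumr; apply: ler_sum => i _.
    case: (ltP 0 (d 0 i)) => di; last by rewrite wS ?expr0n ?mulr0 //= -leNgt.
    by rewrite ler_wpM2r ?sqr_ge0 // -[leRHS]ger0_norm ?Dd ?gt_eqF ?ltW.
  have := sum_sqr_gt0 w0; move: (\sum_i w 0 i ^+ 2) => W W0 H1 H2.
  have : n%:R * (D / (1 + n%:R)) * W < D * W by rewrite ltr_pM2r.
  lra.
- exists (coordmx [pred i | d 0 i < 0] *m P); first by rewrite rank_coordmx.
  move=> x /coordmx_subP[w -> wS] x0 /=.
  have w0 : w != 0 by apply: contraNneq x0 => ->; rewrite mul0mx.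
  have := key w; rewrite ler_norml => /andP[_ +].
  have : \sum_i d 0 i * w 0 i ^+ 2 <= - (D * \sum_i w 0 i ^+ 2).
    rewrite mulr_sumr -sumrN; apply: ler_sum => i _; rewrite -mulNr.
    case: (ltP (d 0 i) 0) => di; last by rewrite wS ?expr0n ?mulr0 //= -leNgt.
    by rewrite ler_wpM2r ?sqr_ge0 // lerNr -ltr0_norm ?Dd ?lt_eqF ?ltW.
  have := sum_sqr_gt0 w0; move: (\sum_i w 0 i ^+ 2) => W W0 H1 H2.
  have : n%:R * (D / (1 + n%:R)) * W < D * W by rewrite ltr_pM2r.
  lra.
Qed.
End Inertia.

(** * Quadratic forms of weighted networks with Dirichlet nodes *)

Section NetworkMatrix.
Variables (W Y : finType) (src tgt : Y -> W) (VD : {set W}).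

Section Ring.
Variable K : comNzRingType.
Implicit Types (c s : Y -> K) (x : 'rV[K]_#|W|).

Definition free_coord w : 'rV[K]_#|W| :=
  if w \in VD then 0 else delta_mx 0 (enum_rank w).

Definition free_val x w : K := if w \in VD then 0 else x 0 (enum_rank w).

(* The coordinates in VD are decoupled from the network and carry the
   identity, so that they contribute neither to the kernel nor to the
   nonpositive subspaces. *)
Definition network_mx c s : 'M[K]_#|W| :=
  \sum_y (c y *: ((free_coord (src y))^T *m free_coord (src y) +
                  (free_coord (tgt y))^T *m free_coord (tgt y)) -
          s y *: ((free_coord (src y))^T *m free_coord (tgt y) +
                  (free_coord (tgt y))^T *m free_coord (src y))) +
  \sum_(w in VD) delta_mx (enum_rank w) (enum_rank w).

Lemma network_mx_sym c s : (network_mx c s)^T = network_mx c s.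
Proof.
rewrite /network_mx linearD /= !linear_sum /=; congr (_ + _).
  apply: eq_bigr => y _.
  rewrite linearB /= !linearZ /= !linearD /= !trmx_mul !trmxK. by congr (_ + _); rewrite addrC.
by apply: eq_bigr => w _; rewrite trmx_delta.
Qed.

Lemma mul_free_coord x w : x *m (free_coord w)^T = (free_val x w)%:M.
Proof.
apply/matrixP => i j; rewrite !ord1 [RHS]mxE eqxx mulr1n /free_coord /free_val.
case: ifP => _; first by rewrite trmx0 mulmx0 mxE.
by rewrite trmx_delta -colE mxE.
Qed.

Lemma mul_network_mx c s x w : (x *m network_mx c s) 0 (enum_rank w) =
  if w \in VD then x 0 (enum_rank w) else
  \sum_y ((src y == w)%:R * (c y * free_val x (src y) - s y * free_val x (tgt y)) +
          (tgt y == w)%:R * (c y * free_val x (tgt y) - s y * free_val x (src y))).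
Proof.
have fc v : free_coord v 0 (enum_rank w) = ((v == w) && (w \notin VD))%:R.
  rewrite /free_coord; case: ifP => vVD.
    by rewrite mxE; have [<-|] := eqVneq v w; rewrite ?vVD.
  rewrite mxE eqxx (inj_eq enum_rank_inj) eq_sym /=.
  by have [<-|] := eqVneq v w; rewrite ?vVD.
rewrite mulmxDr mxE [X in X + _](_ : _ = \sum_y
   ((c y * free_val x (src y) - s y * free_val x (tgt y)) * free_coord (src y) 0 (enum_rank w)
   + (c y * free_val x (tgt y) - s y * free_val x (src y)) * free_coord (tgt y) 0 (enum_rank w))); last first.
  rewrite mulmx_sumr summxE; apply: eq_bigr => y _.
  rewrite mulmxBr -!scalemxAr !mulmxDr !mulmxA !mul_free_coord !mul_scalar_mx.
  rewrite !mxE; ring.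
have -> : (x *m (\sum_(w0 in VD) delta_mx (enum_rank w0) (enum_rank w0))) 0 (enum_rank w) =
    (w \in VD)%:R * x 0 (enum_rank w).
  rewrite mulmx_sumr summxE (eq_bigr (fun v => (v == w)%:R * x 0 (enum_rank w))).
    case: (boolP (w \in VD)) => wVD.
      rewrite (bigD1 w) //= eqxx big1 ?addr0 // => v /andP[_ /negbTE ->].
      by rewrite mul0r.
    rewrite big1 ?mul0r // => v vVD; case: eqP => [vw|]; rewrite ?mul0r //.
    by move: vVD; rewrite vw (negbTE wVD).
  move=> v _; rewrite mxE (bigD1 (enum_rank v)) //= mxE eqxx big1 ?addr0.
    rewrite (inj_eq enum_rank_inj) eq_sym; case: eqP => [->|_] /=; last by rewrite mulr0 mul0r.
    by rewrite mulrC.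
  by move=> i /negbTE iv; rewrite mxE iv mulr0.
case: (boolP (w \in VD)) => wVD.
  rewrite mul1r big1 ?add0r // => y _; by rewrite !fc wVD !andbF !mulr0 addr0.
rewrite mul0r addr0; apply: eq_bigr => y _; rewrite !fc wVD !andbT.
by rewrite mulrC [X in _ + X]mulrC.
Qed.

End Ring.

(** Used for the embedding of the reals into the complex numbers: eigenfunctions are complex, the
    matrix and its inertia are real. *)
Lemma map_network_mx (K L : comNzRingType) (f : {rmorphism K -> L}) (c s : Y -> K) :
  map_mx f (network_mx c s) = network_mx (f \o c) (f \o s).
Proof.
have fc w : map_mx f (free_coord K w) = free_coord L w.
  by rewrite /free_coord; case: ifP => _; rewrite ?map_mx0 ?map_delta_mx.
rewrite /network_mx raddfD /= !raddf_sum /=; congr (_ + _).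
  apply: eq_bigr => y _.
  by rewrite raddfB /= !map_mxZ !raddfD /= !map_mxM -!map_trmx !fc.
by apply: eq_bigr => w _; rewrite map_delta_mx.
Qed.

Section Form.
Variable F : realFieldType.
Implicit Types (c s : Y -> F) (x : 'rV[F]_#|W|).

Lemma qform_network c s x : qform (network_mx c s) x =
  \sum_y (c y * (free_val x (src y) ^+ 2 + free_val x (tgt y) ^+ 2) -
          2 * s y * (free_val x (src y) * free_val x (tgt y))) +
  \sum_(w in VD) x 0 (enum_rank w) ^+ 2.
Proof.
rewrite /qform mxE (reindex_onto enum_rank enum_val) /=; last by move=> i _; rewrite enum_valK.
rewrite (eq_bigl predT) => [|w]; last by rewrite enum_rankK eqxx.
under eq_bigr do rewrite mul_network_mx mxE.
rewrite (bigID (mem VD)) /= addrC; congr (_ + _); last first.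
  by apply: eq_bigr => w ->; rewrite expr2.
under eq_bigr => w /negbTE wVD do rewrite wVD mulr_suml.
rewrite exchange_big /=; apply: eq_bigr => y _.
pose g v := c y * free_val x v.
have E (u v : W) : \sum_(w | w \notin VD)
   (u == w)%:R * (c y * free_val x u - s y * free_val x v) * x 0 (enum_rank w) =
   (c y * free_val x u - s y * free_val x v) * free_val x u.
  case: (boolP (u \in VD)) => uVD.
    rewrite big1 => [|w wVD]; first by rewrite [X in _ * X]/free_val uVD mulr0.
    by case: eqP => [uw|]; [rewrite -uw uVD in wVD|rewrite !mul0r].
  rewrite (bigD1 u) //= eqxx mul1r big1 ?addr0; first by rewrite /free_val (negbTE uVD).
  by move=> w /andP[_ /negbTE wu]; rewrite eq_sym wu !mul0r.
under eq_bigr do rewrite mulrDl.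
by rewrite big_split /= !E; ring.
Qed.

End Form.
End NetworkMatrix.

(** * Phases *)

Section Cotangent.
Variable R : realType.
Implicit Types x y s : R.

Definition cot x : R := cos x / sin x.
(** The branch with values in (0, pi), the range of the nonzero residues of phases. *)
Definition acot y : R := pi / 2 - atan y.

Lemma acot_gt0 y : 0 < acot y.
Proof. by rewrite subr_gt0 atan_ltpi2. Qed.

Lemma acot_ltpi y : acot y < pi.
Proof. by rewrite /acot; have := atan_gtNpi2 y; lra. Qed.

Lemma acotK y : cot (acot y) = y.
Proof.
rewrite /cot /acot -opprB cosN sinN cosBpihalf sinBpihalf opprK.
exact: atanK.
Qed.

Lemma sin_neq0_pi x : 0 < x < pi -> sin x != 0.
Proof. by move=> /sin_gt0_pi /gt_eqF ->. Qed.

Lemma cotD x y : sin x != 0 -> sin y != 0 ->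
  cot x + cot y = sin (x + y) / (sin x * sin y).
Proof. by move=> sx sy; rewrite /cot sinD; field; rewrite sx sy. Qed.

(** When [sin (x + y) = 0] both sides are quotients by zero, hence 0. *)
Lemma cot_sum x y : sin x != 0 -> sin y != 0 ->
  cot (x + y) = (cot x * cot y - 1) / (cot x + cot y).
Proof.
move=> sx sy; rewrite cotD // /cot cosD.
case: (eqVneq (sin (x + y)) 0) => [->|sxy]; first by rewrite mul0r !invr0 !mulr0.
by field; rewrite sx sy sxy.
Qed.

Lemma cotB x y : sin x != 0 -> sin y != 0 ->
  cot x - cot y = sin (y - x) / (sin x * sin y).
Proof. by move=> sx sy; rewrite /cot sinB; field; rewrite sx sy. Qed.

Lemma le_cot x y : 0 < x < pi -> 0 < y < pi -> (cot y <= cot x) = (x <= y).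
Proof.
move=> x0 y0; have sx := sin_gt0_pi x0; have sy := sin_gt0_pi y0.
rewrite -subr_ge0 cotB ?gt_eqF // pmulr_lge0 ?invr_gt0 ?mulr_gt0 //.
move: x0 y0 => /andP[x0 xp] /andP[y0 yp].
case: (leP x y) => xy.
  by apply: sin_ge0_pi; rewrite subr_ge0 xy /= lerBlDr; apply: ltW; lra.
apply/negbTE; rewrite -ltNge -opprB sinN oppr_lt0 sin_gt0_pi // subr_gt0 xy /=.
lra.
Qed.

Lemma le_acot x y : 0 < x < pi -> (y <= cot x) = (x <= acot y).
Proof.
by move=> x0; rewrite -(@le_cot x (acot y)) ?acotK // acot_gt0 acot_ltpi.
Qed.

Lemma cotDpin x n : cot (x + n%:R * pi) = cot x.
Proof.
elim: n => [|n IHn]; first by rewrite mul0r addr0.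
rewrite -addn1 natrD mulrDl mul1r addrA -[RHS]IHn /cot sinDpi cosDpi.
by rewrite invrN mulrNN.
Qed.

Lemma sinDpin_eq0 x n : (sin (x + n%:R * pi) == 0) = (sin x == 0).
Proof.
elim: n => [|n IHn]; first by rewrite mul0r addr0.
by rewrite -addn1 natrD mulrDl mul1r addrA sinDpi oppr_eq0.
Qed.

End Cotangent.

Section Phase.
Variable R : realType.
Implicit Types x y : R.

(** For the phase [x >= 0] of a wave, the multiples of pi in (0, x] are the zeros met so far;
    [residue] is what has been gained since the last one. *)
Definition halfturns x : nat := Num.truncn (x / pi).
Definition residue x : R := x - (halfturns x)%:R * pi.

Lemma residueE x : x = residue x + (halfturns x)%:R * pi.
Proof. by rewrite /residue subrK. Qed.

Lemma residue_itv x : 0 <= x -> 0 <= residue x < pi.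
Proof.
move=> x0; have p0 := @pi_gt0 R.
have /truncn_itv : 0 <= x / pi by rewrite divr_ge0 // ltW.
rewrite -/(halfturns x) ler_pdivlMr // ltr_pdivrMr // -addn1 natrD mulrDl mul1r.
by rewrite /residue => /andP[? ?]; apply/andP; split; lra.
Qed.

Lemma halfturns_uniq n x : n%:R * pi <= x < n.+1%:R * pi -> halfturns x = n.
Proof.
have p0 := @pi_gt0 R.
move=> /andP[h1 h2]; apply: truncn_def.
by rewrite ler_pdivlMr // ltr_pdivrMr // h1.
Qed.

Lemma halfturnsD x n r : 0 <= r < pi -> x = r + n%:R * pi -> halfturns x = n.
Proof.
move=> /andP[r0 rp] ->; apply: halfturns_uniq.
by rewrite lerDr r0 /= -addn1 natrD mulrDl mul1r addrC ltrD2l.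
Qed.

Lemma sin_residue_eq0 x : (sin x == 0) = (sin (residue x) == 0).
Proof. by rewrite [in LHS](residueE x) sinDpin_eq0. Qed.

Lemma residue_gt0 x : 0 <= x -> (0 < residue x) = (sin x != 0).
Proof.
move=> /residue_itv/andP[r0 rp]; rewrite sin_residue_eq0.
case: (ltP 0 (residue x)) => rx; first by rewrite sin_neq0_pi ?rx ?rp.
have -> : residue x = 0 by apply/eqP; rewrite eq_le rx r0.
by rewrite sin0 eqxx.
Qed.

Lemma cot_residue x : cot (residue x) = cot x.
Proof. by rewrite [in RHS](residueE x) cotDpin. Qed.

(* The cotangent addition formula (x y - 1) / (x + y), on its two branches. *)
Lemma cot_sum_pos x1 y1 x2 y2 : 0 < x1 + y1 -> 0 < x2 + y2 ->
  (x1 * y1 - 1) / (x1 + y1) + (x2 * y2 - 1) / (x2 + y2) <=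
  ((x1 + x2) * (y1 + y2) - 1) / ((x1 + x2) + (y1 + y2)).
Proof.
move=> s1 s2; have s3 : 0 < (x1 + x2) + (y1 + y2) by lra.
rewrite -subr_ge0.
(* The square of [x1 * y2 - x2 * y1] is the superadditivity defect of x y / (x + y), the other terms
   that of - 1 / (x + y). *)
have -> : ((x1 + x2) * (y1 + y2) - 1) / (x1 + x2 + (y1 + y2)) -
  ((x1 * y1 - 1) / (x1 + y1) + (x2 * y2 - 1) / (x2 + y2)) =
  ((x1 * y2 - x2 * y1) ^+ 2 + (x1 + y1) ^+ 2 + (x2 + y2) ^+ 2 + (x1 + y1) * (x2 + y2)) /
  ((x1 + y1) * (x2 + y2) * ((x1 + x2) + (y1 + y2))).
  by field; rewrite !gt_eqF.
apply: divr_ge0; last by rewrite !mulr_ge0 // ltW.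
by rewrite !addr_ge0 ?sqr_ge0 // mulr_ge0 // ltW.
Qed.

(** Beyond the pole: the second pair and the total have negative sums. It serves the case where
    exactly one incoming edge has residues adding up to pi or more. *)
Lemma cot_sum_neg x1 y1 x2 y2 : 0 < x1 + y1 -> (x1 + x2) + (y1 + y2) < 0 ->
  (x1 * y1 - 1) / (x1 + y1) + (x2 * y2 - 1) / (x2 + y2) <=
  ((x1 + x2) * (y1 + y2) - 1) / ((x1 + x2) + (y1 + y2)).
Proof.
move=> s1 s3; have s2 : x2 + y2 < 0 by lra.
rewrite -subr_ge0.
have -> : ((x1 + x2) * (y1 + y2) - 1) / (x1 + x2 + (y1 + y2)) -
  ((x1 * y1 - 1) / (x1 + y1) + (x2 * y2 - 1) / (x2 + y2)) =
  ((x1 * y2 - x2 * y1) ^+ 2 + (x1 + y1) ^+ 2 + (x2 + y2) * ((x1 + x2) + (y1 + y2))) /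
  ((x1 + y1) * ((x2 + y2) * ((x1 + x2) + (y1 + y2)))).
  by field; rewrite ?(gt_eqF s1) ?(lt_eqF s2) ?(lt_eqF s3).
have s23 : 0 < (x2 + y2) * ((x1 + x2) + (y1 + y2)) by rewrite nmulr_rgt0.
apply: divr_ge0; first by rewrite !addr_ge0 ?sqr_ge0 // ltW.
by apply: mulr_ge0; apply: ltW.
Qed.

Lemma cot_sum_pos_big (I : eqType) (r : seq I) (u v : I -> R) :
  r != [::] -> {in r, forall i, 0 < u i + v i} ->
  0 < \sum_(i <- r) u i + \sum_(i <- r) v i /\
  \sum_(i <- r) (u i * v i - 1) / (u i + v i) <=
  ((\sum_(i <- r) u i) * (\sum_(i <- r) v i) - 1) /
    (\sum_(i <- r) u i + \sum_(i <- r) v i).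
Proof.
elim: r => // a [|b r] IHr _ uv.
  by rewrite !big_seq1 lexx uv // mem_head.
have [|s0 le] := IHr isT; first by move=> i ir; rewrite uv // in_cons ir orbT.
have a0 : 0 < u a + v a by rewrite uv // mem_head.
rewrite !(big_cons _ _ a); split; first by move: a0 s0; lra.
by apply: le_trans (cot_sum_pos a0 s0); rewrite lerD2l.
Qed.

End Phase.

(** * Kirchhoff vertices and superadditivity of the outgoing phase *)

Section VertexPhase.
Variables (R : realType) (I : finType) (p : pred I).
Implicit Types th ph : I -> R.

(** The logarithmic derivative of a wave is proportional to the cotangent of its phase. With a
    single outgoing edge, the Kirchhoff condition says that the incoming cotangents add up to the
    outgoing one. *)
Definition resid_phase th : R :=
  if [forall i, p i ==> (sin (th i) != 0)]
  then acot (\sum_(i | p i) cot (th i)) else 0.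

(* Prufer phase leaving a Kirchhoff vertex, given the incoming phases. When
   an incoming wave vanishes at the vertex the outgoing phase is reset to the
   next zero. *)
Definition vertex_phase th : R :=
  (\sum_(i | p i) halfturns (th i))%:R * pi + resid_phase th.

Lemma resid_phase_itv th : 0 <= resid_phase th < pi.
Proof.
rewrite /resid_phase; case: ifP => _; last by rewrite lexx pi_gt0.
by rewrite ltW ?acot_gt0 ?acot_ltpi.
Qed.

Lemma vertex_phase_ge0 th : 0 <= vertex_phase th.
Proof.
have /andP[r0 _] := resid_phase_itv th.
by rewrite addr_ge0 // mulr_ge0 ?pi_ge0.
Qed.

Lemma halfturns_vertex_phase th :
  halfturns (vertex_phase th) = (\sum_(i | p i) halfturns (th i))%N.
Proof. by apply: (halfturnsD (resid_phase_itv th)); rewrite addrC. Qed.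

Lemma cot_vertex_phase th : (forall i, p i -> sin (th i) != 0) ->
  sin (vertex_phase th) != 0 /\
  cot (vertex_phase th) = \sum_(i | p i) cot (th i).
Proof.
move=> th0; rewrite /vertex_phase addrC sinDpin_eq0 cotDpin /resid_phase.
rewrite (introT forallP) => [|i]; last exact/implyP/th0.
by rewrite acotK sin_neq0_pi // acot_gt0 acot_ltpi.
Qed.

Lemma eq_vertex_phase th ph : (forall i, p i -> th i = ph i) ->
  vertex_phase th = vertex_phase ph.
Proof.
move=> tp; rewrite /vertex_phase /resid_phase; congr (_%:R * pi + _).
  by apply: eq_bigr => i /tp ->.
rewrite (eq_bigr (fun i => cot (ph i))) => [|i /tp -> //].
congr (if _ then _ else _); apply/eq_forallb => i.
by case: (boolP (p i)) => // /tp ->.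
Qed.

Hypothesis p_nonempty : exists i, p i.

Section Superadd.
Variables th ph : I -> R.
Hypothesis th_ge0 : forall i, 0 <= th i.
Hypothesis ph_ge0 : forall i, 0 <= ph i.

Let a i := residue (th i).
Let b i := residue (ph i).
Let a_itv i : 0 <= a i < pi. Proof. exact: residue_itv. Qed.
Let b_itv i : 0 <= b i < pi. Proof. exact: residue_itv. Qed.
(** The half-turn gained when the two residues are added. *)
Let carry i : nat := (pi <= a i + b i)%R.

Let halfturns_add i :
  halfturns (th i + ph i) = (halfturns (th i) + halfturns (ph i) + carry i)%N.
Proof.
have /andP[a0 ap] := a_itv i; have /andP[b0 bp] := b_itv i.
apply: (@halfturnsD _ _ _ (a i + b i - (carry i)%:R * pi)).
  by rewrite /carry; case: (leP pi (a i + b i)) => /= ab; lra.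
rewrite [in LHS](residueE (th i)) [in LHS](residueE (ph i)) -/(a i) -/(b i).
by rewrite !natrD; ring.
Qed.

Let residue_add i : residue (th i + ph i) = a i + b i - (carry i)%:R * pi.
Proof. by rewrite /residue halfturns_add !natrD /a /b /residue; ring. Qed.

Let cot_add i : cot (th i + ph i) = cot (a i + b i).
Proof. by rewrite -cot_residue residue_add -[LHS](cotDpin _ (carry i)) subrK. Qed.

Let sin_add i : (sin (th i + ph i) == 0) = (sin (a i + b i) == 0).
Proof.
by rewrite sin_residue_eq0 residue_add -[LHS](sinDpin_eq0 _ (carry i)) subrK.
Qed.

Let nocarry_monor i : carry i = 0%N -> sin (ph i) != 0 ->
  sin (th i + ph i) != 0 /\ cot (th i + ph i) <= cot (ph i).
Proof.
rewrite /carry; case: (leP pi (a i + b i)) => // ab _.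
rewrite -residue_gt0 // -/(b i) => b0; have /andP[a0 _] := a_itv i.
have ab0 : 0 < a i + b i < pi by rewrite ab ltr_wpDl.
rewrite sin_add sin_neq0_pi // cot_add -(cot_residue (ph i)) le_cot ?lerDr //.
by have /andP[_ ->] := b_itv i; rewrite b0.
Qed.

Let nocarry_monol i : carry i = 0%N -> sin (th i) != 0 ->
  sin (th i + ph i) != 0 /\ cot (th i + ph i) <= cot (th i).
Proof.
rewrite /carry; case: (leP pi (a i + b i)) => // ab _.
rewrite -residue_gt0 // -/(a i) => a0; have /andP[b0 _] := b_itv i.
have ab0 : 0 < a i + b i < pi by rewrite ab ltr_wpDr.
rewrite sin_add sin_neq0_pi // cot_add -(cot_residue (th i)) le_cot ?lerDl //.
by have /andP[_ ->] := a_itv i; rewrite a0.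
Qed.

(** Needed when one family has a vanishing sine and contributes 0: without carries, adding it only
    lowers the cotangents of the other family [f]. *)
Let resid_le_resid (f : I -> R) :
  (forall i, carry i = 0%N -> sin (f i) != 0 ->
    sin (th i + ph i) != 0 /\ cot (th i + ph i) <= cot (f i)) ->
  (\sum_(i | p i) carry i = 0)%N ->
  resid_phase f <= resid_phase (fun i => th i + ph i).
Proof.
move=> mono /eqP; rewrite sum_nat_eq0 => /forallP nocarry.
have nc i : p i -> carry i = 0%N by move=> pi0; have := nocarry i; rewrite pi0 => /eqP.
rewrite /resid_phase; case: ifP => [/forallP f0|_]; last first.
  by have /andP[] := resid_phase_itv (fun i => th i + ph i).
have H i (pi0 : p i) := mono i (nc i pi0) (implyP (f0 i) pi0).
rewrite (introT forallP) => [|i]; last by apply/implyP => /H[].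
rewrite -le_acot ?acot_gt0 ?acot_ltpi // acotK.
by apply: ler_sum => i /H[].
Qed.

(** Without carries, superadditivity of (x y - 1) / (x + y), summed over the edges, compares the
    outgoing cotangents. With one carry, the overflowing edge goes through the negative branch and
    the others are grouped as before. *)
Let main_case : (\sum_(i | p i) carry i <= 1)%N ->
  (forall i, p i -> sin (th i) != 0) -> (forall i, p i -> sin (ph i) != 0) ->
  resid_phase th + resid_phase ph <=
    (\sum_(i | p i) carry i)%:R * pi + resid_phase (fun i => th i + ph i).
Proof.
move=> J1 th0 ph0.
have a0 i : p i -> 0 < a i by move=> /th0; rewrite -residue_gt0.
have b0 i : p i -> 0 < b i by move=> /ph0; rewrite -residue_gt0.
have sa i : p i -> 0 < sin (a i).
  by move=> pi0; apply: sin_gt0_pi; rewrite a0 //; have /andP[] := a_itv i.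
have sb i : p i -> 0 < sin (b i).
  by move=> pi0; apply: sin_gt0_pi; rewrite b0 //; have /andP[] := b_itv i.
have sE i : p i -> cot (a i) + cot (b i) = sin (a i + b i) / (sin (a i) * sin (b i)).
  by move=> pi0; rewrite cotD // gt_eqF ?sa ?sb.
have s_pos i : p i -> carry i = 0%N -> 0 < cot (a i) + cot (b i).
  rewrite /carry => pi0; case: (leP pi (a i + b i)) => // ab _.
  by rewrite sE // divr_gt0 ?mulr_gt0 ?sa ?sb // sin_gt0_pi // ab addr_gt0 ?a0 ?b0.
pose A := \sum_(i | p i) cot (a i); pose B := \sum_(i | p i) cot (b i).
have rth : resid_phase th = acot A.
  rewrite /resid_phase (introT forallP) => [|i]; last exact/implyP/th0.
  by congr acot; apply: eq_bigr => i _; rewrite cot_residue.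
have rph : resid_phase ph = acot B.
  rewrite /resid_phase (introT forallP) => [|i]; last exact/implyP/ph0.
  by congr acot; apply: eq_bigr => i _; rewrite cot_residue.
have cotAB : cot (acot A + acot B) = (A * B - 1) / (A + B).
  by rewrite cot_sum ?acotK // sin_neq0_pi // acot_gt0 acot_ltpi.
have sAB : A + B = sin (acot A + acot B) / (sin (acot A) * sin (acot B)).
  by rewrite -cotD ?acotK // sin_neq0_pi // acot_gt0 acot_ltpi.
have sA := sin_gt0_pi (introT andP (conj (acot_gt0 A) (acot_ltpi A))).
have sB := sin_gt0_pi (introT andP (conj (acot_gt0 B) (acot_ltpi B))).
have [A0 Ap] := (acot_gt0 A, acot_ltpi A); have [B0 Bp] := (acot_gt0 B, acot_ltpi B).
rewrite rth rph.
have big_pos (q : pred I) (r := [seq i <- index_enum I | q i]) : r != [::] ->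
    (forall i, q i -> p i && (carry i == 0%N)) ->
    0 < \sum_(i | q i) cot (a i) + \sum_(i | q i) cot (b i) /\
    \sum_(i | q i) cot (a i + b i) <=
      ((\sum_(i | q i) cot (a i)) * (\sum_(i | q i) cot (b i)) - 1) /
      (\sum_(i | q i) cot (a i) + \sum_(i | q i) cot (b i)).
  move=> r0 qp; have [|h1 h2] := @cot_sum_pos_big R I r (fun i => cot (a i)) (fun i => cot (b i)) r0.
    by move=> i; rewrite mem_filter => /andP[/qp/andP[pi0 /eqP ci] _]; apply: s_pos.
  move: h1 h2; rewrite /r !big_filter => h1 h2; split=> //. apply: le_trans h2.
  rewrite le_eqVlt; apply/orP; left; apply/eqP; apply: eq_bigr => i /qp/andP[pi0 _].
  by rewrite cot_sum ?gt_eqF ?sa ?sb.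
have sinBpi x : sin (x - pi) = - sin x by rewrite -[x in RHS](subrK pi) sinDpi opprK.
have sAB_sign : (0 < A + B) = (0 < sin (acot A + acot B)).
  by rewrite sAB pmulr_lgt0 // invr_gt0 mulr_gt0.
have resid_add : (forall i, p i -> sin (a i + b i) != 0) ->
    resid_phase (fun i => th i + ph i) = acot (\sum_(i | p i) cot (a i + b i)).
  move=> ab0; rewrite /resid_phase (introT forallP) => [|i]; last first.
    by apply/implyP => /ab0; rewrite sin_add.
  by congr acot; apply: eq_bigr => i _; rewrite cot_add.
have sin_nc i : p i -> carry i = 0%N -> sin (a i + b i) != 0.
  rewrite /carry => pi0; case: (leP pi (a i + b i)) => // ab _.
  by rewrite sin_neq0_pi // ab addr_gt0 ?a0 ?b0.
case: (posnP (\sum_(i | p i) carry i)%N) => [J0|J0].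
  rewrite J0 mul0r add0r.
  have nc i : p i -> carry i = 0%N.
    move=> pi0; move/eqP: J0; rewrite sum_nat_eq0 => /forallP/(_ i).
    by rewrite pi0 => /eqP.
  have [||AB0 le] := big_pos p.
  - have [i pi0] := p_nonempty; apply/eqP => r0.
    by have := mem_filter p i (index_enum I); rewrite r0 pi0 mem_index_enum.
  - by move=> i pi0; rewrite pi0 nc.
  have ABp : acot A + acot B < pi.
    rewrite ltNge; apply/negP => ABp; move: AB0; rewrite -/A -/B sAB_sign.
    rewrite -oppr_lt0 -sinBpi ltNge sin_ge0_pi // subr_ge0 ABp /=; lra.
  rewrite resid_add => [|i pi0]; last by rewrite sin_nc ?nc.
  by rewrite -le_acot ?cotAB // addr_gt0 // ABp.
have J1' : (\sum_(i | p i) carry i = 1)%N by apply/eqP; rewrite eqn_leq J1 J0.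
rewrite J1' mul1r; have /andP[r0 _] := resid_phase_itv (fun i => th i + ph i).
(* Up to pi the carry alone pays for both residues; beyond pi, [A + B] is negative. *)
case: (leP (acot A + acot B) pi) => [?|ABp]; first by lra.
have AB0 : A + B < 0.
  rewrite ltNge le_eqVlt negb_or sAB_sign -leNgt -oppr_ge0 -sinBpi.
  rewrite sin_ge0_pi ?andbT ?subr_ge0 ?(ltW ABp) /=; last lra.
  rewrite eq_sym sAB mulf_neq0 ?invr_eq0 ?mulf_neq0 ?(gt_eqF sA) ?(gt_eqF sB) //.
  by rewrite -oppr_eq0 -sinBpi sin_neq0_pi // subr_gt0 ABp /=; lra.
have [i0 pi0 ci0] : exists2 i, p i & carry i != 0%N.
  move: J0; rewrite lt0n sum_nat_eq0 negb_forall => /existsP[k].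
  by rewrite negb_imply => /andP[? ?]; exists k.
have rest i : p i && (i != i0) -> p i && (carry i == 0%N).
  move=> /andP[pi1 ii0]; rewrite pi1 /=; move: J1'.
  rewrite (bigD1 i0) //= (bigD1 i) /= ?pi1 //; move: ci0.
  move: (carry i0) (carry i) (\sum_(_ <- _ | _) _)%N => x y z.
  by case: x => // x _; case: y => // y; rewrite addSn addnS.
have AE : A = cot (a i0) + \sum_(i | p i && (i != i0)) cot (a i).
  by rewrite /A (bigD1 i0).
have BE : B = cot (b i0) + \sum_(i | p i && (i != i0)) cot (b i).
  by rewrite /B (bigD1 i0).
have ABi0 : A + B = cot (a i0) + cot (b i0) +
    (\sum_(i | p i && (i != i0)) cot (a i) + \sum_(i | p i && (i != i0)) cot (b i)).
  by rewrite AE BE; ring.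
have rest_pos : [seq i <- index_enum I | p i && (i != i0)] = [::] \/
    [seq i <- index_enum I | p i && (i != i0)] != [::].
  by case: eqP; [left|right].
have rest_nil (f : I -> R) : [seq i <- index_enum I | p i && (i != i0)] = [::] ->
    \sum_(i | p i && (i != i0)) f i = 0 by move=> r; rewrite -big_filter r big_nil.
have rest0 : 0 <= \sum_(i | p i && (i != i0)) cot (a i) +
                  \sum_(i | p i && (i != i0)) cot (b i).
  case: rest_pos => [r|/big_pos[//|/ltW//]].
  by rewrite !rest_nil // addr0.
(* Were this sine 0, the edge [i0] would contribute 0 to [A + B] and the others a nonnegative
   amount. *)
have sin0 : sin (a i0 + b i0) != 0.
  apply: contraTneq AB0 => s0.
  by rewrite -leNgt ABi0 sE // s0 mul0r add0r.
rewrite resid_add => [|i pi1]; last first.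
  have [->//|ii0] := eqVneq i i0; have /andP[_ /eqP ci] := rest i (introT andP (conj pi1 ii0)).
  exact: sin_nc.
rewrite -lerBlDl -le_acot; last by rewrite subr_gt0 ABp /=; lra.
have -> : cot (acot A + acot B - pi) = cot (acot A + acot B).
  by rewrite -[LHS](cotDpin _ 1) mul1r subrK.
rewrite cotAB (bigD1 i0) //= cot_sum ?gt_eqF ?sa ?sb //.
case: rest_pos => [r|/big_pos[//|rp rle]]; rewrite AE BE.
  by rewrite !rest_nil // !addr0.
rewrite addrC; apply: le_trans (lerD rle (lexx _)) _.
have s3 : (\sum_(i | p i && (i != i0)) cot (a i) + cot (a i0)) +
    (\sum_(i | p i && (i != i0)) cot (b i) + cot (b i0)) < 0.
  by move: AB0; rewrite ABi0; lra.
apply: le_trans (cot_sum_neg rp s3) _.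
by rewrite (addrC _ (cot (a i0))) (addrC _ (cot (b i0))).
Qed.

(** Half-turns add up exactly, apart from [J] carries. Two carries outweigh the two residues, each
    below pi, which leaves [J <= 1]. *)
Lemma vertex_phaseD :
  vertex_phase th + vertex_phase ph <= vertex_phase (fun i => th i + ph i).
Proof.
pose J := (\sum_(i | p i) carry i)%N.
have HJ : (\sum_(i | p i) halfturns (th i + ph i) =
    \sum_(i | p i) halfturns (th i) + \sum_(i | p i) halfturns (ph i) + J)%N.
  by rewrite /J -!big_split /=; apply: eq_bigr => i _; rewrite halfturns_add.
rewrite /vertex_phase HJ !natrD.
suff : resid_phase th + resid_phase ph <=
    J%:R * pi + resid_phase (fun i => th i + ph i) by move=> *; lra.
have /andP[t0 tp] := resid_phase_itv th; have /andP[f0 fp] := resid_phase_itv ph.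
have /andP[s0 sp] := resid_phase_itv (fun i => th i + ph i).
have p0 := @pi_gt0 R.
case: (leqP 2 J) => [J2|J2].
  have : 2%:R * pi <= J%:R * pi :> R by rewrite ler_pM2r // ler_nat.
  lra.
have zero f : ~~ [forall i, p i ==> (sin (f i) != 0)] -> resid_phase f = 0.
  by rewrite /resid_phase => /negbTE ->.
have J01 : J = 0%N \/ J = 1%N by move: J2; case: (J) => [|[|]]; [left|right|].
case: (boolP [forall i, p i ==> (sin (th i) != 0)]) => [/forallP th0|/zero ->].
  case: (boolP [forall i, p i ==> (sin (ph i) != 0)]) => [/forallP ph0|/zero ->].
    by apply: main_case => [//|i|i]; [apply/implyP/th0|apply/implyP/ph0].
  case: J01 => J01; rewrite J01 ?mul0r ?mul1r addr0 ?add0r; last by lra.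
  exact: resid_le_resid.
case: J01 => J01; rewrite J01 ?mul0r ?mul1r !add0r; last by lra.
exact: resid_le_resid.
Qed.

End Superadd.

(** Monotonicity is superadditivity applied to [th] and [ph - th], outgoing phases being
    nonnegative. *)
Lemma le_vertex_phase th ph : (forall i, 0 <= th i <= ph i) ->
  vertex_phase th <= vertex_phase ph.
Proof.
move=> tp; have -> : ph = fun i => th i + (ph i - th i).
  by apply/funext => i; rewrite addrC subrK.
apply: le_trans (vertex_phaseD _ _) => [|i|i].
- by rewrite lerDl vertex_phase_ge0.
- by have /andP[] := tp i.
- by rewrite subr_ge0; have /andP[] := tp i.
Qed.

Lemma vertex_phaseMn th m : (forall i, 0 <= th i) ->
  m.+1%:R * vertex_phase th <= vertex_phase (fun i => m.+1%:R * th i).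
Proof.
move=> th0; elim: m => [|m IHm].
  rewrite mul1r (_ : (fun i => 1 * th i) = th) //.
  by apply/funext => i; rewrite mul1r.
have -> : (fun i => m.+2%:R * th i) = fun i => m.+1%:R * th i + th i.
  by apply/funext => i; rewrite -(addn1 m.+1) natrD mulrDl mul1r.
apply: le_trans (vertex_phaseD _ th0) => [|i]; last by rewrite mulr_ge0.
by rewrite -(addn1 m.+1) natrD mulrDl mul1r lerD2r.
Qed.

End VertexPhase.

(** * Oscillation counts on an oriented network *)

Lemma constraint_space (F : realFieldType) n (I : finType) (P : pred I)
  (u : I -> 'cV[F]_n) : exists2 U : 'M[F]_n, (n - #|P| <= \rank U)%N &
  forall x : 'rV_n, (x <= U)%MS -> forall i, P i -> (x *m u i) 0 0 = 0.
Proof.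
pose M : 'M[F]_(n, #|P|) := \matrix_(j, k) u (enum_val k) j 0.
exists (kermx M); first by rewrite mxrank_ker leq_sub2l // rank_leq_col.
move=> x /sub_kermxP xM i Pi; have /rowP/(_ (enum_rank_in Pi i)) := xM.
rewrite !mxE => E; rewrite -[RHS]E; apply: eq_bigr => j _.
by rewrite mxE enum_rankK_in.
Qed.

Section Weights.
Variable R : realType.
Implicit Types w l : R.

(* On a piece of length l, the solution of -u'' = w^2 u with boundary values
   x and y has outgoing derivatives s y - c x and s x - c y. *)
Definition sinw w l : R := if w == 0 then l else sin (w * l) / w.
Definition diag_weight w l : R := cos (w * l) / sinw w l.
Definition offdiag_weight w l : R := (sinw w l)^-1.

(** Completion of the square along the wave of phase [a] at the start and [a + w * l] at the end:
    the square vanishes when [x] and [y] are proportional to its values, and the boundary terms are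
    its logarithmic derivatives. *)
Lemma edge_form_square w l a x y : w != 0 -> sin (w * l) != 0 ->
  sin a != 0 -> sin (a + w * l) != 0 ->
  diag_weight w l * (x ^+ 2 + y ^+ 2) - 2 * offdiag_weight w l * (x * y) =
  w * cot (a + w * l) * y ^+ 2 - w * cot a * x ^+ 2 +
  w * (sin (a + w * l) / (sin (w * l) * sin a)) *
    (x - sin a / sin (a + w * l) * y) ^+ 2.
Proof.
move=> w0 sl sa sal; rewrite /diag_weight /offdiag_weight /sinw (negbTE w0) /cot.
have cal : cos (a + w * l) = (cos (w * l) * sin (a + w * l) - sin a) / sin (w * l).
  apply: (mulIf sl); rewrite divfK // sinD cosD.
  have /eqP := cos2Dsin2 (w * l); rewrite addrC -subr_eq0 => /eqP cs.
  apply/eqP; rewrite -subr_eq0; apply/eqP.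
  rewrite -[RHS](mulr0 (- sin a)) -[in RHS]cs; ring.
have ca : cos a = (sin (a + w * l) - sin a * cos (w * l)) / sin (w * l).
  by apply: (mulIf sl); rewrite divfK // sinD; ring.
rewrite cal ca; field; by rewrite w0 sl sa sal.
Qed.

End Weights.

Lemma sinDpin (R : realType) (x : R) n : sin (x + n%:R * pi) = (-1) ^+ n * sin x.
Proof. by rewrite mulr_natl (alternatingn (@sinDpi R)). Qed.

(** * Propagation of phases along the orientation *)

Section Oriented.
Variables (R : realType) (W Y : finType) (src tgt : Y -> W) (VD D : {set W}).
Variables (len : Y -> R) (out : W -> Y) (rk : W -> nat).
Hypothesis VD_sub : VD \subset D.
Hypothesis len_gt0 : forall y, 0 < len y.
Hypothesis src_out : forall w, w \notin D -> src (out w) = w.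
Hypothesis out_src : forall y, src y \notin D -> out (src y) = y.
Hypothesis has_in : forall w, w \notin D -> exists y, tgt y == w.
Hypothesis rk_lt : forall y, src y \notin D -> tgt y \notin D ->
  (rk (src y) < rk (tgt y))%N.

(** The pieces are followed backwards, with [k] as fuel. Ranks drop on the way, so fuel above the
    rank never runs out and the final 0 is a filler. *)
Fixpoint node_phase_rec (om : R) (k : nat) (w : W) : R :=
  if w \in D then 0 else
  if k is k'.+1 then
    vertex_phase [pred y | tgt y == w] (fun y => node_phase_rec om k' (src y) + om * len y)
  else 0.

Definition node_phase om w := node_phase_rec om (\max_w rk w).+1 w.
Definition piece_phase om y := node_phase om (src y) + om * len y.

Lemma node_phase_rec_ge0 om k w : 0 <= om -> 0 <= node_phase_rec om k w.
Proof. by case: k => [|k] om0 /=; case: ifP => // _; apply: vertex_phase_ge0. Qed.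

Lemma node_phase_rec_stable om k k' w : (rk w < k)%N -> (rk w < k')%N ->
  node_phase_rec om k w = node_phase_rec om k' w.
Proof.
elim: k k' w => [|k IHk] [|k'] w //= wk wk'; case: ifP => // /negbT wD.
apply: eq_vertex_phase => y /eqP yw; congr (_ + _).
case: (boolP (src y \in D)) => sD; first by case: (k) (k') => [|?] [|?] /=; rewrite sD.
by apply: IHk; apply: leq_trans (rk_lt sD _) _; rewrite yw.
Qed.

Lemma node_phaseE om w : w \notin D ->
  node_phase om w = vertex_phase [pred y | tgt y == w] (piece_phase om).
Proof.
move=> wD; rewrite {1}/node_phase /= (negbTE wD).
apply: eq_vertex_phase => y /eqP yw; congr (_ + _).
case: (boolP (src y \in D)) => sD; first by rewrite /node_phase; case: (\max_w _) => [|?] /=; rewrite sD.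
have lt : (rk (src y) < \max_w rk w)%N.
  by apply: leq_trans (rk_lt sD _) _; rewrite yw //; apply: leq_bigmax.
by apply: node_phase_rec_stable => //; apply: ltnW.
Qed.

Lemma node_phase_D om w : w \in D -> node_phase om w = 0.
Proof. by move=> wD; rewrite /node_phase /= wD. Qed.

Lemma node_phase_ge0 om w : 0 <= om -> 0 <= node_phase om w.
Proof. exact: node_phase_rec_ge0. Qed.

Lemma piece_phase_ge0 om y : 0 <= om -> 0 <= piece_phase om y.
Proof. by move=> om0; rewrite addr_ge0 ?node_phase_ge0 // mulr_ge0 // ltW. Qed.

Lemma node_phase_le om om' w : 0 <= om <= om' -> node_phase om w <= node_phase om' w.
Proof.
move=> /andP[om0 le]; rewrite /node_phase; move: (\max_v rk v).+1 w => k.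
elim: k => [|k IHk] w /=; case: ifP => // /negbT wD.
have [y0 wy0] := has_in wD.
apply: le_vertex_phase => [|y]; first by exists y0.
rewrite addr_ge0 ?node_phase_rec_ge0 ?mulr_ge0 ?(ltW (len_gt0 _)) //=.
by rewrite lerD ?IHk // ler_wpM2r // ltW.
Qed.

Lemma piece_phase_lt om om' y : 0 <= om -> om < om' -> piece_phase om y < piece_phase om' y.
Proof.
move=> om0 lt; rewrite /piece_phase ler_ltD ?ltr_pM2r //.
by apply: node_phase_le; rewrite om0 ltW.
Qed.

Lemma node_phaseM om m w : 0 <= om ->
  m.+1%:R * node_phase om w <= node_phase (m.+1%:R * om) w.
Proof.
move=> om0; rewrite /node_phase; move: (\max_v rk v).+1 w => k.
elim: k => [|k IHk] w /=; case: ifP; rewrite ?mulr0 // => /negbT wD.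
have [y0 wy0] := has_in wD.
have ne : exists y, [pred y | tgt y == w] y by exists y0.
apply: le_trans; first apply: (vertex_phaseMn ne) => y.
  by rewrite addr_ge0 ?node_phase_rec_ge0 ?mulr_ge0 ?(ltW (len_gt0 _)).
apply: le_vertex_phase => // y.
rewrite mulr_ge0 ?addr_ge0 ?node_phase_rec_ge0 ?mulr_ge0 ?(ltW (len_gt0 _)) //=.
by rewrite mulrDr -mulrA lerD2r.
Qed.

Lemma piece_phaseM om m y : 0 <= om ->
  m.+1%:R * piece_phase om y <= piece_phase (m.+1%:R * om) y.
Proof. by move=> om0; rewrite /piece_phase mulrDr -mulrA lerD2r node_phaseM. Qed.

(* Number of zeros, on the cut graph, of the wave of frequency om started at
   the nodes of D. *)
Definition zero_count om := (\sum_(y | tgt y \in D) halfturns (piece_phase om y))%N.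

Lemma zero_countM om m : 0 <= om ->
  (m.+1 * zero_count om <= zero_count (m.+1%:R * om))%N.
Proof.
move=> om0; rewrite big_distrr /=; apply: leq_sum => y _.
have p0 := piece_phase_ge0 y om0; have pi0 := @pi_gt0 R.
rewrite /halfturns truncn_ge_nat; last by rewrite divr_ge0 ?piece_phase_ge0 ?mulr_ge0 // ltW.
rewrite ler_pdivlMr //; apply: le_trans (piece_phaseM m y om0).
rewrite natrM -mulrA ler_wpM2l //.
by rewrite [leRHS](residueE (piece_phase om y)) lerDr; have /andP[] := residue_itv p0.
Qed.

(** A piece is shorter than half a wavelength, so the wave meets at most one zero on it. *)
Lemma halfturnsS om y : 0 < om -> om * len y < pi ->
  halfturns (piece_phase om y) = halfturns (node_phase om (src y)) \/
  halfturns (piece_phase om y) = (halfturns (node_phase om (src y))).+1.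
Proof.
move=> om0 lt; have n0 := node_phase_ge0 (src y) (ltW om0).
rewrite /piece_phase; move: (node_phase om (src y)) n0 => a a0.
have l0 : 0 < om * len y by rewrite mulr_gt0.
have /andP[r0 rp] := residue_itv a0; have aE := residueE a.
case: (ltP (residue a + om * len y) pi) => H; [left|right].
  by apply: (@halfturnsD _ _ _ (residue a + om * len y)); [rewrite H addr_ge0 // ltW|lra].
apply: (@halfturnsD _ _ _ (residue a + om * len y - pi)).
  by rewrite subr_ge0 H /=; lra.
by rewrite -addn1 natrD mulrDl mul1r {1}aE; ring.
Qed.

Lemma halfturns_le x x' : x <= x' -> (@halfturns R x <= halfturns x')%N.
Proof. by move=> xx; apply: le_truncn; rewrite ler_pM2r // invr_gt0 pi_gt0. Qed.

(** A strictly increasing phase takes each multiple of pi at one frequency at most. *)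
Lemma piece_phase_inj om om' y : 0 <= om -> 0 <= om' ->
  sin (piece_phase om y) = 0 -> sin (piece_phase om' y) = 0 ->
  halfturns (piece_phase om y) = halfturns (piece_phase om' y) -> om = om'.
Proof.
move=> om0 om0' s s' h.
have zero t : 0 <= t -> sin (piece_phase t y) = 0 ->
    piece_phase t y = (halfturns (piece_phase t y))%:R * pi.
  move=> t0 st; have p0 := piece_phase_ge0 y t0.
  have := residue_gt0 p0; rewrite st eqxx /= lt_def => /negbT.
  have /andP[-> _] := residue_itv p0; rewrite andbT negbK => /eqP r0.
  by rewrite {1}(residueE (piece_phase t y)) r0 add0r.
have E : piece_phase om y = piece_phase om' y by rewrite zero // h -zero.
case: (ltgtP om om') => // lt.
  by have := piece_phase_lt y om0 lt; rewrite E ltxx.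
by have := piece_phase_lt y om0' lt; rewrite E ltxx.
Qed.

(** Pigeonhole. A bad frequency is determined by the piece, by which of the two frequencies fails,
    and by the number of half-turns, which is bounded by its value at the top frequency. One
    candidate more than there are such codes suffices. *)
Lemma generic_frequency al be m : 0 <= al < be ->
  exists2 om, al < om < be &
    forall y, sin (piece_phase om y) != 0 /\ sin (piece_phase (m.+1%:R * om) y) != 0.
Proof.
move=> /andP[al0 albe]; pose B := (\max_y halfturns (piece_phase (m.+1%:R * be) y)).+1.
pose N := #|{: Y * bool * 'I_B}|.
pose t (i : 'I_N.+1) := al + (be - al) * (i.+1%:R / N.+2%:R).
have t_itv i : al < t i < be.
  have i0 : 0 < i.+1%:R / N.+2%:R :> R by rewrite divr_gt0.
  have i1 : i.+1%:R / N.+2%:R < 1 :> R by rewrite ltr_pdivrMr // mul1r ltr_nat ltnS.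
  rewrite /t ltrDl mulr_gt0 ?subr_gt0 //= -ltrBrDl gtr_pMr ?subr_gt0 //.
have t0 i : 0 <= t i by have /andP[? _] := t_itv i; apply: ltW; apply: le_lt_trans al0 _.
have t_inj : injective t.
  move=> i j /addrI/(mulfI _); rewrite subr_eq0 gt_eqF // => /(_ isT).
  move/(mulIf _); rewrite invr_eq0 pnatr_eq0 => /(_ isT) /eqP.
  by rewrite eqr_nat eqSS => /eqP /val_inj.
pose mult (b : bool) : R := if b then m.+1%:R else 1.
have mult0 b : 0 < mult b by case: b.
have mult_le b : mult b <= m.+1%:R by case: b => //=; rewrite ler1n.
have mt0 b i : 0 <= mult b * t i by rewrite mulr_ge0 // ltW.
case: (boolP [exists i, [forall yb : Y * bool, sin (piece_phase (mult yb.2 * t i) yb.1) != 0]]).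
  move=> /existsP[i /forallP ti]; exists (t i) => // y.
  by have := ti (y, false); have := ti (y, true); rewrite /= mul1r.
move=> /existsPn bad.
have {}bad i : exists yb : Y * bool, sin (piece_phase (mult yb.2 * t i) yb.1) == 0.
  by have /forallPn[yb] := bad i; rewrite negbK; exists yb.
have bound yb i : (halfturns (piece_phase (mult yb.2 * t i) yb.1) < B)%N.
  rewrite ltnS; apply: leq_trans (leq_bigmax yb.1); apply: halfturns_le.
  have /andP[_ tb] := t_itv i.
  have le : mult yb.2 * t i <= m.+1%:R * be.
    by rewrite ler_pM ?mult_le ?t0 // ltW ?mult0.
  rewrite /piece_phase lerD ?ler_wpM2r ?(ltW (len_gt0 _)) //.
  by apply: node_phase_le; rewrite mt0.
pose code i : Y * bool * 'I_B := let yb := xchoose (bad i) in (yb, Ordinal (bound yb i)).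
have code_inj : injective code.
  move=> i j; rewrite /code; have := xchooseP (bad i); have := xchooseP (bad j).
  move: (xchoose (bad i)) (xchoose (bad j)) => yb yb' /eqP s' /eqP s [E]; rewrite -E in s' *.
  move=> h; apply: t_inj; have := piece_phase_inj (mt0 _ _) (mt0 _ _) s s' h.
  by apply: mulfI; rewrite gt_eqF.
by have := leq_card code code_inj; rewrite card_ord /N ltnn.
Qed.

Section Generic.
Variable om : R.
Hypothesis om_gt0 : 0 < om.
Hypothesis short : forall y, om * len y < pi.
Hypothesis generic : forall y, sin (piece_phase om y) != 0.

Lemma node_phase_generic w : w \notin D -> sin (node_phase om w) != 0 /\
  cot (node_phase om w) = \sum_(y | tgt y == w) cot (piece_phase om y).
Proof. by move=> wD; rewrite node_phaseE //; apply: cot_vertex_phase. Qed.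

Definition has_zero y :=
  halfturns (piece_phase om y) != halfturns (node_phase om (src y)).

(** Half-turns are conserved at the vertices, so those arriving in [D] count the pieces with a zero.
    A piece leaving [D] starts at phase 0 and stays below pi. *)
Lemma card_has_zero : #|[pred y | (src y \notin D) && has_zero y]| = zero_count om.
Proof.
have E y : halfturns (piece_phase om y) =
    (halfturns (node_phase om (src y)) + has_zero y)%N.
  rewrite /has_zero; case: (halfturnsS om_gt0 (short y)) => ->.
    by rewrite eqxx addn0.
  by rewrite eqn_leq ltnn addn1.
have S1 : (\sum_(y | src y \notin D) halfturns (node_phase om (src y)) =
    \sum_(y | tgt y \notin D) halfturns (piece_phase om y))%N.
  transitivity (\sum_(w | w \notin D) halfturns (node_phase om w))%N.
    rewrite (reindex_onto out src) => [|y]; last exact: out_src.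
    apply: eq_big => [w|w wD]; last by rewrite src_out //; case/andP: wD => ? /eqP <-.
    case: (boolP (w \in D)) => wD; last by rewrite src_out // wD eqxx.
    by apply/negbTE; rewrite negb_and negbK; case: eqP => [->|]; rewrite ?wD ?orbT.
  rewrite [RHS](partition_big tgt (fun w => w \notin D)) //=; apply: eq_bigr => w wD.
  rewrite node_phaseE // halfturns_vertex_phase; apply: eq_bigl => y.
  by rewrite /= andbC; case: eqP => // ->; rewrite wD.
have S2 y : src y \in D -> halfturns (piece_phase om y) = 0%N.
  move=> sD; apply: (@halfturnsD _ _ _ (om * len y)); rewrite ?short ?andbT.
    by rewrite mulr_ge0 // ltW.
  by rewrite /piece_phase node_phase_D // add0r mul0r addr0.
have : (\sum_y halfturns (piece_phase om y) =
    \sum_(y | src y \notin D) halfturns (node_phase om (src y)) +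
    #|[pred y | (src y \notin D) && has_zero y]|)%N.
  rewrite (bigID (fun y => src y \in D)) /= big1 // add0n.
  under eq_bigr do rewrite E.
  rewrite big_split /=; congr (_ + _)%N; rewrite -sum1_card.
  rewrite [RHS]big_mkcond [LHS]big_mkcond /=; apply: eq_bigr => y _.
  by rewrite inE; case: (src y \in D) => //=; case: (has_zero y).
rewrite (bigID (fun y => tgt y \in D)) /= S1 addnC => /eqP.
by rewrite eqn_add2l => /eqP <-.
Qed.

Let cw y := diag_weight om (len y).
Let sw y := offdiag_weight om (len y).
Let A := network_mx src tgt VD cw sw.

Definition ratio y := sin (node_phase om (src y)) / sin (piece_phase om y).

Definition square_weight y :=
  om * (sin (piece_phase om y) / (sin (om * len y) * sin (node_phase om (src y)))).

Let sin_len y : 0 < sin (om * len y).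
Proof. by apply: sin_gt0_pi; rewrite short mulr_gt0. Qed.

(* The boundary terms of the squares telescope by the Kirchhoff condition for
   the phases. *)
Lemma form_sum_of_squares (X : W -> R) : (forall w, w \in D -> X w = 0) ->
  \sum_y (cw y * (X (src y) ^+ 2 + X (tgt y) ^+ 2) - 2 * sw y * (X (src y) * X (tgt y))) =
  \sum_(y | src y \notin D) square_weight y * (X (src y) - ratio y * X (tgt y)) ^+ 2.
Proof.
move=> XD.
have E y : cw y * (X (src y) ^+ 2 + X (tgt y) ^+ 2) - 2 * sw y * (X (src y) * X (tgt y)) =
   om * cot (piece_phase om y) * X (tgt y) ^+ 2 +
   (if src y \notin D then square_weight y * (X (src y) - ratio y * X (tgt y)) ^+ 2 -
      om * cot (node_phase om (src y)) * X (src y) ^+ 2 else 0).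
  case: ifPn => sD; last first.
    (* On a piece leaving [D] both the initial phase and the initial value are 0, and only the
       boundary term at the head remains. *)
    rewrite negbK in sD; rewrite /piece_phase node_phase_D // (XD _ sD) add0r.
    rewrite /cw /sw /diag_weight /sinw gt_eqF // /cot; field.
    by rewrite !gt_eqF.
  have [sa _] := node_phase_generic sD.
  have om0 : om != 0 by rewrite gt_eqF.
  have sl : sin (om * len y) != 0 by rewrite gt_eqF.
  rewrite /cw /sw (edge_form_square _ _ om0 sl sa (generic y)).
  by rewrite /square_weight /ratio /piece_phase; ring.
rewrite (eq_bigr _ (fun y _ => E y)) big_split /= -big_mkcond /= big_split /= sumrN.
rewrite addrCA addrA -[RHS]addr0 -addrA; congr (_ + _); apply/eqP; rewrite subr_eq0; apply/eqP.
transitivity (\sum_(w | w \notin D) om * cot (node_phase om w) * X w ^+ 2).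
  rewrite (partition_big tgt predT) //= (bigID (fun w => w \in D)) /= big1 ?add0r.
    apply: eq_bigr => w wD; have [_ ->] := node_phase_generic wD.
    by rewrite mulr_sumr mulr_suml; apply: eq_bigr => y /eqP ->.
  by move=> w wD; rewrite big1 // => y /eqP ->; rewrite XD // expr0n mulr0.
rewrite [RHS](reindex_onto out src) => [|y]; last exact: out_src.
apply: eq_big => [w|w wD]; last by rewrite src_out.
case: (boolP (w \in D)) => wD; last by rewrite src_out // wD eqxx.
by apply/esym/negbTE; rewrite negb_and negbK; case: eqP => [->|]; rewrite ?wD ?orbT.
Qed.

(** The sign of a nonzero sine is the parity of the half-turns, so the quotient of sines changes
    sign exactly when a zero lies on the piece. *)
Lemma square_weight_sign y : src y \notin D ->
  if has_zero y then square_weight y < 0 else 0 < square_weight y.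
Proof.
move=> sD; have [sa _] := node_phase_generic sD; have sp := generic y.
have a0 : 0 <= node_phase om (src y) by rewrite node_phase_ge0 // ltW.
have p0 : 0 <= piece_phase om y by rewrite piece_phase_ge0 // ltW.
have ra : 0 < sin (residue (node_phase om (src y))).
  by apply: sin_gt0_pi; rewrite residue_gt0 // sa; have /andP[] := residue_itv a0.
have rp : 0 < sin (residue (piece_phase om y)).
  by apply: sin_gt0_pi; rewrite residue_gt0 // sp; have /andP[] := residue_itv p0.
have sign2 n : (-1) ^+ n * (-1) ^+ n = 1 :> R by rewrite -exprD addnn -mul2n exprM sqrrN expr1n expr1n.
have sw_eq n m : halfturns (piece_phase om y) = n -> halfturns (node_phase om (src y)) = m ->
    square_weight y = (-1) ^+ n * (-1) ^+ m * (om * sin (residue (piece_phase om y)) /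
      (sin (om * len y) * sin (residue (node_phase om (src y))))).
  move=> hn hm; rewrite /square_weight {1}(residueE (piece_phase om y)).
  rewrite {1}(residueE (node_phase om (src y))) hn hm !sinDpin.
  rewrite [(sin (om * len y) * _)^-1]invfM.
  have -> : ((-1) ^+ m * sin (residue (node_phase om (src y))))^-1 =
     (-1) ^+ m * (sin (residue (node_phase om (src y))))^-1.
    by rewrite invfM invr_sign.
  by rewrite invfM; ring.
have pos : 0 < om * sin (residue (piece_phase om y)) /
      (sin (om * len y) * sin (residue (node_phase om (src y)))).
  by rewrite divr_gt0 ?mulr_gt0.
rewrite /has_zero; case: (halfturnsS om_gt0 (short y)) => h.
  by rewrite h eqxx /= (sw_eq _ _ h erefl) sign2 mul1r.
by rewrite h eqn_leq ltnn /= (sw_eq _ _ h erefl) exprS mulN1r mulNr sign2 mulN1r oppr_lt0.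
Qed.

(** Vanishing on [D :\: VD] and killing the negative squares takes [#|D :\: VD| + zero_count om]
    linear conditions, after which the form is nonnegative. *)
Lemma leq_zero_count k : has_subspace (< 0) A k ->
  (k <= #|D :\: VD| + zero_count om)%N.
Proof.
pose P (i : W + Y) := match i with
  | inl w => w \in D :\: VD
  | inr y => (src y \notin D) && has_zero y end.
pose u (i : W + Y) : 'cV[R]_#|W| := match i with
  | inl w => (delta_mx 0 (enum_rank w))^T
  | inr y => (free_coord VD R (src y) - ratio y *: free_coord VD R (tgt y))^T end.
have cP : #|P| = (#|D :\: VD| + zero_count om)%N.
  by rewrite -card_has_zero -!sum1_card big_sumType /=.
move=> kneg; rewrite -cP.
suff : has_subspace (>= 0) A (#|W| - #|P|).
  move=> kpos; have := has_subspace_disjoint _ kneg kpos.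
  have H (t : R) : (< 0) t -> ~~ (>= 0) t by rewrite /= -ltNge.
  by move/(_ H); have [U kU _] := kneg; have := rank_leq_col U; lia.
have [U rU UP] := constraint_space P u; exists U => // x xU _ /=.
pose X := free_val VD x.
have XD w : w \in D -> X w = 0.
  move=> wD; rewrite /X /free_val; case: ifP => // wVD.
  have := UP x xU (inl w); rewrite /= inE wVD wD => /(_ isT).
  by rewrite trmx_delta -colE mxE.
rewrite qform_network (form_sum_of_squares XD) addr_ge0 //; last first.
  by apply: sumr_ge0 => w _; apply: sqr_ge0.
apply: sumr_ge0 => y sD; have := square_weight_sign sD; case: ifP => hz sgn.
  have := UP x xU (inr y); rewrite /= sD hz => /(_ isT).
  rewrite linearB linearZ /= mulmxBr -scalemxAr !mul_free_coord !mxE !eqxx !mulr1n => E.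
  by rewrite -/(X _) in E; rewrite E expr0n mulr0.
by rewrite mulr_ge0 ?sqr_ge0 // ltW.
Qed.

(** Here all of [D] is cancelled, the coordinates in [VD] carrying positive squares, and so are the
    positive squares. As [out] matches the nodes outside [D] with the squares, [zero_count om]
    dimensions are left. *)
Lemma zero_count_subspace : has_subspace (<= 0) A (zero_count om).
Proof.
pose P (i : W + Y) := match i with
  | inl w => w \in D
  | inr y => (src y \notin D) && ~~ has_zero y end.
pose u (i : W + Y) : 'cV[R]_#|W| := match i with
  | inl w => (delta_mx 0 (enum_rank w))^T
  | inr y => (free_coord VD R (src y) - ratio y *: free_coord VD R (tgt y))^T end.
have cP : (#|P| + zero_count om = #|W|)%N.
  have -> : #|P| = (#|D| + #|[pred y | (src y \notin D) && ~~ has_zero y]|)%N.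
    by rewrite -!sum1_card big_sumType /=.
  have cD : (#|[pred w | w \notin D]| = #|[pred y | src y \notin D]|)%N.
    rewrite -!sum1_card [RHS](reindex_onto out src) => [|y]; last exact: out_src.
    apply: eq_bigl => w; rewrite !inE.
    case: (boolP (w \in D)) => wD; last by rewrite src_out // wD eqxx.
    by apply/esym/negbTE; rewrite negb_and negbK; case: eqP => [->|]; rewrite ?wD ?orbT.
  rewrite -(cardC (mem D)) -addnA; congr (_ + _)%N.
  rewrite (_ : #|predC (mem D)| = #|[pred y | src y \notin D]|); last first.
    by rewrite -cD; apply: eq_card => w; rewrite !inE.
  rewrite -card_has_zero -!sum1_card addnC (bigID has_zero (fun y => y \in [pred y | src y \notin D])) /=.
  by congr (_ + _)%N; apply: eq_bigl => y; rewrite !inE.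
have [U rU UP] := constraint_space P u.
exists U; first by apply: leq_trans rU; rewrite -[X in (_ <= X - _)%N]cP addKn.
move=> x xU _ /=; pose X := free_val VD x.
have xD w : w \in D -> x 0 (enum_rank w) = 0.
  move=> wD; have := UP x xU (inl w); rewrite /= wD => /(_ isT).
  by rewrite trmx_delta -colE mxE.
have XD w : w \in D -> X w = 0.
  by move=> wD; rewrite /X /free_val; case: ifP => // _; apply: xD.
rewrite qform_network (form_sum_of_squares XD) [X in _ + X]big1 => [|w wVD]; last first.
  by rewrite xD ?expr0n // (fintype.subsetP VD_sub).
rewrite addr0; apply: sumr_le0 => y sD; have := square_weight_sign sD; case: ifP => hz sgn.
  by rewrite mulr_le0_ge0 ?sqr_ge0 // ltW.
have := UP x xU (inr y); rewrite /= sD hz => /(_ isT).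
rewrite linearB linearZ /= mulmxBr -scalemxAr !mul_free_coord !mxE !eqxx !mulr1n => E.
by rewrite -/(X _) in E; rewrite E expr0n mulr0.
Qed.

End Generic.
End Oriented.

(** * Subdivision of edges *)

(** The form of a piece is symmetric in its ends, so the matrix does not see the orientation. *)
Lemma network_mx_swap (W Y : finType) (lo hi : Y -> W) (VD : {set W}) (K : comNzRingType)
  (b : pred Y) (c s : Y -> K) :
  network_mx (fun y => if b y then hi y else lo y) (fun y => if b y then lo y else hi y) VD c s =
  network_mx lo hi VD c s.
Proof.
rewrite /network_mx; congr (_ + _)%R; apply: eq_bigr => y _; case: (b y) => //.
by congr (_ *: _ - _ *: _)%R; apply: addrC.
Qed.

Section Subdivision.
Local Open Scope nat_scope.
Variables (V E : finType) (endpt : E * bool -> V) (M : nat).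

(* Every edge is cut into M + 1 pieces by the M interior nodes inr (e, j);
   the piece (e, i) joins the nodes number i and i + 1 of e. *)
Definition node (e : E) (i : nat) : V + E * 'I_M :=
  if i is j.+1 then
    if insub j is Some j' then inr (e, j') else inl (endpt (e, true))
  else inl (endpt (e, false)).

Arguments node : simpl never.

Definition lo (y : E * 'I_M.+1) := node y.1 y.2.
Definition hi (y : E * 'I_M.+1) := node y.1 y.2.+1.

Lemma node_interior e (j : 'I_M) : node e j.+1 = inr (e, j).
Proof. by rewrite /node valK. Qed.

Lemma node_final e i : M <= i -> node e i.+1 = inl (endpt (e, true)).
Proof. by move=> Mi; rewrite /node insubF // ltnNge Mi. Qed.

Lemma node_last e : node e M.+1 = inl (endpt (e, true)).
Proof. exact: node_final. Qed.

Lemma inl_in (A : {set V}) v : (inl v \in [set (inl u : V + E * 'I_M) | u in A]) = (v \in A).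
Proof. by rewrite mem_imset // => u w []. Qed.

Lemma inr_in (A : {set V}) p : (inr p \in [set (inl u : V + E * 'I_M) | u in A]) = false.
Proof. by apply/negbTE/imsetP => -[]. Qed.

Lemma subdivided_orientation (VD D : {set V}) (o : E -> bool) (par : V -> E) (rk : V -> nat)
  (src := fun y => if o y.1 then hi y else lo y)
  (tgt := fun y => if o y.1 then lo y else hi y)
  (D' := [set (inl v : V + E * 'I_M) | v in D])
  (VD' := [set (inl v : V + E * 'I_M) | v in VD]) :
  VD \subset D ->
  (forall v, v \notin D -> endpt (par v, o (par v)) = v) ->
  (forall e, endpt (e, o e) \notin D -> par (endpt (e, o e)) = e) ->
  (forall v, v \notin D -> exists e, endpt (e, ~~ o e) = v) ->
  (forall e, endpt (e, o e) \notin D ->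
            rk (endpt (e, o e)) < rk (endpt (e, ~~ o e))) ->
  exists (out : V + E * 'I_M -> E * 'I_M.+1) (rk' : V + E * 'I_M -> nat),
  [/\ VD' \subset D', #|D' :\: VD'| = #|D :\: VD|,
      forall w, w \notin D' -> src (out w) = w &
      [/\ forall y, src y \notin D' -> out (src y) = y,
          forall w, w \notin D' -> exists y, tgt y == w &
          forall y, src y \notin D' -> tgt y \notin D' -> rk' (src y) < rk' (tgt y)]].
Proof.
move=> VDD Hout Hsrc Hin Hrk.
pose out (w : V + E * 'I_M) : E * 'I_M.+1 := match w with
  | inl v => (par v, if o (par v) then ord_max else ord0)
  | inr (e, j) => (e, if o e then widen_ord (leqnSn M) j else lift ord0 j) end.
(* Scaling by M + 1 leaves M values just below the rank of a head, taken by the interior nodes of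
   each edge pointing to it, in the order of the orientation. *)
pose rk' (w : V + E * 'I_M) := match w with
  | inl v => M.+1 * (rk v).+1
  | inr (e, j) => M.+1 * rk (endpt (e, ~~ o e)) + (if o e then M - j else j.+1) end.
have srcP e (i : 'I_M.+1) :
    (src (e, i) = inl (endpt (e, o e)) /\ i = (if o e then ord_max else ord0)) \/
    exists2 j : 'I_M, src (e, i) = inr (e, j) &
      i = (if o e then widen_ord (leqnSn M) j else lift ord0 j).
  rewrite /src /=; case: (o e).
    case: (eqVneq (i : nat) M) => [iM|iM].
      by left; split; [rewrite /hi /= iM node_last|apply/val_inj].
    have iM' : i < M by have := ltn_ord i; lia.
    by right; exists (Ordinal iM'); [rewrite -node_interior|apply/val_inj].
  case: (posnP i) => [i0|i0].
    by left; split; [rewrite /lo /= i0|apply/val_inj].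
  have iM' : i.-1 < M by have := ltn_ord i; lia.
  right; exists (Ordinal iM'); last by apply/val_inj; rewrite /= /bump; lia.
  by rewrite -node_interior /lo /= prednK.
have tgtP e (i : 'I_M.+1) :
    (tgt (e, i) = inl (endpt (e, ~~ o e)) /\ i = (if o e then ord0 else ord_max)) \/
    exists2 j : 'I_M, tgt (e, i) = inr (e, j) &
      i = (if o e then lift ord0 j else widen_ord (leqnSn M) j).
  rewrite /tgt /=; case: (o e); last first.
    case: (eqVneq (i : nat) M) => [iM|iM].
      by left; split; [rewrite /hi /= iM node_last|apply/val_inj].
    have iM' : i < M by have := ltn_ord i; lia.
    by right; exists (Ordinal iM'); [rewrite -node_interior|apply/val_inj].
  case: (posnP i) => [i0|i0].
    by left; split; [rewrite /lo /= i0|apply/val_inj].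
  have iM' : i.-1 < M by have := ltn_ord i; lia.
  right; exists (Ordinal iM'); last by apply/val_inj; rewrite /= /bump; lia.
  by rewrite -node_interior /lo /= prednK.
exists out, rk'; split.
- by apply/fintype.subsetP => w /imsetP[v /(fintype.subsetP VDD) vD ->]; rewrite inl_in.
- rewrite -(card_imset (D :\: VD) (f := fun v => inl v : V + E * 'I_M)); last by move=> u v [].
  apply: eq_card => -[v|p]; rewrite inE ?inl_in ?inr_in ?andbF //=.
  by rewrite inE.
- move=> [v|[e j]]; rewrite ?inl_in ?inr_in.
    move=> vD; rewrite -[in RHS](Hout _ vD) /src /=; case: (o (par v)) => //.
    by rewrite /hi /= node_last.
  by move=> _; rewrite /src /=; case: (o e); rewrite /lo /hi /= -?node_interior // /bump leq0n.
split.
- move=> [e i]; case: (srcP e i) => [[-> ->]|[j -> ->]]; last by [].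
  by rewrite inl_in /= => /Hsrc ->.
- move=> [v|[e j]]; rewrite ?inl_in ?inr_in.
    move=> /Hin[e <-]; exists (e, if o e then ord0 else ord_max); rewrite /tgt /=.
    by case: (o e); rewrite /lo /hi /= ?node_last.
  move=> _; exists (e, if o e then lift ord0 j else widen_ord (leqnSn M) j); rewrite /tgt /=.
  by case: (o e); rewrite /lo /hi /= -?node_interior // /bump leq0n.
- move=> [e i]; case: (srcP e i) => [[-> ie]|[j -> ie]].
    rewrite inl_in => /Hrk; rewrite -(leq_pmul2l (ltn0Sn M)) => lt.
    case: (tgtP e i) => [[-> _] _|[j -> ie'] _] /=.
      by apply: leq_ltn_trans lt _; rewrite ltn_pmul2l.
    have := congr1 (@nat_of_ord _) (etrans (esym ie) ie'); move: lt (ltn_ord j).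
    by case: (o e) => /=; rewrite ?/bump; move: (M.+1 * _) (M.+1 * _) => a b; lia.
  move=> _; case: (tgtP e i) => [[-> _] _|[j' -> ie'] _] /=.
    by rewrite mulnS addnC ltn_add2r; case: (o e) => //; rewrite ?ltnS ?leq_subr // ltn_ord.
  have := congr1 (@nat_of_ord _) (etrans (esym ie) ie'); move: (ltn_ord j) (ltn_ord j').
  by rewrite ltn_add2l; case: (o e) => /=; rewrite ?/bump; lia.
Qed.

End Subdivision.
Arguments node : simpl never.

(** * Integration on an interval *)

Section Integrals.
Local Open Scope classical_set_scope.
Local Open Scope ring_scope.
Variable R : realType.
Notation mu := (@lebesgue_measure R).
Implicit Types (f g h : R -> R) (D : set R) (a b c s t x l : R).

Definition igr D f := mu.-integrable D (EFin \o f).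
Definition int a b f : R := Rintegral mu `[a, b] f.

Lemma igrD D f g : measurable D -> igr D f -> igr D g -> igr D (fun x => f x + g x).
Proof. by move=> mD; apply: integrableD. Qed.

Lemma igrZ D c f : measurable D -> igr D f -> igr D (fun x => c * f x).
Proof. by move=> mD; apply: integrableZl. Qed.

Lemma igrN D f : igr D f -> igr D (fun x => - f x).
Proof. exact: integrableN. Qed.

Lemma igrB D f g : measurable D -> igr D f -> igr D g -> igr D (fun x => f x - g x).
Proof. by move=> mD df dg; apply: igrD => //; apply: igrN. Qed.

Lemma igr_norm D f : measurable D -> igr D f -> igr D (fun x => `|f x|).
Proof. by move=> mD; apply: integrable_abse. Qed.

Lemma igrS D D' f : measurable D -> measurable D' -> D' `<=` D -> igr D f -> igr D' f.
Proof. by move=> mD mD' DD; apply: integrableS. Qed.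

Lemma igr_measurable D f : igr D f -> measurable_fun D f.
Proof. by move=> /integrableP[/measurable_EFinP]. Qed.

Lemma igrM D h f K : measurable_fun D h -> (forall x, D x -> `|h x| <= K) ->
  measurable D -> igr D f -> igr D (fun x => h x * f x).
Proof.
move=> mh hK mD fi; suff bd : [bounded h x | x in D].
  exact: (@integrableMr _ _ _ mu D mD h (EFin \o f) mh bd fi).
exists K; split; rewrite ?num_real // => M KM x Dx /=.
by apply: le_trans (hK x Dx) _; apply: ltW.
Qed.

Lemma igr_cst a b c : igr `[a, b] (fun=> c).
Proof.
apply: continuous_compact_integrable; first exact: segment_compact.
by move=> x; apply: cst_continuous.
Qed.

Lemma eq_igr D f g : measurable D -> (forall x, D x -> f x = g x) -> igr D f -> igr D g.
Proof.
move=> mD fg; apply: eq_integrable => // x; rewrite inE => Dx; by rewrite /= fg.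
Qed.

Lemma eq_int a b f g : (forall x, a <= x <= b -> f x = g x) -> int a b f = int a b g.
Proof.
move=> fg; apply: eq_Rintegral => x; rewrite inE /= in_itv /= => xab.
exact: fg.
Qed.

Lemma int_pt a f : int a a f = 0.
Proof. by rewrite /int set_itv1 Rintegral_set1. Qed.

Lemma int_cst a b c : a <= b -> int a b (fun=> c) = c * (b - a).
Proof.
move=> ab; rewrite /int Rintegral_cst //; congr (_ * _).
suff H : mu `[a, b] = (b - a)%:E by rewrite -[RHS]/(fine (b - a)%:E) -H.
rewrite lebesgue_measure_itv /= lte_fin.
by case: (ltgtP a b) ab => [_ _|//|-> _]; rewrite ?subrr -?EFinB.
Qed.

Lemma intD a b f g : igr `[a, b] f -> igr `[a, b] g ->
  int a b (fun x => f x + g x) = int a b f + int a b g.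
Proof. exact: RintegralD. Qed.

Lemma intZ a b c f : igr `[a, b] f -> int a b (fun x => c * f x) = c * int a b f.
Proof. exact: RintegralZl. Qed.

Lemma intB a b f g : igr `[a, b] f -> igr `[a, b] g ->
  int a b (fun x => f x - g x) = int a b f - int a b g.
Proof. exact: RintegralB. Qed.

Lemma le_int a b f g : igr `[a, b] f -> igr `[a, b] g ->
  (forall x, a <= x <= b -> f x <= g x) -> int a b f <= int a b g.
Proof.
by move=> fi gi fg; apply: le_Rintegral.
Qed.

Lemma ler_norm_int a b f : igr `[a, b] f -> `|int a b f| <= int a b (fun x => `|f x|).
Proof. exact: le_normr_Rintegral. Qed.

Lemma igr_sub a b s t f : a <= s -> t <= b -> igr `[a, b] f -> igr `[s, t] f.
Proof.
move=> as_ tb; apply: igrS => // x; rewrite /= !in_itv /= => /andP[sx xt].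
by rewrite (le_trans as_ sx) (le_trans xt tb).
Qed.

Lemma int_split a t b f : a <= t <= b -> igr `[a, b] f ->
  int a b f = int a t f + int t b f.
Proof.
move=> /andP[at_ tb] fi; apply/eqP; rewrite addrC -subr_eq; apply/eqP.
rewrite /int Rintegral_itvB ?bnd_simp // Rintegral_itv_obnd_cbnd //.
by apply: igrS fi => // x; rewrite /= !in_itv /= => /andP[/ltW/(le_trans at_) -> ->].
Qed.

Definition cts a b f := {within `[a, b], continuous f}.

Lemma cts_cst a b c : cts a b (fun=> c).
Proof. by apply: continuous_in_subspaceT => x _; exact: cst_continuous. Qed.

Lemma cts_continuous a b f : continuous f -> cts a b f.
Proof. by move=> cf; apply: continuous_in_subspaceT => x _; exact: cf. Qed.

Lemma ctsD a b f g : cts a b f -> cts a b g -> cts a b (fun x => f x + g x).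
Proof. by move=> cf cg x; apply: cvgD; [exact: cf|exact: cg]. Qed.

Lemma ctsM a b f g : cts a b f -> cts a b g -> cts a b (fun x => f x * g x).
Proof. by move=> cf cg x; apply: cvgM; [exact: cf|exact: cg]. Qed.

Lemma ctsZ a b c f : cts a b f -> cts a b (fun x => c * f x).
Proof. by apply: ctsM; exact: cts_cst. Qed.

Lemma eq_cts a b f g : (forall x, a <= x <= b -> f x = g x) -> cts a b f -> cts a b g.
Proof.
by move=> fg; apply: subspace_eq_continuous => x; rewrite inE /= in_itv /= => /fg.
Qed.

(** Absolute continuity of [u] on [0, l], with a chosen integrable derivative [u']. *)
Definition primitive l (u u' : R -> R) :=
  igr `[0, l] u' /\ forall x, 0 <= x <= l -> u x = u 0 + int 0 x u'.

Lemma primitive_incr l (u u' : R -> R) s t : primitive l u u' ->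
  0 <= s -> s <= t -> t <= l -> u t - u s = int s t u'.
Proof.
move=> [ia uE] s0 st tl; rewrite (uE t) ?(le_trans s0) //.
rewrite (uE s) ?s0 ?(le_trans st) // (@int_split 0 s t) ?s0 //; first by ring.
exact: igr_sub ia.
Qed.

Lemma primitive_continuous l (u u' : R -> R) : 0 <= l -> primitive l u u' ->
  cts 0 l u.
Proof.
move=> l0 [ia uE].
have c1 : cts 0 l (fun x => u 0 + int 0 x u').
  by apply: ctsD; [exact: cts_cst|exact: parameterized_integral_continuous].
by apply: eq_cts c1 => x /uE ->.
Qed.

Lemma continuous_igr a b f : cts a b f -> igr `[a, b] f.
Proof. by apply: continuous_compact_integrable; exact: segment_compact. Qed.

Lemma continuous_bound a b f : cts a b f ->
  exists K, forall x, a <= x <= b -> `|f x| <= K.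
Proof.
move=> cf; have [M [_ HM]] := compact_bounded (continuous_compact cf (@segment_compact _ a b)).
exists (`|M| + 1) => x xab; apply: HM; first by rewrite ltr_pwDr // ler_norm.
by exists x => //=; rewrite in_itv.
Qed.

Lemma continuous_measurable a b f : cts a b f ->
  measurable_fun `[a, b] f.
Proof. by move/continuous_igr/igr_measurable. Qed.

Lemma le_bound_over_nat_eq0 (y C : R) : (forall n, `|y| <= C / n.+1%:R) -> y = 0.
Proof.
move=> H; apply/eqP; rewrite -normr_le0 leNgt; apply/negP => y0.
have /archi_boundP : 0 <= `|C| / `|y| by rewrite divr_ge0.
rewrite ltr_pdivrMr // => lt; have := H (Num.Def.archi_bound (`|C| / `|y|)).
rewrite ler_pdivlMr // mulrC => le.
have := le_lt_trans (le_trans le (ler_norm C)) lt.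
by rewrite ltr_pM2r // ltr_nat ltnNge leqnSn.
Qed.

Section ProductRule.
Variables (l : R) (u u' w w' : R -> R).
Hypotheses (l0 : 0 <= l) (pu : primitive l u u') (pw : primitive l w w') (cw' : cts 0 l w').

Let p x := u' x * w x + u x * w' x.

Let iu'w : igr `[0, l] (fun x => u' x * w x).
Proof.
have cw := primitive_continuous l0 pw; have [K wK] := continuous_bound cw.
apply: (eq_igr _ (fun x _ => mulrC (w x) (u' x))) => //.
by apply: (igrM (continuous_measurable cw)) pu.1 => // x; rewrite /= in_itv /=; exact: wK.
Qed.

Let iuw' : igr `[0, l] (fun x => u x * w' x).
Proof. by apply/continuous_igr/ctsM => //; exact: primitive_continuous pu. Qed.

Let ip : igr `[0, l] p.
Proof. exact: igrD. Qed.

Let F x := u x * w x - u 0 * w 0 - int 0 x p.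

(** The defect of the product rule is of second order: it couples the increment of one function with
    the derivative of the other, and [w] moves by at most [K * (t - s)]. *)
Let F_incr K s t : (forall x, 0 <= x <= l -> `|w' x| <= K) -> 0 <= s -> s <= t -> t <= l ->
  `|F t - F s| <= 2 * K * (t - s) * int s t (fun x => `|u' x|).
Proof.
move=> wK s0 st tl; have sub f : igr `[0, l] f -> igr `[s, t] f by apply: igr_sub.
have in0l x : s <= x <= t -> 0 <= x <= l.
  by move=> /andP[sx xt]; rewrite (le_trans s0) // (le_trans xt).
have iu' := sub _ pu.1; have iw' := sub _ pw.1.
have K0 : 0 <= K by apply: le_trans (wK 0 _); rewrite ?lexx.
have E : F t - F s = int s t (fun x => w t * u' x - u' x * w x) +
    int s t (fun x => u s * w' x - u x * w' x).
  rewrite !intB ?intZ //; try exact: igrZ; try exact: sub.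
  rewrite -(primitive_incr pu) // -(primitive_incr pw) // /F.
  rewrite (@int_split 0 s t) ?s0 //; last exact: igr_sub ip.
  rewrite [int s t p]intD; try exact: sub.
  ring.
have I0 : 0 <= int s t (fun x => `|u' x|).
  by apply: Rintegral_ge0 => x _; apply: normr_ge0.
have iabs : igr `[s, t] (fun x => `|u' x|) by apply: igr_norm.
have i1 : igr `[s, t] (fun x => w t * u' x - u' x * w x).
  by apply: igrB => //; [exact: igrZ|exact: sub].
have i2 : igr `[s, t] (fun x => u s * w' x - u x * w' x).
  by apply: igrB => //; [exact: igrZ|exact: sub].
rewrite E; apply: le_trans (ler_normD _ _) _.
have b1 : `|int s t (fun x => w t * u' x - u' x * w x)| <=
    K * (t - s) * int s t (fun x => `|u' x|).
  apply: le_trans (ler_norm_int i1) _; rewrite -intZ //.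
  apply: le_int; [exact: igr_norm|exact: igrZ|move=> x sxt].
  have -> : w t * u' x - u' x * w x = (w t - w x) * u' x by ring.
  rewrite normrM ler_wpM2r //; have /andP[sx xt] := sxt.
  rewrite (primitive_incr pw) ?(le_trans s0) //.
  have iwx : igr `[x, t] w' by apply: igr_sub iw'.
  apply: le_trans (ler_norm_int iwx) _.
  apply: (@le_trans _ _ (K * (t - x))); last by rewrite ler_wpM2l // lerB.
  rewrite -int_cst //; apply: le_int; [exact: igr_norm|exact: igr_cst|move=> y /andP[xy yt]].
  by apply/wK/in0l; rewrite yt (le_trans sx).
have b2 : `|int s t (fun x => u s * w' x - u x * w' x)| <=
    K * (t - s) * int s t (fun x => `|u' x|).
  apply: le_trans (ler_norm_int i2) _.
  have -> : K * (t - s) * int s t (fun x => `|u' x|) = (K * int s t (fun x => `|u' x|)) * (t - s) by ring.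
  rewrite -int_cst //; apply: le_int; [exact: igr_norm|exact: igr_cst|move=> x sxt].
  have /andP[sx xt] := sxt.
  rewrite -mulrBl normrM mulrC ler_pM ?wK ?in0l //.
  rewrite distrC (primitive_incr pu) ?(le_trans xt) //.
  have iux : igr `[s, x] u' by apply: igr_sub iu'.
  apply: le_trans (ler_norm_int iux) _.
  rewrite (@int_split s x t) ?sx // lerDl; apply: Rintegral_ge0 => y _; exact: normr_ge0.
lra.
Qed.

(** As [u'] is merely integrable, no pointwise product rule applies. Summed over n + 1 equal steps,
    the second-order bound leaves a defect of order 1 / (n + 1), hence 0. *)
Lemma primitiveM : primitive l (fun x => u x * w x) p.
Proof.
split=> // x /andP[x0 xl]; apply/eqP; rewrite -subr_eq0 opprD addrA; apply/eqP.
have [K wK] := continuous_bound cw'.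
apply: (@le_bound_over_nat_eq0 _ (2 * K * x * int 0 x (fun y => `|u' y|))) => n.
pose t i := x * (i%:R / n.+1%:R).
have t0 i : 0 <= t i by rewrite mulr_ge0 // divr_ge0.
have tx i : (i <= n.+1)%N -> t i <= x.
  by move=> ni; rewrite ler_piMr // ler_pdivrMr // mul1r ler_nat.
have tS i : t i <= t i.+1 by rewrite ler_wpM2l // ler_wpM2r ?invr_ge0 // ler_nat.
have H i : (i <= n.+1)%N -> `|F (t i)| <= 2 * K * (x / n.+1%:R) * int 0 (t i) (fun y => `|u' y|).
  elim: i => [|i IHi] ni.
    have -> : t 0%N = 0 by rewrite /t mul0r mulr0.
    by rewrite /F !int_pt subrr subr0 normr0 mulr0.
  have step := F_incr wK (t0 i) (tS i) (le_trans (tx _ ni) xl).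
  have ttE : t i.+1 - t i = x / n.+1%:R.
    by rewrite /t -(addn1 i) natrD mulrDl mulrDr addrAC subrr add0r mul1r.
  rewrite ttE in step.
  rewrite (@int_split 0 (t i) (t i.+1)) ?t0 ?tS //; last first.
    apply: igr_norm => //; apply: igr_sub pu.1 => //.
    exact: le_trans (tx _ ni) xl.
  rewrite -[F (t i.+1)](subrK (F (t i))); apply: le_trans (ler_normD _ _) _.
  by rewrite mulrDr addrC lerD // IHi // ltnW.
have := H n.+1 (leqnn _); rewrite (_ : t n.+1 = x); last first.
  by rewrite /t divff ?mulr1 // pnatr_eq0.
by rewrite /F => h; rewrite (_ : _ / n.+1%:R = 2 * K * (x / n.+1%:R) * int 0 x (fun y => `|u' y|)) //; ring.
Qed.

End ProductRule.
End Integrals.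

(** * The equation -u'' = w^2 u on an interval *)

Section Helmholtz.
Local Open Scope classical_set_scope.
Local Open Scope ring_scope.
Variable R : realType.
Notation mu := (@lebesgue_measure R).
Implicit Types (l x w : R) (f g : R -> R).

Lemma primitive_derive l (f f' : R -> R) : (forall x, is_derive x 1 f (f' x)) ->
  continuous f' -> primitive l f f'.
Proof.
move=> df cf'; split; first by apply/continuous_igr/cts_continuous.
move=> x /andP[x0 xl]; move: x0; rewrite le_eqVlt => /predU1P[<-|x0].
  by rewrite int_pt addr0.
have cf : continuous f.
  move=> y; apply: differentiable_continuous; apply/derivable1_diffP.
  by have := df y; case.
have := @continuous_FTC2 _ f' f 0 x x0 (cts_continuous cf').
rewrite /int /Rintegral => -> //=; first by ring.
- split=> [y _||]; first by have := df y; case.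
  + by apply: cvg_at_right_filter; exact: cf.
  + by apply: cvg_at_left_filter; exact: cf.
- by move=> y _; rewrite derive1E; have := df y; case.
Qed.

Definition cosw w x : R := cos (w * x).

Lemma continuous_mulw w : continuous (fun x => w * x).
Proof. by move=> x; apply: cvgM; [exact: cvg_cst|exact: cvg_id]. Qed.

Lemma continuous_cosw w : continuous (cosw w).
Proof.
move=> x; apply: (continuous_comp (@continuous_mulw w x)); exact: continuous_cos.
Qed.

Lemma continuous_sinw w : continuous (sinw w).
Proof.
move=> x; rewrite /sinw; case: eqP => _; first exact: cvg_id.
apply: cvgM; last exact: cvg_cst.
by apply: (continuous_comp (@continuous_mulw w x)); exact: continuous_sin.
Qed.

Lemma sinw0 w : sinw w 0 = 0.
Proof. by rewrite /sinw; case: eqP => // _; rewrite mulr0 sin0 mul0r. Qed.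

Lemma cosw0 w : cosw w 0 = 1.
Proof. by rewrite /cosw mulr0 cos0. Qed.

Lemma cosw2_sinw2 w x : cosw w x ^+ 2 + w ^+ 2 * sinw w x ^+ 2 = 1.
Proof.
rewrite /cosw /sinw; case: eqP => [->|/eqP w0].
  by rewrite mul0r cos0 expr0n /= mul0r addr0 expr1n.
by rewrite expr_div_n mulrCA divff ?mulr1 ?cos2Dsin2 // expf_neq0.
Qed.

Lemma coswD w x y : cosw w (x + y) = cosw w x * cosw w y - w ^+ 2 * (sinw w x * sinw w y).
Proof.
rewrite /cosw /sinw; case: eqP => [->|/eqP w0]; first by rewrite !mul0r cos0; ring.
by rewrite mulrDr cosD; field.
Qed.

Lemma sinwD w x y : sinw w (x + y) = sinw w x * cosw w y + cosw w x * sinw w y.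
Proof.
rewrite /cosw /sinw; case: eqP => [->|/eqP w0]; first by rewrite !mul0r cos0; ring.
by rewrite mulrDr sinD; field.
Qed.

Lemma primitive_sinw w l : primitive l (sinw w) (cosw w).
Proof.
apply: primitive_derive; last exact: continuous_cosw.
move=> x; rewrite /sinw /cosw; case: eqP => [->|/eqP w0].
  by rewrite mul0r cos0; exact: is_derive_id.
have h : is_derive x 1 (fun y => w * y) w.
  have := is_deriveM (is_derive_cst w x 1) (is_derive_id x (1 : R)).
  by rewrite scaler0 addr0 /GRing.scale /= mulr1.
have h2 : is_derive x 1 (fun y => sin (w * y)) (cos (w * x) * w).
  exact: (@is_derive1_comp R sin (fun y => w * y)).
have := is_deriveM h2 (is_derive_cst w^-1 x (1 : R)).
by rewrite scaler0 add0r /GRing.scale /= mulrCA mulVf // mulr1.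
Qed.

Lemma primitive_cosw w l : primitive l (cosw w) (fun x => - w ^+ 2 * sinw w x).
Proof.
apply: primitive_derive; last first.
  by move=> x; apply: cvgM; [exact: cvg_cst|exact: continuous_sinw].
move=> x; have h : is_derive x 1 (fun y => w * y) w.
  have := is_deriveM (is_derive_cst w x 1) (is_derive_id x (1 : R)).
  by rewrite scaler0 addr0 /GRing.scale /= mulr1.
have h2 : is_derive x 1 (fun y => cos (w * y)) (- sin (w * x) * w).
  exact: (@is_derive1_comp R cos (fun y => w * y)).
rewrite /sinw; case: eqP => [w0|/eqP w0].
  by move: h2; rewrite w0 !mulr0 expr0n oppr0 mul0r.
suff -> : - w ^+ 2 * (sin (w * x) / w) = - sin (w * x) * w by [].
by field.
Qed.

(** By the product rule [u * cosw - v * sinw] and [w ^+ 2 * (u * sinw) + v * cosw] are constant.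
    They are solved for [u] and [v] by means of [cosw ^+ 2 + w ^+ 2 * sinw ^+ 2 = 1], for [w = 0] as
    well. *)
Lemma helmholtz_solution l w (u v : R -> R) : 0 <= l ->
  primitive l u v -> primitive l v (fun x => - w ^+ 2 * u x) ->
  forall x, 0 <= x <= l ->
    u x = u 0 * cosw w x + v 0 * sinw w x /\
    v x = v 0 * cosw w x - w ^+ 2 * (u 0 * sinw w x).
Proof.
move=> l0 pu pv x xl.
have cC : cts 0 l (cosw w) by apply/cts_continuous/continuous_cosw.
have cS : cts 0 l (sinw w) by apply/cts_continuous/continuous_sinw.
have cmS : cts 0 l (fun x => - w ^+ 2 * sinw w x) by exact: ctsZ.
have p1 := primitiveM l0 pu (primitive_cosw w l) cmS.
have p2 := primitiveM l0 pv (primitive_sinw w l) cC.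
have p3 := primitiveM l0 pu (primitive_sinw w l) cC.
have p4 := primitiveM l0 pv (primitive_cosw w l) cmS.
have xsub f : igr `[0, l] f -> igr `[0, x] f.
  by apply: igr_sub => //; have /andP[] := xl.
have E1 : u x * cosw w x - v x * sinw w x = u 0.
  rewrite (p1.2 x xl) (p2.2 x xl) cosw0 sinw0 mulr1 mulr0 add0r.
  rewrite (_ : int 0 x _ = int 0 x (fun x => - w ^+ 2 * u x * sinw w x + v x * cosw w x)).
    by rewrite addrK.
  by apply: eq_int => y _; ring.
have E2 : w ^+ 2 * (u x * sinw w x) + v x * cosw w x = v 0.
  rewrite (p3.2 x xl) (p4.2 x xl) cosw0 sinw0 mulr1 mulr0 add0r.
  rewrite -intZ; last exact: xsub p3.1.
  rewrite addrCA -intD; [|exact/igrZ/xsub/p3.1|exact: xsub p4.1] => //.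
  rewrite (_ : int 0 x _ = int 0 x (fun=> 0)); last by apply: eq_int => y _; ring.
  by rewrite int_cst ?mul0r ?addr0 //; have /andP[] := xl.
have cs := cosw2_sinw2 w x; split.
  by rewrite -[LHS]mulr1 -cs -[in RHS]E1 -[in RHS]E2; ring.
by rewrite -[LHS]mulr1 -cs -[in RHS]E1 -[in RHS]E2; ring.
Qed.

End Helmholtz.

(** * Square-integrable functions and equality almost everywhere *)

Section SquareIntegrable.
Local Open Scope classical_set_scope.
Local Open Scope ring_scope.
Variable R : realType.
Notation mu := (@lebesgue_measure R).
Implicit Types (l x : R) (f g h : R -> R).

Definition L2r l f := f \_ `[0, l] \in Lfun mu 2%:E.

Lemma igr_patch l f : igr `[0, l] f <-> igr setT (f \_ `[0, l]).
Proof.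
have := @integrable_mkcond _ _ _ mu `[0, l] (EFin \o f) (measurable_itv _).
by rewrite /igr restrict_EFin.
Qed.

Lemma L2r_sqr l f : L2r l f -> measurable_fun `[0, l] f /\ igr `[0, l] (fun x => f x ^+ 2).
Proof.
move=> fL; split.
  move: fL; rewrite /L2r inE => /andP[/[!inE]/= mf _].
  by apply: (measurable_restrictT f _).2 => //; exact: mf.
apply/igr_patch; have := Lfun2_integrable_sqr fL.
apply: eq_integrable => // x _ /=; rewrite !patchE /=; case: ifP => // _.
by rewrite expr0n.
Qed.

Lemma sqr_L2r l f : measurable_fun `[0, l] f -> igr `[0, l] (fun x => f x ^+ 2) -> L2r l f.
Proof.
move=> mf fi.
have mr : measurable_fun setT (f \_ `[0, l]) by apply: (measurable_restrictT f _).1.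
rewrite /L2r inE; apply/andP; split; rewrite inE //=.
rewrite /finite_norm unlock /Lnorm /= poweR_lty //.
have /integrableP[_] := (igr_patch _ _).1 fi.
apply: le_lt_trans; apply: ge0_le_integral => //.
- apply/measurable_EFinP.
  by apply: (measurableT_comp (measurable_powR _)) => //; exact: measurableT_comp.
- apply: measurableT_comp => //.
  by have /integrableP[] := (igr_patch _ _).1 fi.
- move=> x _; rewrite lee_fin (_ : ((fun y => f y ^+ 2) \_ `[0, l]) x = (f \_ `[0, l]) x ^+ 2).
    by rewrite normrX -powR_mulrn.
  by rewrite !patchE; case: ifP => // _; rewrite expr0n.
Qed.

Lemma L2r_mul l f g : L2r l f -> L2r l g -> igr `[0, l] (fun x => f x * g x).
Proof.
move=> fL gL; apply/igr_patch.
have /Lfun1_integrable := Lfun2_mul_Lfun1 fL gL.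
apply: eq_integrable => // x _ /=; rewrite !patchE /=; case: ifP => // _.
by rewrite mulr0.
Qed.

Lemma L2r_cts l f : cts 0 l f -> L2r l f.
Proof.
move=> cf; apply: sqr_L2r; first exact: continuous_measurable.
by apply: continuous_igr; apply: ctsM.
Qed.

Lemma L2r_igr l f : L2r l f -> igr `[0, l] f.
Proof.
move=> fL; have := L2r_mul (L2r_cts (@cts_cst R 0 l 1)) fL.
by apply: eq_igr => // x _; rewrite mul1r.
Qed.

Lemma L2rD l f g : L2r l f -> L2r l g -> L2r l (fun x => f x + g x).
Proof.
move=> fL gL; have [mf f2] := L2r_sqr fL; have [mg g2] := L2r_sqr gL.
apply: sqr_L2r; first exact: measurable_funD.
have := igrD _ (igrD _ f2 g2) (igrZ 2 _ (L2r_mul fL gL)).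
move=> /(_ _ _ _)/eq_igr; apply => // x _; ring.
Qed.

Lemma eq_L2r l f g : (forall x, 0 <= x <= l -> f x = g x) -> L2r l f -> L2r l g.
Proof.
move=> fg; rewrite /L2r (_ : f \_ `[0, l] = g \_ `[0, l]) //.
apply/funext => x; rewrite !patchE; case: ifP => //.
by rewrite inE /= in_itv /= => /fg.
Qed.

Definition ae_on l (P : R -> Prop) := {ae mu, forall x, `[0, l]%classic x -> P x}.

Lemma ae_on_imp l l' (P Q : R -> Prop) : l' <= l ->
  (forall x, 0 <= x <= l' -> P x -> Q x) -> ae_on l P -> ae_on l' Q.
Proof.
move=> ll PQ; rewrite /ae_on; apply: filterS; first exact: (@ae_filter_ringOfSetsType _ _ R mu).
move=> x Px xl'; apply: PQ; first by move: xl'; rewrite /= in_itv.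
by apply: Px; move: xl'; rewrite /= !in_itv /= => /andP[-> /le_trans ->].
Qed.

Lemma ae_on_and l (P Q : R -> Prop) : ae_on l P -> ae_on l Q -> ae_on l (fun x => P x /\ Q x).
Proof.
move=> p q; have := @filterI _ _ (@ae_filter_ringOfSetsType _ _ R mu) _ _ p q.
apply: filterS.
by move=> x [Px Qx] xl; split; [exact: Px|exact: Qx].
Qed.

Lemma ae_int l f g : igr `[0, l] f -> igr `[0, l] g -> ae_on l (fun x => f x = g x) ->
  int 0 l f = int 0 l g.
Proof.
move=> /igr_measurable mf /igr_measurable mg fg; congr fine.
apply: ae_eq_integral => //; [exact/measurable_EFinP|exact/measurable_EFinP|].
by apply: (ae_on_imp _ _ fg) => // x _ ->.
Qed.

Lemma int_sqr_eq0 l f : L2r l f -> int 0 l (fun x => f x ^+ 2) = 0 ->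
  ae_on l (fun x => f x = 0).
Proof.
move=> fL f0; have [mf f2] := L2r_sqr fL.
have : (\int[mu]_(x in `[0%R, l]) `|(f x ^+ 2)%:E| = 0)%E.
  under eq_integral do rewrite gee0_abs ?lee_fin ?sqr_ge0 //.
  rewrite -[LHS]fineK; first by rewrite [X in X%:E]f0.
  exact: integrable_fin_num.
have m2 : measurable_fun `[0, l] (EFin \o (fun x => f x ^+ 2)).
  by apply/measurable_EFinP; apply: igr_measurable.
move/(ae_eq_integral_abs mu (measurable_itv _) m2).1.
apply: filterS.
by move=> x H /H /= [] /eqP; rewrite sqrf_eq0 => /eqP.
Qed.

(** The difference, extended by 0, has integral 0 over every half-line, and Lebesgue differentiation
    makes it vanish almost everywhere. *)
Lemma primitive_unique l f g : igr `[0, l] f -> igr `[0, l] g ->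
  (forall x, 0 <= x <= l -> int 0 x f = int 0 x g) -> ae_on l (fun x => f x = g x).
Proof.
move=> fi gi fg; pose d := (fun x => f x - g x) \_ `[0, l].
have di : igr setT d by apply/igr_patch; exact: igrB.
have dl : locally_integrable setT d by apply: open_integrable_locally => //; exact: openT.
have dy y : mu.-integrable `]-oo, y] (EFin \o d) by apply: igrS di.
have F0 y : (\int[mu]_(t in `]-oo, y]) d t)%R = 0.
  rewrite /d -Rintegral_mkcondr.
  case: (ltP y 0) => y0.
    rewrite (_ : _ `&` _ = set0) ?Rintegral_set0 //; apply/seteqP; split=> // x [].
    by rewrite /= !in_itv /= => xy /andP[x0 _]; have := le_lt_trans (le_trans x0 xy) y0; rewrite ltxx.
  have [l0|l0] := ltP l 0.
    rewrite (_ : _ `&` _ = set0) ?Rintegral_set0 //; apply/seteqP; split=> // x [].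
    by rewrite /= !in_itv /= => xy /andP[x0 xl]; have := le_lt_trans (le_trans x0 xl) l0; rewrite ltxx.
  have ml : 0 <= Num.min y l <= l by rewrite le_min y0 l0 ge_min lexx orbT.
  rewrite (_ : _ `&` _ = `[0, Num.min y l]%classic); last first.
    by apply/seteqP; split=> x; rewrite /= !in_itv /= le_min;
      [move=> [-> /andP[-> ->]]|move=> /andP[-> /andP[-> ->]]].
  have /andP[_ mL] := ml.
  have sub h : igr `[0, l] h -> igr `[0, Num.min y l] h by apply: igr_sub.
  by rewrite -/(int _ _ _) intB ?fg ?subrr //; apply: sub.
have := FTC1Ny dy dl.
apply: filterS; first exact: (@ae_filter_ringOfSetsType _ _ R mu).
move=> x [_ dx] xl; move: dx; rewrite (_ : (fun y => _) = cst 0); last exact/funext.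
rewrite derive1_cst /d patchE mem_set // => /esym/eqP.
by rewrite subr_eq0 => /eqP.
Qed.

End SquareIntegrable.

(** * Eigenfunctions *)

Section RealWeak.
Local Open Scope classical_set_scope.
Local Open Scope ring_scope.
Variables (R : realType) (G : metric_graph R) (VD : {set vert G}) (w : R).
Notation mu := (@lebesgue_measure R).
Implicit Types (l x : R) (u v : edge G -> R -> R) (a b : edge G -> R).

Definition rprim l (f f' : R -> R) := L2r l f' /\ primitive l f f'.

Definition real_endval u (p : edge G * bool) : R := u p.1 (if p.2 then len p.1 else 0).

Definition real_form_domain u v : Prop :=
  [/\ forall e, rprim (len e) (u e) (v e),
      forall p q, endpt p = endpt q -> real_endval u p = real_endval u q &
      forall p, endpt p \in VD -> real_endval u p = 0].

Definition wave a b e x : R := a e * cosw w x + b e * sinw w x.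
Definition dwave a b e x : R := b e * cosw w x - w ^+ 2 * (a e * sinw w x).

(* Derivative into the edge at the endpoint p. *)
Definition outflow a b (p : edge G * bool) : R :=
  if p.2 then - dwave a b p.1 (len p.1) else b p.1.

Lemma len_ge0 (e : edge G) : 0 <= len e.
Proof. exact/ltW/len_gt0. Qed.

Lemma cts_wave a b e l : cts 0 l (wave a b e).
Proof.
apply: ctsD; apply: ctsZ; apply: cts_continuous; [exact: continuous_cosw|exact: continuous_sinw].
Qed.

Lemma cts_dwave a b e l : cts 0 l (dwave a b e).
Proof.
apply: (@eq_cts _ _ _ (fun x => b e * cosw w x + (- w ^+ 2 * a e) * sinw w x)).
  by move=> x _; rewrite /dwave; ring.
apply: ctsD; apply: ctsZ; apply: cts_continuous; [exact: continuous_cosw|exact: continuous_sinw].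
Qed.

Lemma primitive_lin l (f f' g g' : R -> R) c d : primitive l f f' -> primitive l g g' ->
  primitive l (fun x => c * f x + d * g x) (fun x => c * f' x + d * g' x).
Proof.
move=> [if' fE] [ig' gE]; split; first by apply: igrD => //; apply: igrZ.
move=> x xl; have sub h : igr `[0, l] h -> igr `[0, x] h.
  by apply: igr_sub => //; have /andP[] := xl.
rewrite intD ?intZ; try (apply: igrZ => //); try exact: sub.
by rewrite (fE x xl) (gE x xl); ring.
Qed.

Lemma eq_primitive l (f f' g g' : R -> R) : 0 <= l -> (forall x, 0 <= x <= l -> f x = g x) ->
  (forall x, 0 <= x <= l -> f' x = g' x) -> primitive l f f' -> primitive l g g'.
Proof.
move=> l0 fg fg' [if' fE]; split.
  by apply: (eq_igr _ _ if') => // x; rewrite /= in_itv /=; exact: fg'.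
move=> x xl; rewrite -fg // -fg ?lexx // fE //; congr (_ + _); apply: eq_int => y /andP[y0 yx].
by apply: fg'; rewrite y0 (le_trans yx) //; have /andP[] := xl.
Qed.

Lemma primitive_wave a b e l : 0 <= l -> primitive l (wave a b e) (dwave a b e).
Proof.
move=> l0; apply: eq_primitive (primitive_lin (a e) (b e) (primitive_cosw w l) (primitive_sinw w l)) => //.
by move=> x _; rewrite /dwave; ring.
Qed.

Lemma primitive_dwave a b e l : 0 <= l ->
  primitive l (dwave a b e) (fun x => - w ^+ 2 * wave a b e x).
Proof.
move=> l0; apply: eq_primitive (primitive_lin (b e) (- w ^+ 2 * a e) (primitive_cosw w l) (primitive_sinw w l)) => //.
- by move=> x _; rewrite /dwave; ring.
- by move=> x _; rewrite /wave; ring.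
Qed.

Lemma wave_by_parts a b e u v : rprim (len e) (u e) (v e) ->
  int 0 (len e) (fun x => dwave a b e x * v e x) =
  w ^+ 2 * int 0 (len e) (fun x => wave a b e x * u e x) -
  (outflow a b (e, true) * real_endval u (e, true) + outflow a b (e, false) * real_endval u (e, false)).
Proof.
move=> [vL pu]; have l0 := len_ge0 e.
have cw : cts 0 (len e) (fun x => - w ^+ 2 * wave a b e x) by apply/ctsZ/cts_wave.
have pp := primitiveM l0 pu (primitive_dwave a b e l0) cw.
have i1 : igr `[0, len e] (fun x => dwave a b e x * v e x).
  by apply: L2r_mul => //; apply/L2r_cts/cts_dwave.
have i2 : igr `[0, len e] (fun x => wave a b e x * u e x).
  by apply/continuous_igr/ctsM; [exact: cts_wave|exact: primitive_continuous pu].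
have d0 : dwave a b e 0 = b e by rewrite /dwave cosw0 sinw0; ring.
have := pp.2 (len e); rewrite l0 lexx d0 => /(_ isT).
rewrite (_ : int 0 _ _ = int 0 (len e) (fun x => dwave a b e x * v e x + - w ^+ 2 * (wave a b e x * u e x))).
  rewrite intD //; last exact: igrZ.
  rewrite intZ // /outflow /real_endval /= => E.
  by rewrite mulNr [dwave a b e (len e) * _]mulrC E; ring.
by apply: eq_int => x _; ring.
Qed.

Definition kirchhoff a b := forall p0, endpt p0 \notin VD ->
  \sum_(p | endpt p == endpt p0) outflow a b p = 0.

(** Integration by parts leaves outflow times value at each end of an edge. Grouped by vertices,
    these terms vanish by the Kirchhoff condition or by the Dirichlet condition on [u]. *)
Lemma green a b u v : kirchhoff a b -> real_form_domain u v ->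
  \sum_e int 0 (len e) (fun x => dwave a b e x * v e x) =
  w ^+ 2 * \sum_e int 0 (len e) (fun x => wave a b e x * u e x).
Proof.
move=> K [uv uc uD]; under eq_bigr do rewrite (wave_by_parts a b (uv _)).
rewrite big_split /= sumrN mulr_sumr.
rewrite (_ : \sum_e (_ + _) = 0) ?subr0 //.
transitivity (\sum_p outflow a b p * real_endval u p).
  rewrite (eq_bigr (fun p => (fun e c => outflow a b (e, c) * real_endval u (e, c)) p.1 p.2)); last by case.
  rewrite -(pair_bigA _ (fun e c => outflow a b (e, c) * real_endval u (e, c))) /=.
  by apply: eq_bigr => e _; rewrite big_bool.
rewrite (partition_big (@endpt R G) predT) //= big1 // => x _.
case: (pickP (fun p => endpt p == x)) => [p0 /eqP p0x|none]; last by rewrite big_pred0.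
rewrite -p0x (eq_bigr (fun p => outflow a b p * real_endval u p0)) => [|p /eqP/uc -> //].
rewrite -mulr_suml; case: (boolP (endpt p0 \in VD)) => pVD; first by rewrite uD ?mulr0.
by rewrite K ?mul0r.
Qed.

Lemma rprim_lin l z0 z1 : 0 < l ->
  rprim l (fun x => z0 + (z1 - z0) / l * x) (fun=> (z1 - z0) / l).
Proof.
move=> l0; split; first exact/L2r_cts/cts_cst.
apply: eq_primitive (primitive_lin z0 ((z1 - z0) / l) (primitive_cosw 0 l) (primitive_sinw 0 l)).
- exact: ltW.
- by move=> x _; rewrite /cosw /sinw eqxx mul0r cos0 mulr1.
- by move=> x _; rewrite /cosw mul0r cos0 expr0n /= oppr0 mul0r mulr0 add0r mulr1.
Qed.

Lemma rprim_int l f : L2r l f -> rprim l (fun x => int 0 x f) f.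
Proof.
move=> fL; split=> //; split; first exact: L2r_igr.
by move=> x _; rewrite int_pt add0r.
Qed.

(** Regularity after du Bois-Reymond: on each edge [v + w ^+ 2 * U], with [U] a primitive of [u], is
    constant almost everywhere, so [v] has a continuous representative and [u] solves the
    differential equation. Affine test functions yield the Kirchhoff conditions. *)
Lemma weak_solution u v : (forall e, rprim (len e) (u e) (v e)) ->
  (forall g g', real_form_domain g g' ->
    \sum_e int 0 (len e) (fun x => v e x * g' e x) =
    w ^+ 2 * \sum_e int 0 (len e) (fun x => u e x * g e x)) ->
  exists a b, [/\ forall e x, 0 <= x <= len e -> u e x = wave a b e x,
    forall e, ae_on (len e) (fun x => v e x = dwave a b e x) & kirchhoff a b].
Proof.
move=> uv weak.
have key e : exists c, (forall x, 0 <= x <= len e -> u e x = u e 0 * cosw w x + c * sinw w x) /\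
   ae_on (len e) (fun x => v e x = c * cosw w x - w ^+ 2 * (u e 0 * sinw w x)).
  have l0 := len_gt0 e; have l0' := len_ge0 e; have [vL pu] := uv e.
  set l := len e in l0 l0' vL pu *.
  have cu := primitive_continuous l0' pu.
  pose U x := int 0 x (u e).
  have pU : primitive l U (u e) by split; [exact: continuous_igr|move=> x _; rewrite /U int_pt add0r].
  have cU := primitive_continuous l0' pU.
  have vUL : L2r l (fun x => v e x + w ^+ 2 * U x) by apply/L2rD/L2r_cts/ctsZ.
  (* With [c] the mean, [F] integrates to 0, so its primitive, extended by 0 to the other edges, is
     a test function. Testing with it shows that [F ^+ 2] has integral 0. *)
  pose c := int 0 l (fun x => v e x + w ^+ 2 * U x) / l.
  pose F x := (v e x + w ^+ 2 * U x) + - c.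
  have FL : L2r l F by apply: L2rD vUL (L2r_cts (@cts_cst R 0 l _)).
  have F0 : int 0 l F = 0.
    rewrite /F intD; [|exact: L2r_igr|exact: igr_cst].
    by rewrite int_cst // subr0 mulNr /c divfK ?gt_eqF // subrr.
  have Fae : ae_on l (fun x => F x = 0).
    apply: int_sqr_eq0 => //.
    pose g e' x := if e' == e then int 0 x F else 0.
    pose g' e' x := if e' == e then F x else 0.
    have gend p : real_endval g p = 0.
      rewrite /real_endval /g; case: eqP => // ->; case: p.2; last by rewrite int_pt.
      exact: F0.
    have gt : real_form_domain g g'.
      split=> [e'|p q _|p _]; rewrite ?gend //.
      rewrite /g /g'; case: eqP => [->|_]; first exact: rprim_int.
      have := rprim_int (L2r_cts (@cts_cst R 0 (len e') 0)).
      rewrite (_ : (fun x => int 0 x (fun=> 0)) = fun=> 0) //.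
      by apply/funext => x; rewrite -(mul0r (0 : R)) /int RintegralZl ?mul0r //; exact: igr_cst.
    have := weak _ _ gt.
    have pick (h h' : edge G -> R -> R) :
        \sum_e0 int 0 (len e0) (fun x => h e0 x * (if e0 == e then h' e0 x else 0)) =
        int 0 l (fun x => h e x * h' e x).
      rewrite (bigD1 e) //= [X in _ + X]big1 => [|e' /negbTE ee].
        by rewrite addr0; apply: eq_int => x _; rewrite eqxx.
      rewrite -[RHS](mul0r (len e' - 0)) -int_cst ?len_ge0 //.
      by apply: eq_int => x _; rewrite ee mulr0.
    rewrite (pick v (fun _ => F)) (pick u (fun _ x => int 0 x F)) => E1.
    have pF := (rprim_int FL).2.
    have := (primitiveM l0' pF pU cu).2 l; rewrite l0' lexx => /(_ isT).
    rewrite F0 int_pt !mul0r add0r intD; last first.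
    - by apply/continuous_igr/ctsM => //; exact: primitive_continuous pF.
    - by apply: L2r_mul => //; exact: L2r_cts.
    move=> E2.
    have E3 : int 0 l (fun x => F x ^+ 2) =
        int 0 l (fun x => v e x * F x) + w ^+ 2 * int 0 l (fun x => F x * U x) + - c * int 0 l F.
      have i1 : igr `[0, l] (fun x => v e x * F x) by exact: L2r_mul.
      have i2 : igr `[0, l] (fun x => F x * U x) by apply: L2r_mul => //; exact: L2r_cts.
      have i3 : igr `[0, l] F by exact: L2r_igr.
      have j2 : igr `[0, l] (fun x => w ^+ 2 * (F x * U x)) by exact: igrZ.
      have j3 : igr `[0, l] (fun x => - c * F x) by exact: igrZ.
      have j12 : igr `[0, l] (fun x => v e x * F x + w ^+ 2 * (F x * U x)) by exact: igrD.
      rewrite -(intZ _ i2) -(intZ _ i3) -(intD i1 j2) -(intD j12 j3).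
      by apply: eq_int => x _; rewrite /F; ring.
    rewrite E3 F0 mulr0 addr0 E1 -mulrDr.
    rewrite (_ : int 0 l (fun x => u e x * int 0 x F) = int 0 l (fun x => int 0 x F * u e x)).
      by rewrite addrC -E2 mulr0.
    by apply: eq_int => x _; rewrite mulrC.
  pose V x := c + - w ^+ 2 * U x.
  have vV : ae_on l (fun x => v e x = V x).
    by apply: (ae_on_imp _ _ Fae) => // x _; rewrite /F /V => E; lra.
  have cV : cts 0 l V by apply: ctsD; [exact: cts_cst|exact: ctsZ].
  have puV : primitive l (u e) V.
    split; first exact: continuous_igr.
    move=> x /andP[x0 xl]; rewrite pu.2 ?x0 //; congr (_ + _); apply: ae_int.
    - by apply: igr_sub pu.1.
    - by apply: igr_sub (continuous_igr cV).
    - exact: (ae_on_imp xl _ vV).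
  have pV : primitive l V (fun x => - w ^+ 2 * u e x).
    split; first by apply/igrZ/continuous_igr.
    move=> x /andP[x0 xl]; rewrite /V /U int_pt mulr0 addr0 intZ //.
    by apply: igr_sub (continuous_igr cu).
  have sol := helmholtz_solution l0' puV pV.
  have V0 : V 0 = c by rewrite /V /U int_pt mulr0 addr0.
  exists c; split=> [x xl|]; first by have [-> _] := sol x xl; rewrite V0.
  by apply: (ae_on_imp _ _ vV) => // x xl ->; have [_ ->] := sol x xl; rewrite V0.
have [b bP] := choice key.
pose a e := u e 0.
have uab e x : 0 <= x <= len e -> u e x = wave a b e x by have [H _] := bP e; exact: H.
have vab e : ae_on (len e) (fun x => v e x = dwave a b e x) by have [_ H] := bP e; exact: H.
exists a, b; split=> // p0 p0D.
(* The hat function of a vertex: integration by parts against it leaves the sum of the outflows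
   there. *)
pose z (x : vert G) : R := (x == endpt p0)%:R.
pose g e x := z (endpt (e, false)) + (z (endpt (e, true)) - z (endpt (e, false))) / len e * x.
pose g' e (x : R) := (z (endpt (e, true)) - z (endpt (e, false))) / len e.
have gend p : real_endval g p = z (endpt p).
  case: p => e [] /=; rewrite /real_endval /g /=; last by rewrite mulr0 addr0.
  by rewrite divfK ?gt_eqF ?len_gt0 // addrC subrK.
have gt : real_form_domain g g'.
  split=> [e|p q pq|p pD]; rewrite ?gend ?pq //; first exact/rprim_lin/len_gt0.
  by rewrite /z; case: eqP => // pp0; rewrite -pp0 pD in p0D.
have [gprim _ _] := gt; have := weak _ _ gt.
rewrite (eq_bigr (fun e => int 0 (len e) (fun x => dwave a b e x * g' e x))) => [|e _]; last first.
  have [vL _] := uv e; have [gL _] := gprim e.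
  apply: ae_int; first exact: L2r_mul.
    by apply: L2r_mul => //; exact/L2r_cts/cts_dwave.
  by apply: (ae_on_imp _ _ (vab e)) => // x _ ->.
under eq_bigr do rewrite (wave_by_parts a b (gprim _)).
rewrite big_split /= sumrN mulr_sumr.
rewrite (eq_bigr (fun e => w ^+ 2 * int 0 (len e) (fun x => u e x * g e x))) => [|e _]; last first.
  by congr (_ * _); apply: eq_int => x xl; rewrite uab.
move/eqP; rewrite -subr_eq0 addrAC subrr add0r oppr_eq0 => /eqP E; rewrite -[RHS]E.
rewrite (eq_bigr (fun e => \sum_(c : bool) outflow a b (e, c) * z (endpt (e, c)))) => [|e _]; last first.
  by rewrite big_bool !gend.
rewrite (pair_bigA _ (fun e c => outflow a b (e, c) * z (endpt (e, c)))) /=.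
rewrite big_mkcond /=; apply: eq_bigr => -[e c] _ /=; rewrite /z.
by case: eqP; rewrite ?mulr1 ?mulr0.
Qed.

End RealWeak.

(** * Real and imaginary parts *)

Section ComplexParts.
Local Open Scope classical_set_scope.
Local Open Scope complex_scope.
Variable R : realType.
Implicit Types (z : R[i]) (l : R) (F H : R -> R[i]).

Definition re z : R := complex.Re z.
Definition im z : R := complex.Im z.

Lemma eq_parts z z' : re z = re z' -> im z = im z' -> z = z'.
Proof. by case: z z' => [a b] [c d] /= -> ->. Qed.

Lemma reD z z' : re (z + z') = re z + re z'. Proof. by case: z z' => [a b] [c d]. Qed.
Lemma imD z z' : im (z + z') = im z + im z'. Proof. by case: z z' => [a b] [c d]. Qed.
Lemma reM z z' : re (z * z') = re z * re z' - im z * im z'.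
Proof. by case: z z' => [a b] [c d]. Qed.
Lemma imM z z' : im (z * z') = re z * im z' + im z * re z'.
Proof. by case: z z' => [a b] [c d]. Qed.
Lemma reJ z : re z^* = re z. Proof. by case: z. Qed.
Lemma imJ z : im z^* = - im z. Proof. by case: z. Qed.

Lemma re_sum (I : finType) (f : I -> R[i]) : re (\sum_i f i) = \sum_i re (f i).
Proof. exact: (big_morph re reD). Qed.
Lemma im_sum (I : finType) (f : I -> R[i]) : im (\sum_i f i) = \sum_i im (f i).
Proof. exact: (big_morph im imD). Qed.

Lemma is_L2_derivativeP l F H : is_L2_derivative l F H <->
  rprim l (re \o F) (re \o H) /\ rprim l (im \o F) (im \o H).
Proof.
split=> [[[rL iL] FE]|[[rL [ri rE]] [iL [ii iE]]]].
  split; split=> //; split; try exact: L2r_igr.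
  - by move=> x /FE /(congr1 re); rewrite reD.
  - by move=> x /FE /(congr1 im); rewrite imD.
split=> [//|x xl]; apply: eq_parts; rewrite ?reD ?imD; [exact: rE|exact: iE].
Qed.

Lemma re_cintegral l F : re (cintegral l F) = int 0 l (re \o F).
Proof. by []. Qed.
Lemma im_cintegral l F : im (cintegral l F) = int 0 l (im \o F).
Proof. by []. Qed.

Lemma L2_derivativeP l F : H1_interval l F -> is_L2_derivative l F (L2_derivative l F).
Proof. by case=> H FH; apply: (@xgetPex _ _ [set g | is_L2_derivative l F g]); exists H. Qed.

Lemma rprim_unique l (f g h : R -> R) : rprim l f g -> rprim l f h ->
  ae_on l (fun x => g x = h x).
Proof.
move=> [_ [gi gE]] [_ [hi hE]]; apply: primitive_unique => // x xl.
by apply: (addrI (f 0)); rewrite -gE // -hE.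
Qed.

End ComplexParts.
Arguments re {R}.
Arguments im {R}.

Section Eigenspace.
Local Open Scope classical_set_scope.
Local Open Scope complex_scope.
Variables (R : realType) (G : metric_graph R) (VD : {set vert G}).
Implicit Types (f g h : graph_fun G).

Lemma parts_form_domain g : form_domain VD g ->
  let Dg e := L2_derivative (len e) (g e) in
  real_form_domain VD (fun e => re \o g e) (fun e => re \o Dg e) /\
  real_form_domain VD (fun e => im \o g e) (fun e => im \o Dg e).
Proof.
move=> [[[gc gv] gH] gD] Dg.
have P e := (is_L2_derivativeP _ _ _).1 (L2_derivativeP (gH e)).
split; split=> [e|p q pq|p pD].
- by have [] := P e.
- exact: (congr1 re (gv _ _ pq)).
- exact: (congr1 re (gD _ pD)).
- by have [] := P e.
- exact: (congr1 im (gv _ _ pq)).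
- exact: (congr1 im (gD _ pD)).
Qed.

Lemma re_inner f g : re (L2_inner f g) =
  \sum_e int 0 (len e) (fun x => re (f e x) * re (g e x) + im (f e x) * im (g e x)).
Proof.
rewrite re_sum; apply: eq_bigr => e _; rewrite re_cintegral; apply: eq_int => x _.
by rewrite /= reM reJ imJ mulrN opprK.
Qed.

Lemma im_inner f g : im (L2_inner f g) =
  \sum_e int 0 (len e) (fun x => im (f e x) * re (g e x) - re (f e x) * im (g e x)).
Proof.
rewrite im_sum; apply: eq_bigr => e _; rewrite im_cintegral; apply: eq_int => x _.
by rewrite /= imM reJ imJ mulrN addrC.
Qed.

Lemma form_domain_real u v : real_form_domain VD u v -> form_domain VD (fun e x => (u e x)%:C).
Proof.
move=> [uv uc uD]; have z0 (e : edge G) : rprim (len e) (fun=> 0) (fun=> 0).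
  have := rprim_int (L2r_cts (@cts_cst R 0 (len e) 0)).
  rewrite (_ : (fun x => int 0 x (fun=> 0)) = fun=> 0) //.
  by apply/funext => x; rewrite -(mul0r (0 : R)) /int RintegralZl ?mul0r //; exact: igr_cst.
split; first split; first split.
- move=> e; split.
    by apply: (primitive_continuous (len_ge0 e)); have [_] := uv e; exact.
  exact: cts_cst.
- by move=> p q pq; rewrite /endval; have := uc _ _ pq; rewrite /real_endval => ->.
- move=> e; exists (fun x => (v e x)%:C); apply/is_L2_derivativeP; split; first exact: uv.
  exact: z0.
- by move=> p pD; rewrite /endval; have := uD _ pD; rewrite /real_endval => ->.
Qed.

Variable w : R.

Definition cwave (A B : edge G -> R[i]) (e : edge G) (x : R) : R[i] :=
  A e * (cosw w x)%:C + B e * (sinw w x)%:C.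

Definition explicit_eigenfunction f : Prop := exists A B : edge G -> R[i],
  [/\ forall e x, 0 <= x <= len e -> f e x = cwave A B e x,
      forall p q, endpt p = endpt q -> endval f p = endval f q,
      forall p, endpt p \in VD -> endval f p = 0 &
      kirchhoff VD w (re \o A) (re \o B) /\ kirchhoff VD w (im \o A) (im \o B)].

Lemma re_cwave A B e x : re (cwave A B e x) = wave w (re \o A) (re \o B) e x.
Proof. by rewrite reD !reM /= !mulr0 !subr0. Qed.

Lemma im_cwave A B e x : im (cwave A B e x) = wave w (im \o A) (im \o B) e x.
Proof. by rewrite imD !imM /= !mulr0 !add0r. Qed.

(** Real test functions split the equation into two real weak equations. The chosen derivatives are
    determined only almost everywhere, so the integrands are exchanged up to null sets. *)
Lemma eigenfunction_explicit f : eigenspace VD (w ^+ 2) f -> explicit_eigenfunction f.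
Proof.
move=> [fdom _ weak]; have [[ru rc rD] [iu ic iD]] := parts_form_domain fdom.
pose Df e := L2_derivative (len e) (f e).
have test (y y' : edge G -> R -> R) : real_form_domain VD y y' ->
  \sum_e int 0 (len e) (fun x => re (Df e x) * y' e x) =
    w ^+ 2 * \sum_e int 0 (len e) (fun x => re (f e x) * y e x) /\
  \sum_e int 0 (len e) (fun x => im (Df e x) * y' e x) =
    w ^+ 2 * \sum_e int 0 (len e) (fun x => im (f e x) * y e x).
  move=> gt; have gdom := form_domain_real gt; have [gp _ _] := gt.
  pose Dg e := L2_derivative (len e) (fun x => (y e x)%:C).
  have [[rg _ _] [ig _ _]] := parts_form_domain gdom.
  have rD' e : ae_on (len e) (fun x => re (Dg e x) = y' e x).
    exact: rprim_unique (rg e) (gp e).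
  have iD' e : ae_on (len e) (fun x => im (Dg e x) = 0).
    apply: rprim_unique (ig e) _; split; first exact/L2r_cts/cts_cst.
    split; first exact: igr_cst.
    by move=> x /andP[x0 _]; rewrite int_cst // mul0r addr0.
  have D' e := ae_on_and (rD' e) (iD' e).
  have Lfr e : L2r (len e) (fun x => re (Df e x)) by have [] := ru e.
  have Lfi e : L2r (len e) (fun x => im (Df e x)) by have [] := iu e.
  have Lgr e : L2r (len e) (fun x => re (Dg e x)) by have [] := rg e.
  have Lgi e : L2r (len e) (fun x => im (Dg e x)) by have [] := ig e.
  have Ly e : L2r (len e) (y' e) by have [] := gp e.
  have cfr e : cts 0 (len e) (fun x => re (f e x)).
    by apply: (primitive_continuous (len_ge0 e)); have [_] := ru e; exact.
  have cfi e : cts 0 (len e) (fun x => im (f e x)).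
    by apply: (primitive_continuous (len_ge0 e)); have [_] := iu e; exact.
  have cy e : cts 0 (len e) (y e).
    by apply: (primitive_continuous (len_ge0 e)); have [_] := gp e; exact.
  have := weak _ gdom; move=> E; split.
    have := congr1 re E; rewrite !re_inner => E'.
    rewrite mulr_sumr; transitivity (\sum_e int 0 (len e) (fun x =>
       re (Df e x) * re (Dg e x) + im (Df e x) * im (Dg e x))).
      apply: eq_bigr => e _; apply: ae_int; first exact: L2r_mul.
        by apply: igrD => //; exact: L2r_mul.
      by apply: (ae_on_imp _ _ (D' e)) => // x _ [-> ->]; rewrite mulr0 addr0.
    rewrite E'; apply: eq_bigr => e _; rewrite -intZ; last exact/continuous_igr/ctsM.
    by apply: eq_int => x _; rewrite reM imM /= !mul0r !mulr0 !subr0 addr0 mulrA.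
  have := congr1 im E; rewrite !im_inner => E'.
  rewrite mulr_sumr; transitivity (\sum_e int 0 (len e) (fun x =>
     im (Df e x) * re (Dg e x) - re (Df e x) * im (Dg e x))).
    apply: eq_bigr => e _; apply: ae_int; first exact: L2r_mul.
      by apply: igrB => //; exact: L2r_mul.
    by apply: (ae_on_imp _ _ (D' e)) => // x _ [-> ->]; rewrite mulr0 subr0.
  rewrite E'; apply: eq_bigr => e _; rewrite -intZ; last exact/continuous_igr/ctsM.
  by apply: eq_int => x _; rewrite reM imM /= !mul0r !mulr0 subr0 addr0 mulrA.
have [a [b [ab _ Kab]]] := weak_solution ru (fun y y' gt => (test y y' gt).1).
have [c [d [cd _ Kcd]]] := weak_solution iu (fun y y' gt => (test y y' gt).2).
exists (fun e => a e +i* c e), (fun e => b e +i* d e); split=> //.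
- move=> e x xl; apply: eq_parts; rewrite ?re_cwave ?im_cwave; [exact: ab|exact: cd].
- by have [[[]]] := fdom.
- by have [_] := fdom.
Qed.

Lemma explicit_eigenfunctionP f : explicit_eigenfunction f -> eigenspace VD (w ^+ 2) f.
Proof.
move=> [A [B [fE fc fD [Kr Ki]]]].
have fr e x : 0 <= x <= len e -> re (f e x) = wave w (re \o A) (re \o B) e x.
  by move=> /fE ->; rewrite re_cwave.
have fi e x : 0 <= x <= len e -> im (f e x) = wave w (im \o A) (im \o B) e x.
  by move=> /fE ->; rewrite im_cwave.
pose F' e x : R[i] := dwave w (re \o A) (re \o B) e x +i* dwave w (im \o A) (im \o B) e x.
have pr e : rprim (len e) (re \o f e) (re \o F' e).
  split; first exact/L2r_cts/cts_dwave.
  apply: eq_primitive (primitive_wave w (re \o A) (re \o B) e (len_ge0 e)) => //.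
    exact: len_ge0.
  by move=> x xl; rewrite -fr.
have pi e : rprim (len e) (im \o f e) (im \o F' e).
  split; first exact/L2r_cts/cts_dwave.
  apply: eq_primitive (primitive_wave w (im \o A) (im \o B) e (len_ge0 e)) => //.
    exact: len_ge0.
  by move=> x xl; rewrite -fi.
have cr e := primitive_continuous (len_ge0 e) (pr e).2.
have ci e := primitive_continuous (len_ge0 e) (pi e).2.
have fdom : form_domain VD f.
  split=> //; split; first by split=> // e; split; [exact: cr|exact: ci].
  by move=> e; exists (F' e); apply/is_L2_derivativeP.
split=> //.
  move=> e; split.
    apply: (@eq_L2r _ _ (fun x => w ^+ 2 * re (f e x))); last exact/L2r_cts/ctsZ/cr.
    by move=> x _; rewrite /= -/(re _) reM /= mul0r subr0.
  apply: (@eq_L2r _ _ (fun x => w ^+ 2 * im (f e x))); last exact/L2r_cts/ctsZ/ci.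
  by move=> x _; rewrite /= -/(im _) imM /= mul0r addr0.
move=> g gdom; have [[ru rc rD] [iu ic iD]] := parts_form_domain gdom.
have [[rf _ _] [jf _ _]] := parts_form_domain fdom.
pose Df e := L2_derivative (len e) (f e); pose Dg e := L2_derivative (len e) (g e).
have Dr e : ae_on (len e) (fun x => re (Df e x) = re (F' e x)) := rprim_unique (rf e) (pr e).
have Di e : ae_on (len e) (fun x => im (Df e x) = im (F' e x)) := rprim_unique (jf e) (pi e).
have DD e := ae_on_and (Dr e) (Di e).
have Lfr e : L2r (len e) (fun x => re (Df e x)) by have [] := rf e.
have Lfi e : L2r (len e) (fun x => im (Df e x)) by have [] := jf e.
have Lgr e : L2r (len e) (fun x => re (Dg e x)) by have [] := ru e.
have Lgi e : L2r (len e) (fun x => im (Dg e x)) by have [] := iu e.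
have cgr e := primitive_continuous (len_ge0 e) (ru e).2.
have cgi e := primitive_continuous (len_ge0 e) (iu e).2.
have LF'r e : L2r (len e) (fun x => re (F' e x)) := (pr e).1.
have LF'i e : L2r (len e) (fun x => im (F' e x)) := (pi e).1.
have rg : real_form_domain VD (fun e => re \o g e) (fun e => re \o Dg e) by split.
have ig : real_form_domain VD (fun e => im \o g e) (fun e => im \o Dg e) by split.
apply: eq_parts; rewrite ?re_inner ?im_inner.
  rewrite (eq_bigr (fun e => int 0 (len e) (fun x => re (F' e x) * re (Dg e x)) +
     int 0 (len e) (fun x => im (F' e x) * im (Dg e x)))) => [|e _]; last first.
    rewrite -intD; try exact: L2r_mul.
    apply: ae_int; try (by apply: igrD => //; exact: L2r_mul).
    by apply: (ae_on_imp _ _ (DD e)) => // x _ [-> ->].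
  rewrite big_split /= (green Kr rg) (green Ki ig) -mulrDr -big_split mulr_sumr /=.
  apply: eq_bigr => e _; rewrite -intD; last first.
  - by apply/continuous_igr/ctsM; [exact: cts_wave|exact: cgi].
  - by apply/continuous_igr/ctsM; [exact: cts_wave|exact: cgr].
  rewrite -intZ; last first.
    by apply: igrD => //; apply/continuous_igr/ctsM; try exact: cts_wave; [exact: cgr|exact: cgi].
  apply: eq_int => x xl; rewrite reM imM /= fr // fi // /=; ring.
rewrite (eq_bigr (fun e => int 0 (len e) (fun x => im (F' e x) * re (Dg e x)) -
     int 0 (len e) (fun x => re (F' e x) * im (Dg e x)))) => [|e _]; last first.
  rewrite -intB; try exact: L2r_mul.
  apply: ae_int; try (by apply: igrB => //; exact: L2r_mul).
  by apply: (ae_on_imp _ _ (DD e)) => // x _ [-> ->].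
rewrite big_split sumrN /= (green Ki rg) (green Kr ig) -mulrBr -sumrB mulr_sumr /=.
apply: eq_bigr => e _; rewrite -intB; last first.
- by apply/continuous_igr/ctsM; [exact: cts_wave|exact: cgi].
- by apply/continuous_igr/ctsM; [exact: cts_wave|exact: cgr].
rewrite -intZ; last first.
  by apply: igrB => //; apply/continuous_igr/ctsM; try exact: cts_wave; [exact: cgr|exact: cgi].
apply: eq_int => x xl; rewrite reM imM /= fr // fi // /=; ring.
Qed.

End Eigenspace.

(** * Discretization *)

Section Discretization.
Local Open Scope complex_scope.
Variables (R : realType) (G : metric_graph R) (VD : {set vert G}) (M : nat) (w : R).
Notation V := (vert G).
Notation E := (edge G).
Notation W := (V + E * 'I_M)%type.
Notation Y := (E * 'I_M.+1)%type.
Notation node := (@node V E (@endpt R G) M).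
Notation lo := (@lo V E (@endpt R G) M).
Notation hi := (@hi V E (@endpt R G) M).

Definition step (e : E) : R := len e / M.+1%:R.
Definition dnodes : {set W} := [set (inl v : W) | v in VD].
Definition cweight (y : Y) : R := diag_weight w (step y.1).
Definition sweight (y : Y) : R := offdiag_weight w (step y.1).
Definition graph_mx : 'M[R]_#|{: W}| := network_mx lo hi dnodes cweight sweight.

Hypothesis sinw_step : forall e, sinw w (step e) != 0.
Hypothesis has_dart : forall v : V, exists p, endpt p = v.

Lemma stepM e : M.+1%:R * step e = len e.
Proof. by rewrite /step mulrC divfK // pnatr_eq0. Qed.

Section Wave.
Variables A B : E -> R[i].

Definition dcwave (e : E) (x : R) : R[i] :=
  B e * (cosw w x)%:C - (w ^+ 2)%:C * (A e * (sinw w x)%:C).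

Definition coutflow (p : E * bool) : R[i] :=
  if p.2 then - dcwave p.1 (len p.1) else B p.1.

Lemma dcwave0 e : dcwave e 0 = B e.
Proof. by rewrite /dcwave cosw0 sinw0 !mulr0 subr0 mulr1. Qed.

Lemma cwave0 e : cwave w A B e 0 = A e.
Proof. by rewrite /cwave cosw0 sinw0 mulr0 addr0 mulr1. Qed.

Lemma re_coutflow p : re (coutflow p) = outflow w (re \o A) (re \o B) p.
Proof.
rewrite /coutflow /outflow; case: p.2 => //; rewrite /dcwave /dwave.
have reN z : re (- z) = - re z :> R by case: z.
by rewrite reN reD reN !reM /= !mulr0 !mul0r !subr0.
Qed.

Lemma im_coutflow p : im (coutflow p) = outflow w (im \o A) (im \o B) p.
Proof.
rewrite /coutflow /outflow; case: p.2 => //; rewrite /dcwave /dwave.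
have imN z : im (- z) = - im z :> R by case: z.
by rewrite imN imD imN !imM /= !mulr0 !mul0r !add0r !addr0.
Qed.

(** The Dirichlet-to-Neumann relation of one piece, from the addition formulas and
    [cosw ^+ 2 + w ^+ 2 * sinw ^+ 2 = 1]. *)
Lemma wave_step e x : let r := step e in
  (diag_weight w r)%:C * cwave w A B e x - (offdiag_weight w r)%:C * cwave w A B e (x + r) =
    - dcwave e x /\
  (diag_weight w r)%:C * cwave w A B e (x + r) - (offdiag_weight w r)%:C * cwave w A B e x =
    dcwave e (x + r).
Proof.
move=> r; have S0 : (sinw w r)%:C != 0 :> R[i].
  by apply: contraNneq (sinw_step e) => /complexI ->.
rewrite /diag_weight /offdiag_weight -/(cosw w r) /cwave /dcwave coswD sinwD.
have := cosw2_sinw2 w r; rewrite [cosw w r ^+ 2]expr2 [sinw w r ^+ 2]expr2.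
move: (w ^+ 2) => q /(congr1 (real_complex R)).
rewrite !(rmorphD, rmorphN, rmorphM, fmorphV, rmorph1) /=.
move: S0; move: (sinw w r)%:C (cosw w r)%:C (sinw w x)%:C (cosw w x)%:C (A e) (B e) q%:C.
move=> S C s c a b q' S0 cs.
have E1 z : S * (C * S^-1 * z) = C * z by field.
have E2 z : S * (S^-1 * z) = z by field.
split; apply: (mulfI S0); rewrite mulrBr E1 E2; first by ring.
have {}cs : C * C = 1 - q' * (S * S) by rewrite -cs addrK.
transitivity ((C * C) * (a * c + b * s) - (a * c + b * s) + C * S * (b * c - q' * (a * s))).
  by ring.
by rewrite cs; ring.
Qed.

(* The node equations applied to a wave: the contributions of the pieces of
   an edge telescope to the outflows at its endpoints. *)
Lemma node_equation (X : W -> R[i]) (n : W) :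
  (forall e i, (i <= M.+1)%N -> X (node e i) = cwave w A B e (i%:R * step e)) ->
  \sum_y ((lo y == n)%:R * ((cweight y)%:C * X (lo y) - (sweight y)%:C * X (hi y)) +
          (hi y == n)%:R * ((cweight y)%:C * X (hi y) - (sweight y)%:C * X (lo y))) =
  - \sum_p (inl (endpt p) == n)%:R * coutflow p.
Proof.
move=> XE.
pose h e i := (node e i == n)%:R * dcwave e (i%:R * step e).
rewrite (eq_bigr (fun y : Y => h y.1 y.2.+1 - h y.1 y.2)) => [|[e i] _]; last first.
  rewrite /lo /hi /= !XE ?ltn_ord //; last by rewrite ltnW // ltn_ord.
  rewrite /cweight /sweight /= -(addn1 i) natrD mulrDl mul1r.
  have [-> ->] := wave_step e (i%:R * step e).
  by rewrite /h addn1 -(addn1 i) natrD mulrDl mul1r addn1 addrC mulrN.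
rewrite -(pair_bigA _ (fun e (i : 'I_M.+1) => h e i.+1 - h e i)) /=.
rewrite [in RHS](eq_bigr (fun p : E * bool => (fun e c => (inl (endpt (e, c)) == n)%:R * coutflow (e, c)) p.1 p.2)); last by case.
rewrite -(pair_bigA _ (fun e c => (inl (endpt (e, c)) == n)%:R * coutflow (e, c))) /=.
rewrite -sumrN; apply: eq_bigr => e _; rewrite big_bool /=.
rewrite -(big_mkord predT (fun i => h e i.+1 - h e i)) telescope_sumr // /h.
rewrite node_last stepM mul0r dcwave0 /coutflow /=.
by rewrite mulrN opprD opprK.
Qed.

Lemma dcwave_kirchhoff : (forall v, v \notin VD ->
    \sum_p (inl (endpt p) == inl v :> W)%:R * coutflow p = 0) ->
  kirchhoff VD w (re \o A) (re \o B) /\ kirchhoff VD w (im \o A) (im \o B).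
Proof.
move=> H; suff K p0 : endpt p0 \notin VD -> \sum_(p | endpt p == endpt p0) coutflow p = 0.
  split=> p0 /K E.
    transitivity (re (\sum_(p | endpt p == endpt p0) coutflow p)); last by rewrite E.
    rewrite (big_morph re (@reD R) (erefl : re 0 = 0)); apply: eq_bigr => p _.
    by rewrite re_coutflow.
  transitivity (im (\sum_(p | endpt p == endpt p0) coutflow p)); last by rewrite E.
  rewrite (big_morph im (@imD R) (erefl : im 0 = 0)); apply: eq_bigr => p _.
  by rewrite im_coutflow.
move=> /H E; rewrite -[RHS]E big_mkcond /=; apply: eq_bigr => p _.
rewrite (_ : (inl (endpt p) == inl (endpt p0) :> W) = (endpt p == endpt p0)) //.
by case: eqP; rewrite ?mul1r ?mul0r.
Qed.

Lemma kirchhoff_dcwave v : v \notin VD ->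
  kirchhoff VD w (re \o A) (re \o B) -> kirchhoff VD w (im \o A) (im \o B) ->
  \sum_p (inl (endpt p) == inl v :> W)%:R * coutflow p = 0.
Proof.
move=> vD Kr Ki; have [p0 p0v] := has_dart v; rewrite -p0v in vD *.
rewrite (eq_bigr (fun p => if endpt p == endpt p0 then coutflow p else 0)) => [|p _]; last first.
  rewrite (_ : (inl (endpt p) == inl (endpt p0) :> W) = (endpt p == endpt p0)) //.
  by case: eqP; rewrite ?mul1r ?mul0r.
rewrite -big_mkcond /=; apply: eq_parts.
  rewrite (big_morph re (@reD R) (erefl : re 0 = 0)) -[RHS](Kr _ vD).
  by apply: eq_bigr => p _; rewrite re_coutflow.
rewrite (big_morph im (@imD R) (erefl : im 0 = 0)) -[RHS](Ki _ vD).
by apply: eq_bigr => p _; rewrite im_coutflow.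
Qed.

End Wave.

(** Any dart at [v] serves, as the end values of a continuous function agree there; 0 stands for a
    vertex without darts. *)
Definition node_val (f : graph_fun G) (n : W) : R[i] := match n with
  | inl v => if [pick p | endpt p == v] is Some p then endval f p else 0
  | inr (e, j) => f e (j.+1%:R * step e) end.

Lemma node_valE f e i : (forall p q, endpt p = endpt q -> endval f p = endval f q) ->
  (i <= M.+1)%N -> node_val f (node e i) = f e (i%:R * step e).
Proof.
move=> fc; have vE p : node_val f (inl (endpt p)) = endval f p.
  by rewrite /=; case: pickP => [q /eqP/fc //|/(_ p)]; rewrite eqxx.
case: i => [|i]; first by rewrite vE /endval /= mul0r.
rewrite ltnS leq_eqVlt => /predU1P[->|iM]; first by rewrite node_last vE /endval /= stepM.
by rewrite (_ : i = Ordinal iM) // node_interior.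
Qed.

Definition graph_mxC : 'M[R[i]]_#|{: W}| := map_mx (real_complex R) graph_mx.

Definition val_row (X : W -> R[i]) : 'rV[R[i]]_#|{: W}| := \row_j X (enum_val j).

Lemma val_rowE X n : val_row X 0 (enum_rank n) = X n.
Proof. by rewrite mxE enum_rankK. Qed.

Lemma step_le e i : (i <= M.+1)%N -> 0 <= i%:R * step e <= len e.
Proof.
move=> iM; have s0 : 0 <= step e by rewrite divr_ge0 ?len_ge0.
by rewrite mulr_ge0 //= -(stepM e) ler_wpM2r // ler_nat.
Qed.

Lemma graph_mxC_eq0 (x : 'rV[R[i]]_#|{: W}|) (X := fun n => x 0 (enum_rank n)) :
  x *m graph_mxC = 0 <->
  (forall n, n \in dnodes -> X n = 0) /\
  (forall n, n \notin dnodes ->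
    \sum_y ((lo y == n)%:R * ((cweight y)%:C * X (lo y) - (sweight y)%:C * X (hi y)) +
            (hi y == n)%:R * ((cweight y)%:C * X (hi y) - (sweight y)%:C * X (lo y))) = 0).
Proof.
rewrite /graph_mxC /graph_mx map_network_mx.
have fv : (forall n, n \in dnodes -> X n = 0) -> forall n, free_val dnodes x n = X n.
  by move=> X0 n; rewrite /free_val; case: ifP => // /X0 ->.
split=> [x0|[X0 XK]].
  have E n := mul_network_mx lo hi dnodes (real_complex R \o cweight) (real_complex R \o sweight) x n.
  have X0 n : n \in dnodes -> X n = 0.
    by move=> nD; have := E n; rewrite x0 nD mxE /X => <-.
  split=> // n nD; have := E n; rewrite x0 (negbTE nD) mxE => H; rewrite [RHS]H.
  by apply: eq_bigr => y _; rewrite !fv.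
apply/rowP => j; rewrite -(enum_valK j) mul_network_mx [RHS]mxE; case: ifP => [/X0 //|/negbT nD].
rewrite -[RHS](XK _ nD).
by apply: eq_bigr => y _; rewrite !fv.
Qed.

Lemma eigenfunction_kernel f : explicit_eigenfunction VD w f ->
  val_row (node_val f) *m graph_mxC = 0.
Proof.
move=> [A [B [fE fc fD [Kr Ki]]]]; apply/graph_mxC_eq0; split=> [n|n nD].
  rewrite val_rowE => /imsetP[v vD ->] /=.
  by case: pickP => // p /eqP pv; rewrite fD // pv.
under eq_bigr do rewrite !val_rowE.
rewrite (@node_equation A B) => [|e i iM]; last by rewrite node_valE // fE // step_le.
apply/eqP; rewrite oppr_eq0; apply/eqP.
case: n nD => [v|p] nD; last by rewrite big1 // => q _; rewrite mul0r.
apply: kirchhoff_dcwave => //; apply: contraNN nD => vD.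
by apply/imsetP; exists v.
Qed.

Lemma node_eq_inr e i (p : E * 'I_M) :
  (node e i == inr p) = (e == p.1) && (i == p.2.+1).
Proof.
case: p => e' j /=; case: i => [|i]; first by rewrite andbF.
rewrite eqSS; case: (ltnP i M) => iM.
  rewrite (_ : i = Ordinal iM) // node_interior.
  by rewrite (_ : (inr _ == inr _ :> W) = ((e, Ordinal iM) == (e', j))).
rewrite node_final //; apply/esym/negbTE; rewrite negb_and orbC.
by rewrite gtn_eqF // (leq_trans (ltn_ord j)).
Qed.

Lemma sum_pieces_inr (P Q : Y -> R[i]) (e : E) (j : 'I_M) :
  \sum_y ((lo y == inr (e, j))%:R * P y + (hi y == inr (e, j))%:R * Q y) =
  P (e, lift ord0 j) + Q (e, widen_ord (leqnSn M) j).
Proof.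
rewrite big_split /=; congr (_ + _).
  rewrite (bigD1 (e, lift ord0 j)) //= /lo node_eq_inr /= !eqxx mul1r big1 ?addr0 // => -[e' i] ne.
  rewrite node_eq_inr /=; case: eqP => [ee|_]; rewrite ?mul0r //=; case: eqP => [ij|_]; rewrite ?mul0r //.
  by move: ne; rewrite xpair_eqE ee eqxx /= (_ : i = lift ord0 j) ?eqxx //; apply/val_inj.
rewrite (bigD1 (e, widen_ord (leqnSn M) j)) //= /hi node_eq_inr /= !eqxx mul1r big1 ?addr0 // => -[e' i] ne.
rewrite node_eq_inr /=; case: eqP => [ee|_]; rewrite ?mul0r //=; case: eqP => [[ij]|_]; rewrite ?mul0r //.
by move: ne; rewrite xpair_eqE ee eqxx /= (_ : i = widen_ord (leqnSn M) j) ?eqxx //; apply/val_inj.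
Qed.

(** The first two nodes of an edge fix a wave on it. The equations at the interior nodes form a
    three-term recurrence which the wave also satisfies, so both agree at all nodes; the equations
    at the vertices are the Kirchhoff conditions. *)
Lemma kernel_eigenfunction (x : 'rV[R[i]]_#|{: W}|) : x *m graph_mxC = 0 ->
  exists2 f, explicit_eigenfunction VD w f & val_row (node_val f) = x.
Proof.
move=> x0; pose X n := x 0 (enum_rank n).
have [X0 XK] : (forall n, n \in dnodes -> X n = 0) /\ (forall n, n \notin dnodes ->
    \sum_y ((lo y == n)%:R * ((cweight y)%:C * X (lo y) - (sweight y)%:C * X (hi y)) +
            (hi y == n)%:R * ((cweight y)%:C * X (hi y) - (sweight y)%:C * X (lo y))) = 0).
  exact/graph_mxC_eq0.
pose A e := X (node e 0).
pose B e := (X (node e 1) - A e * (cosw w (step e))%:C) / (sinw w (step e))%:C.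
have S0 e : (sinw w (step e))%:C != 0 :> R[i].
  by apply: contraNneq (sinw_step e) => /complexI ->.
have XE2 e i : (i.+1 <= M.+1)%N -> X (node e i) = cwave w A B e (i%:R * step e) /\
    X (node e i.+1) = cwave w A B e (i.+1%:R * step e).
  elim: i => [|i IHi] iM.
    by rewrite mul0r cwave0 mul1r /cwave /B divfK // addrC subrK.
  have [Xi Xi1] := IHi (ltnW iM); split=> //.
  have jM : (i < M)%N by rewrite -ltnS.
  have := XK (inr (e, Ordinal jM)); rewrite /dnodes inr_in => /(_ isT).
  rewrite sum_pieces_inr /lo /hi /= /bump /= add1n Xi Xi1 /cweight /sweight /=.
  have [_] := wave_step A B e (i%:R * step e).
  have [+ _] := wave_step A B e (i.+1%:R * step e).
  have -> : i%:R * step e + step e = i.+1%:R * step e by rewrite -addn1 natrD mulrDl mul1r.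
  have -> : i.+1%:R * step e + step e = i.+2%:R * step e by rewrite -(addn1 i.+1) natrD mulrDl mul1r.
  have s0 : (offdiag_weight w (step e))%:C != 0 :> R[i].
    by rewrite /offdiag_weight fmorphV invr_eq0 S0.
  move=> E1; rewrite -[RHS]opprK -E1 => E2 E3; apply: (mulfI s0); apply/eqP; rewrite -subr_eq0; apply/eqP.
  by rewrite -[RHS]oppr0 -[in RHS]E3 E2; ring.
have XE e i : (i <= M.+1)%N -> X (node e i) = cwave w A B e (i%:R * step e).
  case: i => [|i] iM; first by have [] := XE2 e 0%N isT.
  by have [] := XE2 e i iM.
have endX p : endval (cwave w A B) p = X (inl (endpt p)).
  case: p => e []; rewrite /endval /=; first by rewrite -stepM -XE // node_last.
  by rewrite cwave0.
have fc p q : endpt p = endpt q -> endval (cwave w A B) p = endval (cwave w A B) q.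
  by move=> pq; rewrite !endX pq.
exists (cwave w A B).
  exists A, B; split=> // [p pD|].
    by rewrite endX X0 //; apply/imsetP; exists (endpt p).
  apply: dcwave_kirchhoff => v vD; apply/eqP; rewrite -oppr_eq0 -(node_equation _ XE).
  by apply/eqP/XK; apply: contraNN vD => /imsetP[u uD [->]].
apply/rowP => j; rewrite -(enum_valK j) val_rowE -/(X _).
case: (enum_val j) => [v|[e k]].
  by have [p <-] := has_dart v; rewrite -endX /=; case: pickP => [q /eqP/fc //|/(_ p)]; rewrite eqxx.
by rewrite -(@node_interior V E (@endpt R G) M e k) node_valE ?XE ?step_le ?(ltnW (ltn_ord (lift ord0 k))) //.
Qed.

(** Node values determine a combination of eigenfunctions: nodes 0 and 1 of an edge give back both
    coefficients, [sinw w (step e)] being nonzero. *)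
Lemma explicit_sum d (c : 'I_d -> R[i]) (b : 'I_d -> graph_fun G) :
  (forall i, explicit_eigenfunction VD w (b i)) ->
  (forall n, \sum_i c i * node_val (b i) n = 0) ->
  forall e x, 0 <= x <= len e -> \sum_i c i * b i e x = 0.
Proof.
move=> bex b0 e x xl.
have [A AP] := choice bex; have [B BP] := choice AP.
have S0 : (sinw w (step e))%:C != 0 :> R[i].
  by apply: contraNneq (sinw_step e) => /complexI ->.
have bE i y : 0 <= y <= len e -> b i e y = cwave w (A i) (B i) e y by have [H _ _ _] := BP i; exact: H.
have bc i : forall p q, endpt p = endpt q -> endval (b i) p = endval (b i) q by have [_ H _ _] := BP i.
have A0 : \sum_i c i * A i e = 0.
  rewrite -[RHS](b0 (node e 0)); apply: eq_bigr => i _.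
  by rewrite (node_valE _ (bc i)) // mul0r bE ?lexx ?len_ge0 // cwave0.
have B0 : \sum_i c i * B i e = 0.
  apply: (mulIf S0); rewrite mul0r -[RHS](b0 (node e 1)).
  rewrite (_ : \sum_i c i * node_val (b i) (node e 1) =
    (\sum_i c i * A i e) * (cosw w (step e))%:C + (\sum_i c i * B i e) * (sinw w (step e))%:C).
    by rewrite A0 mul0r add0r.
  rewrite !mulr_suml -big_split /=; apply: eq_bigr => i _.
  by rewrite (node_valE _ (bc i)) // bE ?step_le // mul1r /cwave mulrDr !mulrA.
under eq_bigr do rewrite bE // /cwave mulrDr !mulrA.
by rewrite big_split /= -!mulr_suml A0 B0 !mul0r addr0.
Qed.

(** The node values of a basis of eigenfunctions form a basis of the kernel, and the rank of a real
    matrix is the same over the complex numbers. *)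
Lemma eigenspace_dim d : has_dimension (eigenspace VD (w ^+ 2)) d ->
  d = (#|{: W}| - \rank graph_mx)%N.
Proof.
case=> b [bE bfree bspan].
have bex i : explicit_eigenfunction VD w (b i) by apply: eigenfunction_explicit.
rewrite -(mxrank_map (real_complex R)) -mxrank_ker -/graph_mxC.
pose Bm : 'M[R[i]]_(d, #|{: W}|) := \matrix_(i, j) node_val (b i) (enum_val j).
have rB i : row i Bm = val_row (node_val (b i)) by apply/rowP => j; rewrite !mxE.
have Bfree : row_free Bm.
  rewrite -kermx_eq0; apply/eqP/row_matrixP => i; rewrite row0.
  apply/rowP => j; rewrite [RHS]mxE.
  have kB : row i (kermx Bm) *m Bm = 0 by apply/sub_kermxP; rewrite row_sub.
  apply: (bfree (fun j => row i (kermx Bm) 0 j)); apply: explicit_sum => // n.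
  have := congr1 (fun A : 'rV_#|{: W}| => A 0 (enum_rank n)) kB; rewrite !mxE => H.
  by rewrite -[RHS]H; apply: eq_bigr => k _; rewrite [Bm _ _]mxE enum_rankK.
rewrite -(eqP Bfree); apply: eqmx_rank; apply/andP; split.
  apply/row_subP => i; rewrite rB; apply/sub_kermxP; exact: eigenfunction_kernel.
apply/row_subP => i; set x := row i _.
have /kernel_eigenfunction[f /explicit_eigenfunctionP fE <-] : x *m graph_mxC = 0.
  by apply/sub_kermxP; rewrite row_sub.
have [c cE] := bspan f fE.
apply/submxP; exists (\row_i c i); apply/rowP => j; rewrite !mxE.
rewrite (eq_bigr (fun i => c i * node_val (b i) (enum_val j))) => [|i' _]; last by rewrite !mxE.
case: (enum_val j) => [v|[e k]] /=; last by rewrite cE // step_le // ltnW // ltnS ltn_ord.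
case: pickP => [[e []] _|none] /=; rewrite /endval /=.
- by rewrite cE // len_ge0 lexx.
- by rewrite cE // len_ge0 lexx.
- by rewrite big1 // => i' _; rewrite mulr0.
Qed.

End Discretization.

(** * Absence of negative eigenvalues *)

Section NegativeEigenvalues.
Local Open Scope complex_scope.
Variables (R : realType).

Lemma rprim_eq0 l (u v : R -> R) : 0 < l -> rprim l u v ->
  int 0 l (fun x => v x ^+ 2) = 0 -> int 0 l (fun x => u x ^+ 2) = 0 ->
  forall x, 0 <= x <= l -> u x = 0.
Proof.
move=> l0 [vL [vi uE]] v0 u0; have va := int_sqr_eq0 vL v0.
have uc x : 0 <= x <= l -> u x = u 0.
  move=> /andP[x0 xl]; rewrite uE ?x0 // -[RHS]addr0; congr (_ + _).
  rewrite (_ : int 0 x v = int 0 x (fun=> 0)); first by rewrite int_cst // mul0r.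
  apply: ae_int; first exact: igr_sub vi.
  - exact: igr_cst.
  - exact: ae_on_imp va.
move=> x xl; rewrite uc //; apply/eqP; rewrite -sqrf_eq0.
move: u0; rewrite (@eq_int _ _ _ _ (fun=> u 0 ^+ 2)) => [|y /uc -> //].
by rewrite int_cst ?ltW // subr0 => /eqP; rewrite mulf_eq0 (gt_eqF l0) orbF.
Qed.

Lemma int_sqr_ge0 l (u v : R -> R) : 0 <= int 0 l (fun x => u x ^+ 2 + v x ^+ 2).
Proof. by apply: Rintegral_ge0 => x _; rewrite addr_ge0 ?sqr_ge0. Qed.

Lemma int_sqrD_eq0 l (u v : R -> R) : L2r l u -> L2r l v ->
  int 0 l (fun x => u x ^+ 2 + v x ^+ 2) = 0 ->
  int 0 l (fun x => u x ^+ 2) = 0 /\ int 0 l (fun x => v x ^+ 2) = 0.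
Proof.
move=> /L2r_sqr[_ iu] /L2r_sqr[_ iv]; rewrite intD // => /eqP.
have P (y : R -> R) : 0 <= int 0 l (fun x => y x ^+ 2).
  by apply: Rintegral_ge0 => x _; rewrite sqr_ge0.
by rewrite paddr_eq0 // => /andP[/eqP -> /eqP ->].
Qed.

(** Testing the equation with [f] itself equates the squared norm of its derivative with [mu] times
    that of [f], so both are 0. *)
Lemma negative_eigenspace (G : metric_graph R) (VD : {set vert G}) (mu : R) f :
  mu < 0 -> eigenspace VD mu f -> forall e x, 0 <= x <= len e -> f e x = 0.
Proof.
move=> mu0 [fdom _ weak]; have [[ru _ _] [iu _ _]] := parts_form_domain fdom.
have := congr1 re (weak _ fdom); rewrite !re_inner.
set S1 := (X in X = _); set S2 := (X in _ = X).
pose S3 := \sum_e int 0 (len e) (fun x => re (f e x) ^+ 2 + im (f e x) ^+ 2).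
have Lfr e : L2r (len e) (re \o f e).
  by apply/L2r_cts/(primitive_continuous (len_ge0 e)); have [_] := ru e; exact.
have Lfi e : L2r (len e) (im \o f e).
  by apply/L2r_cts/(primitive_continuous (len_ge0 e)); have [_] := iu e; exact.
have -> : S2 = mu * S3.
  rewrite mulr_sumr; apply: eq_bigr => e _; rewrite -intZ; last first.
    by apply: igrD => //; [have [] := L2r_sqr (Lfr e)|have [] := L2r_sqr (Lfi e)].
  by apply: eq_int => x _; rewrite reM imM /=; ring.
have S30 : 0 <= S3 by apply: sumr_ge0 => e _; exact: int_sqr_ge0.
have S10 : 0 <= S1 by apply: sumr_ge0 => e _; exact: int_sqr_ge0.
move=> S13; have S1_0 : S1 = 0.
  by apply/eqP; rewrite eq_le S10 andbT S13 nmulr_rle0.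
have S3_0 : S3 = 0.
  by move/eqP: S13; rewrite S1_0 eq_sym mulf_eq0 (lt_eqF mu0) => /eqP.
move=> e x xl.
have zero (F : edge G -> R) : (forall e, 0 <= F e) -> \sum_e F e = 0 -> F e = 0.
  move=> F0 /eqP; rewrite psumr_eq0 => [/allP/(_ e)|*]; last exact: F0.
  by rewrite mem_index_enum => /(_ isT)/eqP.
have [r1 i1] : int 0 (len e) (fun x => re (graph_derivative f e x) ^+ 2) = 0 /\
    int 0 (len e) (fun x => im (graph_derivative f e x) ^+ 2) = 0.
  apply: int_sqrD_eq0; first by have [] := ru e.
    by have [] := iu e.
  exact: (zero (fun e => int 0 (len e) (fun x => re (graph_derivative f e x) ^+ 2 +
    im (graph_derivative f e x) ^+ 2)) (fun e => int_sqr_ge0 _ _ _) S1_0).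
have [r0 i0] : int 0 (len e) (fun x => re (f e x) ^+ 2) = 0 /\
    int 0 (len e) (fun x => im (f e x) ^+ 2) = 0.
  apply: int_sqrD_eq0; [exact: Lfr|exact: Lfi|].
  exact: (zero (fun e => int 0 (len e) (fun x => re (f e x) ^+ 2 + im (f e x) ^+ 2))
    (fun e => int_sqr_ge0 _ _ _) S3_0).
apply: eq_parts.
  exact: (rprim_eq0 (len_gt0 e) (ru e) r1 r0).
exact: (rprim_eq0 (len_gt0 e) (iu e) i1 i0).
Qed.

Lemma has_dimension0 (G : metric_graph R) (E : set (graph_fun G)) d :
  (forall f, E f -> forall e x, 0 <= x <= len e -> f e x = 0) ->
  has_dimension E d -> d = 0%N.
Proof.
move=> E0; case: d => // d [b [bE bfree _]].
suff /(bfree (fun=> 1))/(_ ord0)/eqP : forall e x, 0 <= x <= len e -> \sum_i 1 * b i e x = 0.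
  by rewrite oner_eq0.
by move=> e x xl; apply: big1 => i _; rewrite (E0 (b i)) // mulr0.
Qed.

End NegativeEigenvalues.

(** * Spectral flow *)

Section SortedMultiplicity.
Local Open Scope classical_set_scope.
Local Open Scope card_scope.
Variables (R : realType) (lam : nat -> R).
Hypothesis lam_le : forall m n, (1 <= m <= n)%N -> lam m <= lam n.

Lemma multiplicity_ge (a i d : nat) (mu : R) :
  (forall m, (a < m <= i)%N -> lam m = mu) ->
  [set n | (1 <= n)%N /\ lam n = mu] #= `I_d -> (i <= a + d)%N.
Proof.
move=> E; rewrite card_eq_le => /andP[H _].
have inj : {in `I_(i - a) &, injective (fun x => a.+1 + x)%N} by move=> x y _ _ /addnI.
have : `I_(i - a) #<= `I_d.
  have := inj_card_eq inj; rewrite card_eq_le => /andP[_ h1].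
  apply: card_le_trans h1 (card_le_trans _ H); apply: subset_card_le => _ [x /= xi <-].
  by split; [lia|apply: E; lia].
by rewrite card_le_II; lia.
Qed.

(** For [d > 0], if [lam (a + d)] exceeded [mu], the indices with value [mu] would lie strictly
    between [a] and [a + d], where there is room for fewer than [d]. *)
Lemma multiplicity_le (a d : nat) (mu : R) : ((0 < a)%N -> lam a < mu) ->
  [set n | (1 <= n)%N /\ lam n = mu] #= `I_d -> (0 < a + d)%N -> lam (a + d)%N <= mu.
Proof.
move=> am; case: d => [|d].
  by rewrite addn0 => _ /am /ltW.
rewrite card_eq_le => /andP[_ H] _; rewrite leNgt; apply/negP => lt.
have : `I_d.+1 #<= `I_d.
  apply: (card_le_trans H); set S := [set n | _].
  have Sa x : S x -> (a < x)%N.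
    move=> [x1 xm]; rewrite ltnNge; apply/negP => xa.
    have a0 : (0 < a)%N by lia.
    by have := le_lt_trans (lam_le (m := x) (n := a) _) (am a0); rewrite xm ltxx x1 xa; move=> /(_ isT).
  have inj : {in S &, injective (fun x => x - a.+1)%N}.
    by move=> x y /[!inE] /Sa xa /Sa ya; lia.
  have := inj_card_eq inj; rewrite card_eq_le => /andP[_ h1].
  apply: (card_le_trans h1); apply: subset_card_le => _ [x Sx <-] /=.
  rewrite ltnNge; apply/negP => dx; have := Sa x Sx; case: Sx => x1 xm ax.
  have := lt_le_trans lt (lam_le (m := (a + d.+1)%N) (n := x) _).
  have -> : (0 < a + d.+1 <= x)%N by lia.
  by rewrite xm ltxx => /(_ isT).
by rewrite card_le_II ltnn.
Qed.

(** [a] is the number of positive indices with a value below [lam i]; it is 0 when there are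
    none. *)
Lemma first_index i : (0 < i)%N -> exists a, [/\ (a < i)%N, (0 < a)%N -> lam a < lam i &
  forall m, (a < m <= i)%N -> lam m = lam i].
Proof.
move=> i0; have ex : exists m, (0 < m)%N && (lam m == lam i) by exists i; rewrite i0 eqxx.
case: (ex_minnP ex) => m /andP[m0 /eqP mi] mmin; exists m.-1; split.
- by have := mmin i; rewrite i0 eqxx => /(_ isT); lia.
- move=> a0; rewrite lt_neqAle -{2}mi lam_le ?andbT; last by lia.
  apply/negP => h; have := mmin m.-1; rewrite a0 h => /(_ isT); lia.
- move=> k /andP[ak ki]; apply/eqP; rewrite eq_le lam_le ?andTb; last by lia.
  by rewrite -mi lam_le //; lia.
Qed.

End SortedMultiplicity.

Section SpectralFlow.
Local Open Scope classical_set_scope.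
Local Open Scope card_scope.
Variables (R : realType) (n : nat) (A : R -> 'M[R]_n) (W : R) (lam : nat -> R).
Hypothesis A_sym : forall w, (A w)^T = A w.
Hypothesis A_cont : forall w, 0 <= w < W -> forall i j, {for w, continuous (fun w => A w i j)}.
Hypothesis A_decr : forall w w' x, 0 <= w -> w < w' -> w' < W -> x != 0 ->
  qform (A w) x <= 0 -> qform (A w') x < 0.
Hypothesis A0_ge0 : forall x, 0 <= qform (A 0) x.
Hypothesis lam_le : forall m n, (1 <= m <= n)%N -> lam m <= lam n.
Hypothesis lam_ge0 : forall m, (1 <= m)%N -> 0 <= lam m.
Hypothesis lam_mult : forall w, 0 <= w < W ->
  [set m | (1 <= m)%N /\ lam m = w ^+ 2] #= `I_(n - \rank (A w)).

(** On [U + kermx B] the form sees only the component in [U], and a negative subspace meets the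
    kernel in 0. *)
Lemma has_subspace_kernel (B : 'M[R]_n) k : B^T = B -> has_subspace (< 0) B k ->
  has_subspace (<= 0) B (k + (n - \rank B)).
Proof.
move=> Bs [U kU UB]; exists (U + kermx B)%MS.
  rewrite mxrank_disjoint_sum ?mxrank_ker ?leq_add2r //.
  apply/eqP; rewrite -submx0; apply/rV_subP => x.
  rewrite sub_capmx => /andP[xU /sub_kermxP xB].
  case: (eqVneq x 0) => [->|/(UB _ xU)]; first exact: sub0mx.
  by rewrite /qform xB mul0mx mxE /= ltxx.
move=> x /sub_addsmxP[[y z] /= ->]; set u := y *m U; set v := z *m kermx B.
have vB : v *m B = 0 by apply/sub_kermxP/submxMl.
have Bv : B *m v^T = 0 by rewrite -{1}Bs -trmx_mul vB trmx0.
rewrite /qform mulmxDl vB addr0 linearD /= mulmxDr -[u *m B *m v^T]mulmxA Bv mulmx0 addr0.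
move=> _; case: (eqVneq u 0) => [->|u0]; first by rewrite !mul0mx mxE.
by apply/ltW/(UB u) => //; exact: submxMl.
Qed.

(** Induction along the distinct values: the subspace found for the preceding value becomes negative
    by strict decrease, and the kernel adds the multiplicity of [lam i]. *)
Lemma eigenvalue_subspace i : (0 < i)%N -> lam i < W ^+ 2 -> 0 < W ->
  has_subspace (<= 0) (A (Num.sqrt (lam i))) i.
Proof.
move=> i0 iW W0; elim/ltn_ind: i i0 iW => i IH i0 iW; set w := Num.sqrt (lam i).
have wi : w ^+ 2 = lam i by rewrite sqr_sqrtr // lam_ge0.
have w0 : 0 <= w := sqrtr_ge0 _.
have wW : w < W by rewrite -(ltr_sqr (R := R)) ?nnegrE ?wi // ltW.
have [a [ai alt aeq]] := first_index lam_le i0.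
have := lam_mult (w := w); rewrite w0 wW wi => /(_ isT) /(multiplicity_ge aeq) le.
apply: has_subspace_leq le _; apply: has_subspace_kernel => //.
case: (posnP a) => [->|a0]; first by exists 0; rewrite // => x; rewrite submx0 => ->.
have aW := lt_trans (alt a0) iW.
apply: has_subspace_impl (IH _ ai a0 aW) => x x0.
apply: (A_decr (w := Num.sqrt (lam a))) => //.
by rewrite /w ltr_sqrt ?alt // (le_lt_trans (lam_ge0 a0)) ?alt.
Qed.

(** The positive directions also persist near [w], so a nonpositive subspace there is bounded by the
    negative index plus the nullity at [w]. *)
Lemma near_inertia w : 0 <= w < W -> exists q, has_subspace (< 0) (A w) q /\
  \forall v \near w, has_subspace (< 0) (A v) q /\
    forall k, has_subspace (<= 0) (A v) k -> (k <= q + (n - \rank (A w)))%N.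
Proof.
move=> wW; have [p [q [pq _ [e e0 H]]]] := inertia (A_sym w).
exists q; split; first by have [] := H (A w) _ => // i j; rewrite subrr normr0 ltW.
have : \forall v \near w, forall i j, `|A v i j - A w i j| <= e.
  apply: (@filter_forall R _ (fun i v => forall j, `|A v i j - A w i j| <= e) (nbhs w) (nbhs_filter w)) => i.
  apply: (@filter_forall R _ (fun j v => `|A v i j - A w i j| <= e) (nbhs w) (nbhs_filter w)) => j.
  have := @A_cont w wW i j => /cvgrPdist_le/(_ e e0).
  by apply: filterS => v; rewrite distrC.
apply: filterS => v /H[vp vq]; split=> // k vk.
have PQ (t : R) : (> 0) t -> ~~ (<= 0) t by rewrite /= ltNge.
by have := has_subspace_disjoint PQ vp vk; have := rank_leq_row (A w); rewrite -pq; lia.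
Qed.

(* Were the bound to fail, let s be the infimum of the w at which it fails.
   Below s it holds, which bounds the negative part of the inertia of A s;
   by the multiplicity of s^2 the bound then also holds on a neighbourhood
   to the right of s. *)
Lemma subspace_eigenvalue w k : 0 <= w < W -> (0 < k)%N ->
  has_subspace (<= 0) (A w) k -> lam k <= w ^+ 2.
Proof.
move=> wW k0 wk; rewrite leNgt; apply/negP => wl.
pose S := [set w | 0 <= w < W /\ exists2 k, (0 < k)%N &
  has_subspace (<= 0) (A w) k /\ w ^+ 2 < lam k].
have Sw : S w by split=> //; exists k.
have Slb : has_lbound S by exists 0 => x [/andP[]].
have Sinf : has_inf S by split=> //; exists w.
pose s := inf S.
have s0 : 0 <= s by apply: lb_le_inf; [exists w|move=> x [/andP[]]].
have sw : s <= w by apply: ge_inf.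
have sW : 0 <= s < W by rewrite s0 (le_lt_trans sw) //; case/andP: wW.
have [q [sq /nbhs_ballP[d /= d0 Hd]]] := near_inertia sW.
(* At [s = 0] the form is nonnegative, so [q = 0]. For [s > 0] the [q] negative directions persist
   slightly to the left of [s], where the bound holds. *)
have qs : (0 < q)%N -> lam q < s ^+ 2.
  move=> q0; move: s0; rewrite le_eqVlt => /predU1P[s0|s0].
    move: sq; rewrite -s0 => -[U qU UA].
    have /rowV0Pn[x xU x0] : U != 0 by rewrite -mxrank_eq0; lia.
    by have /= := UA x xU x0; rewrite ltNge A0_ge0.
  pose v := Num.max 0 (s - d / 2).
  have vs : v < s by rewrite gt_max s0 gtrBl divr_gt0.
  have v0 : 0 <= v by rewrite le_max lexx.
  have vW : 0 <= v < W by rewrite v0 (lt_trans vs) //; case/andP: sW.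
  have [|vq _] := Hd v.
    rewrite /ball /= ger0_norm ?subr_ge0 ?(ltW vs) //.
    have : s - d / 2 <= v by rewrite le_max lexx orbT.
    lra.
  apply: (@le_lt_trans _ _ (v ^+ 2)); last by rewrite ltr_sqr ?nnegrE // ltW.
  rewrite leNgt; apply/negP => vl.
  have : S v.
    split=> //; exists q => //; split=> //.
    by apply: has_subspace_impl vq => x _ /ltW.
  by move/(ge_inf Slb); rewrite leNgt vs.
(* At a failure [v] in [s, s + d), the index [l] is at most [q] plus the multiplicity of [s ^+ 2],
   so [lam l] is already at most [s ^+ 2]. *)
have [v Sv vs] := inf_adherent d0 Sinf.
have sv : s <= v by apply: ge_inf.
case: Sv => _ [l l0 [vl lamv]].
have [|_ /(_ l vl) lq] := Hd v.
  by rewrite /ball /= ler0_norm ?subr_le0 // opprB ltrBlDl.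
have qd : (0 < q + (n - \rank (A s)))%N by lia.
have := multiplicity_le lam_le qs (lam_mult sW) qd.
rewrite leNgt => /negP; apply.
apply: lt_le_trans (lam_le (m := l) _); last by rewrite l0.
by apply: le_lt_trans lamv; rewrite ler_sqr ?nnegrE // (le_trans s0).
Qed.

End SpectralFlow.

(** * Monotonicity in the frequency *)

Section Weights.
Variable R : realType.
Implicit Types (a b x l w : R).

Lemma sin_mean_value x : 0 < x -> exists2 c, 0 < c < x & sin x = x * cos c.
Proof.
move=> x0; have [c] := MVT x0 (fun y _ => is_derive_sin y) (continuous_subspaceT (@continuous_sin R)).
by rewrite in_itv /= sin0 !subr0 => cx E; exists c; rewrite // E mulrC.
Qed.

Lemma mul_cos_lt_sin x : 0 < x <= pi -> x * cos x < sin x.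
Proof.
move=> /andP[x0 xp]; have [c /andP[c0 cx] ->] := sin_mean_value x0.
have cp : c <= pi := le_trans (ltW cx) xp.
by rewrite ltr_pM2l // ltr_cos // in_itv /= ?(ltW x0) ?(ltW c0).
Qed.

Lemma sin_le x : 0 <= x -> sin x <= x.
Proof.
rewrite le_eqVlt => /predU1P[<-|x0]; first by rewrite sin0.
by have [c _ ->] := sin_mean_value x0; rewrite -[leRHS]mulr1 ler_pM2l ?cos_le1.
Qed.

(** The decrease of x cot x. With [d = b - a], a sin d > a d cos d > a d cos b >= d cos b sin a, and
    sin d expands by the subtraction formula. *)
Lemma mul_cos_sin_lt a b : 0 < a -> a < b -> b < pi / 2 ->
  b * cos b * sin a < a * cos a * sin b.
Proof.
move=> a0 ab bp; set d := b - a.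
have d0 : 0 < d by rewrite subr_gt0.
have p0 := pi_gt0 R.
have Cb : 0 < cos b by apply: cos_gt0_pihalf; lra.
have dp : 0 < d <= pi by apply/andP; split=> //; rewrite /d; lra.
have h1 := mul_cos_lt_sin dp.
have h2 : cos b < cos d by rewrite ltr_cos ?in_itv /= /d; [lra|apply/andP; lra|apply/andP; lra].
have h3 := sin_le (ltW a0).
have sd : a * sin d = a * cos a * sin b - a * cos b * sin a by rewrite sinB; ring.
have h4 : a * (d * cos d) < a * sin d by rewrite ltr_pM2l.
have h5 : d * cos b * sin a <= d * cos b * a by rewrite ler_pM2l // mulr_gt0.
have h6 : a * (d * cos b) < a * (d * cos d) by rewrite ltr_pM2l // ltr_pM2l.
have : b * cos b * sin a = a * cos b * sin a + d * cos b * sin a by rewrite /d; ring.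
have : d * cos b * a = a * (d * cos b) by ring.
lra.
Qed.

(** The eigenvalues of the matrix of a piece, on the symmetric and the antisymmetric vector: - w tan
    h and w cot h. *)
Lemma diag_offdiag_half w l (h := w * l / 2) : 0 < w -> 0 < l -> w * l < pi ->
  diag_weight w l - offdiag_weight w l = - (w * (sin h / cos h)) /\
  diag_weight w l + offdiag_weight w l = w * (cos h / sin h).
Proof.
move=> w0 l0 wl; have wl0 : 0 < w * l by rewrite mulr_gt0.
have C0 : cos h != 0 by rewrite gt_eqF // cos_gt0_pihalf // /h; lra.
have S0 : sin h != 0 by rewrite gt_eqF // sin_gt0_pi // /h; apply/andP; split; lra.
rewrite /diag_weight /offdiag_weight /sinw (gt_eqF w0).
have -> : w * l = h *+ 2 by rewrite /h -mulr_natr divfK // pnatr_eq0.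
rewrite cos_mulr2n sin_mulr2n; have := cos2Dsin2 h.
have w1 := lt0r_neq0 w0.
move: C0 S0; move: (cos h) (sin h) => C S C0 S0 CS.
have S2 : S ^+ 2 = 1 - C ^+ 2 by rewrite -CS; ring.
have D0 : (C * S) *+ 2 != 0 by rewrite mulrn_eq0 mulf_neq0.
have E2 : (C * S) *+ 2 / w != 0 by rewrite mulf_neq0 // invr_eq0.
split; apply: (mulIf E2).
  rewrite mulrBl divfK // mulVf //.
  transitivity (- (2 * S ^+ 2)); first by rewrite S2; ring.
  by field; rewrite C0 w1.
rewrite mulrDl divfK // mulVf //.
transitivity (2 * C ^+ 2); first by ring.
by field; rewrite S0 w1.
Qed.

Lemma diagB_offdiag_decr w w' l : 0 <= w -> w < w' -> 0 < l -> w' * l < pi ->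
  diag_weight w' l - offdiag_weight w' l < diag_weight w l - offdiag_weight w l.
Proof.
move=> w0 ww l0 wl; have w'0 := le_lt_trans w0 ww.
have [-> _] := diag_offdiag_half w'0 l0 wl.
have wl'0 : 0 < w' * l by rewrite mulr_gt0.
have C'0 : 0 < cos (w' * l / 2) by apply: cos_gt0_pihalf; lra.
have S'0 : 0 < sin (w' * l / 2) by apply: sin_gt0_pi; apply/andP; split; lra.
move: w0; rewrite le_eqVlt => /predU1P[<-|w0].
  rewrite /diag_weight /offdiag_weight /sinw eqxx mul0r cos0 div1r subrr oppr_lt0.
  by rewrite mulr_gt0 // divr_gt0.
have wlt : w * l < w' * l by rewrite ltr_pM2r.
have wl0 : 0 < w * l by rewrite mulr_gt0.
have [-> _] := diag_offdiag_half w0 l0 (lt_trans wlt wl).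
have C0 : 0 < cos (w * l / 2) by apply: cos_gt0_pihalf; lra.
have S0 : 0 < sin (w * l / 2) by apply: sin_gt0_pi; apply/andP; split; lra.
rewrite ltrN2; apply: ltr_pM => //; [exact: ltW|by rewrite divr_ge0 // ltW|].
rewrite ltr_pdivrMr // [ltRHS]mulrAC ltr_pdivlMr // -subr_gt0 [X in _ - X]mulrC -sinB.
by apply: sin_gt0_pi; apply/andP; split; lra.
Qed.

Lemma diagD_offdiag_decr w w' l : 0 <= w -> w < w' -> 0 < l -> w' * l < pi ->
  diag_weight w' l + offdiag_weight w' l < diag_weight w l + offdiag_weight w l.
Proof.
move=> w0 ww l0 wl; have w'0 := le_lt_trans w0 ww.
have [_ ->] := diag_offdiag_half w'0 l0 wl.
have wl'0 : 0 < w' * l by rewrite mulr_gt0.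
have S'0 : 0 < sin (w' * l / 2) by apply: sin_gt0_pi; apply/andP; split; lra.
have l20 : 0 < l / 2 by rewrite divr_gt0.
move: w0; rewrite le_eqVlt => /predU1P[<-|w0].
  rewrite /diag_weight /offdiag_weight /sinw eqxx mul0r cos0 div1r.
  rewrite mulrA ltr_pdivrMr // -(ltr_pM2l l20).
  have -> : l / 2 * ((l^-1 + l^-1) * sin (w' * l / 2)) = sin (w' * l / 2).
    by field; rewrite gt_eqF.
  have -> : l / 2 * (w' * cos (w' * l / 2)) = (w' * l / 2) * cos (w' * l / 2) by ring.
  by apply: mul_cos_lt_sin; apply/andP; split; lra.
have wlt : w * l < w' * l by rewrite ltr_pM2r.
have wl0 : 0 < w * l by rewrite mulr_gt0.
have [_ ->] := diag_offdiag_half w0 l0 (lt_trans wlt wl).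
have S0 : 0 < sin (w * l / 2) by apply: sin_gt0_pi; apply/andP; split; lra.
rewrite !(mulrA _ (cos _)) ltr_pdivrMr // [ltRHS]mulrAC ltr_pdivlMr // -(ltr_pM2l l20).
have := @mul_cos_sin_lt (w * l / 2) (w' * l / 2).
have -> : l / 2 * (w' * cos (w' * l / 2) * sin (w * l / 2)) =
  w' * l / 2 * cos (w' * l / 2) * sin (w * l / 2) by ring.
have -> : l / 2 * (w * cos (w * l / 2) * sin (w' * l / 2)) =
  w * l / 2 * cos (w * l / 2) * sin (w' * l / 2) by ring.
by apply; lra.
Qed.

Lemma edge_form_diagonal (c s x y : R) : c * (x ^+ 2 + y ^+ 2) - 2 * s * (x * y) =
  (c - s) / 2 * (x + y) ^+ 2 + (c + s) / 2 * (x - y) ^+ 2.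
Proof. by field. Qed.

Lemma edge_form_decr w w' l x y : 0 <= w -> w < w' -> 0 < l -> w' * l < pi ->
  (x != 0) || (y != 0) ->
  diag_weight w' l * (x ^+ 2 + y ^+ 2) - 2 * offdiag_weight w' l * (x * y) <
  diag_weight w l * (x ^+ 2 + y ^+ 2) - 2 * offdiag_weight w l * (x * y).
Proof.
move=> w0 ww l0 wl xy; rewrite !edge_form_diagonal.
have := diagB_offdiag_decr w0 ww l0 wl; have := diagD_offdiag_decr w0 ww l0 wl.
set b' := diag_weight w' l - _; set b := diag_weight w l - _.
set a' := diag_weight w' l + _; set a := diag_weight w l + _ => aa bb.
have : 0 < (x + y) ^+ 2 + (x - y) ^+ 2.
  have -> : (x + y) ^+ 2 + (x - y) ^+ 2 = 2 * (x ^+ 2 + y ^+ 2) by ring.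
  rewrite mulr_gt0 // lt_def addr_ge0 ?sqr_ge0 // paddr_eq0 ?sqr_ge0 //.
  by rewrite !sqrf_eq0 negb_and xy.
have := sqr_ge0 (x + y); have := sqr_ge0 (x - y).
move: ((x + y) ^+ 2) ((x - y) ^+ 2) => P Q Q0 P0 PQ.
case: (ltP 0 P) => P1.
  have : 0 < (b - b') * P by rewrite mulr_gt0 // subr_gt0.
  have : 0 <= (a - a') * Q by rewrite mulr_ge0 // subr_ge0 ltW.
  lra.
have : 0 < (a - a') * Q by rewrite mulr_gt0 ?subr_gt0 //; lra.
have : 0 <= (b - b') * P by rewrite mulr_ge0 // subr_ge0 ltW.
lra.
Qed.

Lemma edge_form0_ge0 l x y : 0 < l ->
  0 <= diag_weight 0 l * (x ^+ 2 + y ^+ 2) - 2 * offdiag_weight 0 l * (x * y).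
Proof.
move=> l0; rewrite /diag_weight /offdiag_weight /sinw eqxx mul0r cos0 div1r.
rewrite (_ : _ - _ = l^-1 * (x - y) ^+ 2); last by ring.
by rewrite mulr_ge0 ?sqr_ge0 // invr_ge0 ltW.
Qed.

Lemma sinw_neq0 w l : 0 <= w -> 0 < l -> w * l < pi -> sinw w l != 0.
Proof.
move=> w0 l0 wl; rewrite /sinw; case: (eqVneq w 0) => [_|w1]; first exact: lt0r_neq0.
have {}w0 : 0 < w by rewrite lt_def w1.
by rewrite mulf_neq0 ?invr_eq0 // lt0r_neq0 // sin_gt0_pi // mulr_gt0.
Qed.

(** At [w = 0] the limit of sin (w l) / w is the derivative of sin (w l) there, which is the value
    [l] chosen for [sinw 0 l]. *)
Lemma continuous_sinw_freq l : continuous (fun w => sinw w l).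
Proof.
have cl w : {for w, continuous (fun w => w * l)}.
  by apply: cvgM; [exact: cvg_id|exact: cvg_cst].
have cs w : {for w, continuous (fun w => sin (w * l))}.
  by apply: (continuous_comp (cl w)); exact: continuous_sin.
have nz w w' : w' != 0 -> sinw w' l = sin (w' * l) / w' by rewrite /sinw => /negbTE ->.
move=> w; case: (eqVneq w 0) => [->|w0]; last first.
  have near_nz : \forall x \near w, sin (x * l) / x = sinw x l.
    have : \forall x \near w, x != 0 by apply: (@cvgr_neq0 _ _ _ (nbhs w) (nbhs_filter w) id w) => //; exact: cvg_id.
    by apply: filterS => x x0; rewrite nz.
  rewrite /continuous_at nz //; apply: cvg_trans; first exact: (near_eq_cvg near_nz).
  by apply: cvgM; [exact: cs|apply: cvgV].
have D : is_derive (0 : R) 1 (fun w => sin (w * l)) l.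
  have h : is_derive (0 : R) 1 (fun w : R => w * l) l.
    have := is_deriveM (is_derive_id (0 : R) (1 : R)) (is_derive_cst l (0 : R) 1).
    by rewrite scaler0 add0r /GRing.scale /= mulr1.
  have := @is_derive1_comp R sin (fun y => y * l) 0 _ _ (is_derive_sin _) h.
  by rewrite mul0r cos0 mul1r.
have [D1 D2] := D; apply/continuous_withinNx.
have -> : sinw 0 l = l by rewrite /sinw eqxx.
rewrite -[X in (_ --> X)%classic]D2; apply: cvg_trans D1.
apply: near_eq_cvg.
have := @nbhs_dnbhs_neq R 0; apply: filterS => x x0.
by rewrite nz //= mul0r sin0 subr0 addr0 /GRing.scale /= mulr1 mulrC.
Qed.

End Weights.

Section Frequency.
Variables (R : realType) (G : metric_graph R) (VD : {set vert G}) (M : nat) (W : R).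
Notation step := (@step R G M).
Notation lo := (@lo (vert G) (edge G) (@endpt R G) M).
Notation hi := (@hi (vert G) (edge G) (@endpt R G) M).
Notation dnodes := (@dnodes R G VD M).
Hypothesis short : forall e, W * step e < pi.
Hypothesis has_dart : forall v : vert G, exists p, endpt p = v.

Lemma step_gt0 e : 0 < step e.
Proof. by rewrite divr_gt0 ?len_gt0. Qed.

Lemma sinw_step_neq0 w e : 0 <= w < W -> sinw w (step e) != 0.
Proof.
move=> /andP[w0 wW]; apply: sinw_neq0 => //; first exact: step_gt0.
by apply: lt_trans (short e); rewrite ltr_pM2r ?step_gt0.
Qed.

Lemma graph_mx_continuous w : 0 <= w < W ->
  forall i j, {for w, continuous (fun w => graph_mx VD M w i j)}.
Proof.
move=> wW i j.
pose a y := ((free_coord dnodes R (lo y))^T *m free_coord dnodes R (lo y) +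
  (free_coord dnodes R (hi y))^T *m free_coord dnodes R (hi y)) i j.
pose b y := ((free_coord dnodes R (lo y))^T *m free_coord dnodes R (hi y) +
  (free_coord dnodes R (hi y))^T *m free_coord dnodes R (lo y)) i j.
pose z : R := (\sum_(n in dnodes) delta_mx (enum_rank n) (enum_rank n)) i j.
rewrite (_ : (fun w => graph_mx VD M w i j) = fun w => \sum_y
    (cweight w y * a y - sweight w y * b y) + z); last first.
  apply/funext => v; rewrite /graph_mx /network_mx [LHS]mxE; congr (_ + _).
  by rewrite summxE; apply: eq_bigr => y _; rewrite /a /b !mxE.
have cS y : {for w, continuous (fun w => (sinw w (step y))^-1)}.
  by apply: cvgV; [exact: sinw_step_neq0|exact: continuous_sinw_freq].
have cC y : {for w, continuous (fun w : R => cos (w * step y))}.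
  apply: (@continuous_comp _ _ _ (fun w : R => w * step y) cos); last exact: continuous_cos.
  by apply: cvgM; [exact: cvg_id|exact: cvg_cst].
apply: cvgD; last exact: cvg_cst.
apply: cvg_big => [|y _]; first exact: add_continuous.
apply: cvgB; apply: cvgM; try exact: cvg_cst.
  by apply: cvgM; [exact: cC|exact: cS].
exact: cS.
Qed.

Lemma has_piece n : exists y, (lo y == n) || (hi y == n).
Proof.
case: n => [v|[e j]].
  have [[e []] pv] := has_dart v.
    by exists (e, ord_max); rewrite /hi node_last pv eqxx orbT.
  by exists (e, ord0); apply/orP; left; rewrite -pv; apply/eqP.
exists (e, widen_ord (leqnSn M) j).
by rewrite /hi /= node_interior eqxx orbT.
Qed.

(** A nonzero value at a free node makes the form of some piece decrease strictly. Otherwise [x]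
    lives on the Dirichlet nodes, where the form is a fixed sum of squares, and a nonpositive value
    forces [x = 0]. *)
Lemma graph_mx_decr w w' x : 0 <= w -> w < w' -> w' < W -> x != 0 ->
  qform (graph_mx VD M w) x <= 0 -> qform (graph_mx VD M w') x < 0.
Proof.
move=> w0 ww wW x0; rewrite /graph_mx !qform_network.
have edge_lt y : (free_val dnodes x (lo y) != 0) || (free_val dnodes x (hi y) != 0) ->
  cweight w' y * (free_val dnodes x (lo y) ^+ 2 + free_val dnodes x (hi y) ^+ 2) -
    2 * sweight w' y * (free_val dnodes x (lo y) * free_val dnodes x (hi y)) <
  cweight w y * (free_val dnodes x (lo y) ^+ 2 + free_val dnodes x (hi y) ^+ 2) -
    2 * sweight w y * (free_val dnodes x (lo y) * free_val dnodes x (hi y)).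
  apply: edge_form_decr => //; first exact: step_gt0.
  by apply: lt_trans (short y.1); rewrite ltr_pM2r ?step_gt0.
have edge_le y :
  cweight w' y * (free_val dnodes x (lo y) ^+ 2 + free_val dnodes x (hi y) ^+ 2) -
    2 * sweight w' y * (free_val dnodes x (lo y) * free_val dnodes x (hi y)) <=
  cweight w y * (free_val dnodes x (lo y) ^+ 2 + free_val dnodes x (hi y) ^+ 2) -
    2 * sweight w y * (free_val dnodes x (lo y) * free_val dnodes x (hi y)).
  case: (boolP ((free_val dnodes x (lo y) != 0) || (free_val dnodes x (hi y) != 0))).
    by move/edge_lt/ltW.
  by rewrite negb_or !negbK => /andP[/eqP -> /eqP ->]; rewrite !(mulr0, expr0n, addr0).
case: (boolP [exists n, free_val dnodes x n != 0]) => [/existsP[n xn]|/existsPn xn].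
  apply: lt_le_trans; rewrite ltrD2r; have [y yn] := has_piece n.
  rewrite (bigD1 y) //= [ltRHS](bigD1 y) //=; apply: ltr_leD; last by apply: ler_sum => y' _.
  by apply: edge_lt; case/orP: yn => /eqP ->; rewrite xn ?orbT.
have v0 n : free_val dnodes x n = 0 by apply/eqP/negPn/xn.
rewrite big1 ?add0r => [|y _]; last by rewrite !v0 !(mulr0, expr0n, addr0, subr0).
have D0 n : n \in dnodes -> 0 <= x 0 (enum_rank n) ^+ 2 by rewrite sqr_ge0.
move=> le; have /eqP : \sum_(n in dnodes) x 0 (enum_rank n) ^+ 2 = 0.
  by apply/eqP; rewrite eq_le le sumr_ge0.
rewrite psumr_eq0 // => /allP xD; case/negP: x0; apply/eqP/rowP => i.
rewrite -(enum_valK i) mxE; case: (boolP (enum_val i \in dnodes)) => iD.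
  by apply/eqP; rewrite -sqrf_eq0; apply: (implyP (xD _ _)); rewrite ?mem_index_enum.
by have := v0 (enum_val i); rewrite /free_val (negbTE iD).
Qed.

Lemma graph_mx0_ge0 x : 0 <= qform (graph_mx VD M 0) x.
Proof.
rewrite /graph_mx qform_network addr_ge0 ?sumr_ge0 // => [y _|n _]; last exact: sqr_ge0.
by apply: edge_form0_ge0; exact: step_gt0.
Qed.

End Frequency.

(** * Proof of the inequality *)

Section Eigenvalues.
Variables (R : realType) (G : metric_graph R) (VD : {set vert G}) (lam : nat -> R).
Hypothesis lam_eigenvalues : eigenvalue_sequence VD lam.

Lemma trivial_eigenspace mu n : (0 < n)%N ->
  (forall f, eigenspace VD mu f -> forall e x, 0 <= x <= len e -> f e x = 0) -> lam n <> mu.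
Proof.
move=> n0 E0 ln; have [_ /(_ mu)[d /(has_dimension0 E0) ->]] := lam_eigenvalues.
rewrite II0 card_eq0 => /eqP S0.
by have : [set n | (1 <= n)%N /\ lam n = mu]%classic n by []; rewrite S0.
Qed.

Lemma eigenvalue_ge0 n : (0 < n)%N -> 0 <= lam n.
Proof.
move=> n0; rewrite leNgt; apply/negP => l0.
by apply: (trivial_eigenspace (mu := lam n) n0) => // f; exact: negative_eigenspace.
Qed.

(** Functions are given edgewise, so without edges every eigenspace is trivial, whereas [lam 1] is
    an eigenvalue. *)
Lemma edge_inhabited : edge G.
Proof.
case: (pickP (@predT (edge G))) => [//|no].
have : lam 1 = lam 1 by []; case/(trivial_eigenspace _); first by [].
by move=> f _ e; have := no e.
Qed.

Lemma graph_adj u v : connect (adj (@endpt R G) predT) u v.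
Proof. exact: graph_connected. Qed.

Lemma vertex_dart (v : vert G) : exists p, endpt p = v.
Proof.
have e0 := edge_inhabited; have /connectP[[|u p] /=] := graph_adj v (endpt (e0, false)).
  by move=> _ <-; exists (e0, false).
by case/andP => /adjP[d _ [dv _]] _ _; exists d.
Qed.

(* Were the inequality to fail, there would be a frequency om with
   lam j < om^2 and (m.+1 om)^2 < lam K, K = m.+1 (j - n0). The zero counts
   would satisfy j <= n0 + C om and C (m.+1 om) < K, against
   m.+1 C om <= C (m.+1 om). *)
Lemma eigenvalue_multiple j m (n0 := (num_neumann_leaves VD + betti G)%N) :
  (forall v, v \in VD -> leaf v) -> (n0 < j)%N -> 0 < lam j ->
  lam (m.+1 * (j - n0))%N <= m.+1%:R ^+ 2 * lam j.
Proof.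
move=> VDl jn lj; rewrite leNgt; apply/negP; set K := (_ * _)%N => lK.
have j0 : (0 < j)%N := leq_ltn_trans (leq0n _) jn.
have [lam_le lam_dim] := lam_eigenvalues.
have lK0 : 0 < lam K by apply: lt_trans lK; rewrite mulr_gt0 // exprn_gt0.
pose W := Num.sqrt (lam K); have W0 : 0 < W by rewrite sqrtr_gt0.
have W2 : W ^+ 2 = lam K by rewrite sqr_sqrtr // ltW.
(* With more than [W] times the total length over pi pieces per edge, every piece is shorter than
   half a wavelength up to frequency [W]. *)
have [M short] : exists M, forall e : edge G, W * @step R G M e < pi.
  pose L := W * (\sum_(e : edge G) len e) / pi; exists (Num.Def.archi_bound L) => e.
  have L0 : 0 <= L.
    by rewrite mulr_ge0 ?invr_ge0 ?pi_ge0 // mulr_ge0 ?(ltW W0) // sumr_ge0 // => e' _; exact: len_ge0.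
  have := archi_boundP L0; rewrite /L ltr_pdivrMr ?pi_gt0 // => lt.
  rewrite /step mulrA ltr_pdivrMr // mulrC; apply: (@le_lt_trans _ _ (W * \sum_(e : edge G) len e)).
    rewrite mulrC ler_pM2l // (bigD1 e) //= lerDl sumr_ge0 // => e' _; exact: len_ge0.
  apply: lt_le_trans lt _; rewrite mulrC ler_pM2l ?pi_gt0 // ler_nat; exact: leqnSn.
have lam_mult w : 0 <= w < W ->
    ([set n | (1 <= n)%N /\ lam n = (w ^+ 2)%R] #=
     `I_(#|{: vert G + edge G * 'I_M}| - \rank (graph_mx VD M w)))%card.
  move=> wW; have [d dd] := lam_dim (w ^+ 2).
  rewrite (eigenspace_dim (M := M) _ _ dd) //; last exact: vertex_dart.
  by move=> e; exact: sinw_step_neq0 short _ _ wW.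
have [D [ori [par [rk [VDD Dcard [h1 h2 h3 h4]]]]]] :=
  oriented_cut graph_adj edge_inhabited VDl.
have [out [rk' [VDD' Dcard' S1 [S2 S3 S4]]]] :=
  @subdivided_orientation _ _ _ M VD D ori par rk VDD h1 h2 h3 h4.
pose src (y : edge G * 'I_M.+1) := if ori y.1 then hi (@endpt R G) y else lo (@endpt R G) y.
pose tgt (y : edge G * 'I_M.+1) := if ori y.1 then lo (@endpt R G) y else hi (@endpt R G) y.
have in_piece w : w \notin [set inl v | v in D] -> exists y, tgt y == w.
  by move=> /S3[y yw]; exists y; rewrite yw.
have len_gt0 (y : edge G * 'I_M.+1) : 0 < @step R G M y.1 by exact: step_gt0.
(* The negated inequality is what makes this interval of frequencies nonempty. *)
have al_be : 0 <= Num.sqrt (lam j) < W / m.+1%:R.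
  rewrite sqrtr_ge0 ltr_pdivlMr // -ltr_sqr ?nnegrE ?mulr_ge0 ?sqrtr_ge0 //.
  by rewrite W2 exprMn sqr_sqrtr ?ltW // mulrC.
have [om /andP[jom omW] gen] := @generic_frequency R _ _ src tgt _ _ rk' len_gt0 in_piece _ _ m al_be.
have om0 : 0 < om by case/andP: al_be => /le_lt_trans/(_ jom).
have Mom : m.+1%:R * om < W by rewrite mulrC -ltr_pdivlMr.
have Mom0 : 0 < m.+1%:R * om by rewrite mulr_gt0.
have omW' : om < W.
  by apply: le_lt_trans Mom; rewrite ler_peMl ?ler1n // ltW.
have short' w y : w < W -> w * @step R G M y.1 < pi.
  by move=> wW; apply: lt_trans (short y.1); rewrite ltr_pM2r ?step_gt0.
have mxE w : network_mx src tgt [set inl v | v in VD] (fun y => diag_weight w (@step R G M y.1))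
    (fun y => offdiag_weight w (@step R G M y.1)) = graph_mx VD M w.
  exact: network_mx_swap.
have jK : (0 < K)%N by rewrite muln_gt0 subn_gt0 jn.
have neg_j : has_subspace (< 0) (graph_mx VD M om) j.
  have ljK : lam j < W ^+ 2.
    by rewrite W2; apply: le_lt_trans lK; rewrite ler_peMl ?(ltW lj) // exprn_ege1 // ler1n.
  have decr := @graph_mx_decr R G VD M W short vertex_dart.
  have := eigenvalue_subspace (fun w => network_mx_sym _ _ _ _ _) decr lam_le eigenvalue_ge0
    lam_mult j0 ljK W0.
  apply: has_subspace_impl => x x0; apply: decr => //; exact: sqrtr_ge0.
have jC : (j <= n0 + zero_count src tgt [set inl v | v in D] (fun y => @step R G M y.1) rk' om)%N.
  rewrite -mxE in neg_j.
  have := @leq_zero_count R _ _ src tgt _ _ _ _ _ VDD' len_gt0 S1 S2 S4 om om0 (fun y => short' _ om y omW')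
    (fun y => (gen y).1) j neg_j.
  move=> /leq_trans; apply.
  by rewrite leq_add2r Dcard'.
have CM := @zero_countM R _ _ src tgt _ _ rk' len_gt0 in_piece _ m (ltW om0).
have := @zero_count_subspace R _ _ src tgt _ _ _ _ _ VDD' len_gt0 S1 S2 S4 _ Mom0 (fun y => short' _ _ y Mom)
  (fun y => (gen y).2).
rewrite mxE; move: CM; set C := zero_count _ _ _ _ _ (_ * _) => CM hC.
have KC : (K <= C)%N.
  by apply: leq_trans CM; rewrite leq_pmul2l // leq_subLR.
have := subspace_eigenvalue (fun w => network_mx_sym _ _ _ _ _) (@graph_mx_continuous R G VD M W short)
   (@graph_mx0_ge0 R G VD M) lam_le lam_mult (w := m.+1%:R * om) (k := C).
rewrite (ltW Mom0) Mom => /(_ isT (leq_trans jK KC) hC).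
rewrite leNgt => /negP; apply; apply: lt_le_trans (lam_le K C _); last by rewrite jK.
by rewrite -W2 ltr_sqr // nnegrE ltW.
Qed.

End Eigenvalues.

Theorem theorem1p8 (R : realType) (G : metric_graph R) (VD : {set vert G})
  (VD_leaves : forall v, v \in VD -> leaf v)
  (lam : nat -> R) (lam_eigenvalues : eigenvalue_sequence VD lam)
  (k j : nat) (kj : (j < k)%N)
  (hj : (num_neumann_leaves VD + betti G + 1 <= j)%N) :
  lam k / lam j <=
    4 * (k%:R ^+ 2 / (j%:R - (num_neumann_leaves VD + betti G)%:R) ^+ 2).
Proof.
set n0 := (num_neumann_leaves VD + betti G)%N in hj *.
have j0 : (0 < j)%N by lia.
have rhs0 : 0 <= 4 * (k%:R ^+ 2 / (j%:R - n0%:R) ^+ 2) :> R.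
  by rewrite mulr_ge0 // divr_ge0 // sqr_ge0.
(* For [lam j = 0] the quotient is 0 by convention. *)
have := eigenvalue_ge0 lam_eigenvalues j0; rewrite le_eqVlt => /predU1P[<-|lj].
  by rewrite invr0 mulr0.
have [lam_le _] := lam_eigenvalues.
pose J := (j - n0)%N; have J0 : (0 < J)%N by rewrite /J; lia.
rewrite -natrB; last by lia.
rewrite -/J ler_pdivrMr //.
(* The remainder of 2k modulo [J] is less than [J <= k], so [q * J] lies between k and 2k. *)
pose q := (2 * k %/ J)%N.
have qJ : (q * J <= 2 * k)%N := leq_trunc_div _ _.
have kq : (k <= q * J)%N.
  by have := divn_eq (2 * k) J; have := ltn_pmod (2 * k) J0; rewrite -/q; lia.
have q0 : (0 < q)%N by move: kq; case: q {qJ} => //; rewrite mul0n; lia.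
apply: le_trans (lam_le k (q * J)%N _) _; first by rewrite kq andbT; lia.
apply: le_trans (_ : q%:R ^+ 2 * lam j <= _).
  by rewrite -(prednK q0); apply: (eigenvalue_multiple lam_eigenvalues) => //; lia.
rewrite ler_pM2r // mulrA ler_pdivlMr ?exprn_gt0 ?ltr0n // -exprMn -natrM.
have -> : 4 * k%:R ^+ 2 = (2 * k)%:R ^+ 2 :> R by rewrite natrM; ring.
by rewrite ler_sqr ?nnegrE // ler_nat.
Qed.
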